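(* Assume $|\chi|=\bar s<\infty$, let $s$ be the order of $q=\chi^{-1}(a)$, so $\bar s=ss'$ with $s'\ge1$, and let $\xi\in k$ be a root of unity of order $s'$. Let $X=\{y,z\}\cup\{x_{[\alpha]}\mid[\alpha]\in k^\times/\langle\xi\rangle\}$ and let $\mathbb Z[X]$ be the polynomial ring over $\mathbb Z$ in the commuting variables $X$. For $\lambda\in\hat G$ let $r\mapsto r^\lambda$ be the ring automorphism of $\mathbb Z[X]$ with $y^\lambda=y$, $z^\lambda=z$, $x_{[\alpha]}^\lambda=x_{[\lambda(a)^s\alpha]}$; this is a right action of $\hat G$. Let $\mathbb Z[X]\sharp\hat G$ be the skew group ring: a free right $\mathbb Z[X]$-module with basis $\hat G$ and multiplication $(\lambda r)(\sigma t)=(\lambda\sigma)(r^\sigma t)$ for $\lambda,\sigma\in\hat G$, $r,t\in\mathbb Z[X]$ (containing $\hat G$ and $\mathbb Z[X]$ via $\lambda=\lambda 1$, $r=\varepsilon r$). Let $J$ be the two-sided ideal of $\mathbb Z[X]\sharp\hat G$ generated by the elements $$y^{s}-(1+\chi)\sum_{i=0}^{[\frac{s-1}{2}]}(-1)^i\binom{s-1-i}{i}\chi^iy^{s-1-2i}-\sum_{1\le i\le[\frac{s-1}{2}]}\sum_{j=0}^{[\frac{s-2i-1}{2}]}(-1)^j\frac{s-2i}{s-i}\binom{s-1}{i}\binom{s-2i-1-j}{j}\chi^{i+j}y^{s-2i-2j},$$ $\chi x_{[\alpha]}-x_{[\alpha]}$, $yx_{[\alpha]}-2x_{[\alpha]}$,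 $x_{[\alpha]}x_{[\beta]}-\sum_{i=0}^{s'-1}s\,x_{[\alpha+\beta\xi^i]}$ (for $[\beta]\ne[-\alpha]$), and $$x_{[\alpha]}x_{[-\alpha]}-\sum_{1\le i\le s'-1}s\,x_{[(1-\xi^i)\alpha]}-\sum_{i=0}^{\bar s-1}\sum_{j=0}^{[\frac{s-1}{2}]}(-1)^j\binom{s-1-j}{j}\chi^iy^{s-1-2j},$$ for all $[\alpha],[\beta]\in k^\times/\langle\xi\rangle$. Then the Green ring $r(\mathcal W)$ is isomorphic to $(\mathbb Z[X]\sharp\hat G)/J$, via the map sending $\lambda\in\hat G$ to $[V_1(\lambda)]$, $y\mapsto[V_2(\varepsilon)]$, $z\mapsto[V_{s+1}(\varepsilon)]$, $x_{[\alpha]}\mapsto[V_1(\varepsilon,\alpha^{s'})]$.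
   Context: Let $k$ be an algebraically closed field of characteristic zero, $G$ a group, $a$ a central element of $G$, $\hat G$ the group of characters $G\to k^\times$ with identity $\varepsilon$, and $\chi\in\hat G$ with $\chi(a)\ne1$. $H=kG(\chi^{-1},a,0)$ is the Hopf algebra generated by the group $G$ and $x$ with $xg=\chi^{-1}(g)gx$, $\Delta(g)=g\otimes g$, $\Delta(x)=x\otimes a+1\otimes x$; tensor products of modules: $g(m\otimes n)=gm\otimes gn$, $x(m\otimes n)=xm\otimes an+m\otimes xn$. $V_t(\lambda)$ ($\lambda\in\hat G$, $t\ge1$) has basis $m_0,\dots,m_{t-1}$ with $gm_i=\chi^i(g)\lambda(g)m_i$, $xm_i=m_{i+1}$ ($i\le t-2$), $xm_{t-1}=0$. For $|\chi|=\bar s<\infty$, $\lambda\in\hat G$, $\beta\in k$, $t\ge1$, $V_t(\lambda,\beta)$ has basis $m_0,\dots,m_{t\bar s-1}$ with $gm_i=\chi^i(g)\lambda(g)m_i$, $xm_i=m_{i+1}$ ($i\le t\bar s-2$), $xm_{t\bar s-1}=\sum_{j=0}^{t-1}\alpha_jm_{j\bar s}$ where $(Y-\beta)^t=Y^t-\sum_{j=0}^{t-1}\alpha_jY^j$. $\mathcal W$ is the category of finite-dimensional weight $H$-modules (direct sums of $M_{(\lambda)}=\{v:gv=\lambda(g)v\ \forall g\}$), and $r(\mathcal W)$ its Green ring (abelian group on isoclasses modulo $[U\oplus V]=[U]+[V]$, product $[U][V]=[U\otimes V]$). $[r]$ is the integer part; empty sums are $0$; $[\alpha]$ is the class of $\alpha$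 in $k^\times/\langle\xi\rangle$. *)

(* Defs.v *)
From HB Require Import structures.
From mathcomp Require Import all_boot all_algebra.
From mathcomp Require Import boolp classical_sets.
From mathcomp.real_closed Require Import mxtens.
From Stdlib Require List.
Set Implicit Arguments.
Unset Strict Implicit.
Unset Printing Implicit Defensive.
Import GRing.Theory.
Local Open Scope ring_scope.

Definition is_character (k : fieldType) (G : groupType) (l : G -> k) : Prop :=
  (forall g, l g != 0) /\ (forall g h, l (g * h)%g = l g * l h).

Definition chr_one (k : fieldType) (G : Type) : G -> k := fun _ => 1.
Definition chr_mul (k : fieldType) (G : Type) (l m : G -> k) : G -> k :=
  fun g => l g * m g.
Definition chr_pow (k : fieldType) (G : Type) (l : G -> k) (n : nat) : G -> k :=
  fun g => l g ^+ n.

Definition chr_order (k : fieldType) (G : groupType) (l : G -> k) (n : nat) : Prop :=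
  (0 < n)%N /\ chr_pow l n = @chr_one k G /\
  (forall m, (0 < m < n)%N -> chr_pow l m <> @chr_one k G).

(* Finite-dimensional H-modules, H = kG(chi^{-1}, a, 0).                *)
(* A module is k^n (column vectors) with the action of each g in G and  *)
(* of x given by n x n matrices.                                        *)

Record hmod (k : fieldType) (G : Type) := HMod {
  hdim : nat;
  hg : G -> 'M[k]_hdim;
  hx : 'M[k]_hdim
}.

(* M is an H-module (G acts, and x g = chi^{-1}(g) g x) which is a weight
   module, i.e. a direct sum of weight spaces M_(lambda): it has a basis of
   common eigenvectors for all g in G. *)
Definition is_wmod (k : fieldType) (G : groupType) (chi : G -> k)
    (M : hmod k G) : Prop :=
  hg M 1%g = 1%:M /\
  (forall g h, hg M (g * h)%g = hg M g *m hg M h) /\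
  (forall g, hx M *m hg M g = (chi g)^-1 *: (hg M g *m hx M)) /\
  exists P : 'M[k]_(hdim M), P \in unitmx /\
    exists mu : 'I_(hdim M) -> G -> k,
      forall i g, hg M g *m col i P = mu i g *: col i P.

Definition hdsum (k : fieldType) (G : Type) (M N : hmod k G) : hmod k G :=
  @HMod k G (hdim M + hdim N)
    (fun g => block_mx (hg M g) 0 0 (hg N g))
    (block_mx (hx M) 0 0 (hx N)).

Definition htens (k : fieldType) (G : Type) (a : G) (M N : hmod k G) : hmod k G :=
  @HMod k G (hdim M * hdim N)
    (fun g => hg M g *t hg N g)
    (hx M *t hg N a + 1%:M *t hx N).

Definition hiso (k : fieldType) (G : Type) (M N : hmod k G) : Prop :=
  exists (F : 'M[k]_(hdim N, hdim M)) (F' : 'M[k]_(hdim M, hdim N)),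
    F' *m F = 1%:M /\ F *m F' = 1%:M /\
    (forall g, F *m hg M g = hg N g *m F) /\ F *m hx M = hx N *m F.

(* V_t(lambda): basis m_0..m_{t-1}, g m_i = chi^i(g) lambda(g) m_i,
   x m_i = m_{i+1}, x m_{t-1} = 0 *)
Definition Vt (k : fieldType) (G : Type) (chi : G -> k) (t : nat) (l : G -> k)
  : hmod k G :=
  @HMod k G t
    (fun g => \matrix_(i < t, j < t) ((i == j)%:R * (chi g ^+ i * l g)))
    (\matrix_(i < t, j < t) (i == j.+1 :> nat)%:R).

(* alpha_j with (Y - beta)^t = Y^t - sum_{j<t} alpha_j Y^j *)
Definition alpha_coef (k : fieldType) (t : nat) (beta : k) (j : nat) : k :=
  - (('X - beta%:P) ^+ t)`_j.

(* V_t(lambda, beta) for |chi| = sb: basis m_0..m_{t sb - 1},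
   g m_i = chi^i(g) lambda(g) m_i, x m_i = m_{i+1} (i <= t sb - 2),
   x m_{t sb - 1} = sum_{j<t} alpha_j m_{j sb} *)
Definition Vtb (k : fieldType) (G : Type) (chi : G -> k) (sb t : nat)
  (l : G -> k) (beta : k) : hmod k G :=
  @HMod k G (t * sb)
    (fun g => \matrix_(i < t * sb, j < t * sb) ((i == j)%:R * (chi g ^+ i * l g)))
    (\matrix_(i < t * sb, j < t * sb)
        ((i == j.+1 :> nat)%:R +
         ((j.+1 == t * sb)%N && (sb %| i)%N)%:R * alpha_coef t beta (i %/ sb)%N)).

(* Green ring r(W): formal Z-combinations of weight modules, modulo the  *)
(* subgroup generated by [U]-[U'] (U ~= U') and [U(+)V]-[U]-[V].         *)

Definition fsum (k : fieldType) (G : Type) := seq (int * hmod k G).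

Definition coefR (k : fieldType) (G : Type) (f : fsum k G) (M : hmod k G) : int :=
  \sum_(t <- f | `[< t.2 = M >]) t.1.

Definition valid_fsum (k : fieldType) (G : groupType) (chi : G -> k)
    (f : fsum k G) : Prop :=
  forall t, List.In t f -> is_wmod chi t.2.

Definition indic (P : Prop) : int := (nat_of_bool `[< P >])%:Z.

Definition greenEq (k : fieldType) (G : groupType) (chi : G -> k)
    (f g : fsum k G) : Prop :=
  exists (I D : seq (int * (hmod k G * hmod k G))),
    (forall t, List.In t I ->
       [/\ is_wmod chi t.2.1, is_wmod chi t.2.2 & hiso t.2.1 t.2.2]) /\
    (forall t, List.In t D -> is_wmod chi t.2.1 /\ is_wmod chi t.2.2) /\
    forall M, coefR f M - coefR g M =
       \sum_(t <- I) t.1 * (indic (t.2.1 = M) - indic (t.2.2 = M)) +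
       \sum_(t <- D) t.1 * (indic (hdsum t.2.1 t.2.2 = M)
                            - indic (t.2.1 = M) - indic (t.2.2 = M)).

Definition grmul (k : fieldType) (G : Type) (a : G) (f g : fsum k G) : fsum k G :=
  [seq (t.1 * u.1, htens a t.2 u.2) | t <- f, u <- g].

(* X = {y, z} u {x_[alpha] | [alpha] in k^x/<xi>}; a class [alpha] is the *)
(* coset alpha<xi> (a subset of k^x).                                    *)

Inductive var (k : Type) := VY | VZ | VX of set k.
Arguments VY {k}. Arguments VZ {k}.

(* [alpha] = alpha <xi> (xi is a root of unity) *)
Definition xclass (k : fieldType) (xi al : k) : set k :=
  [set b | exists i : nat, b = xi ^+ i * al].

Definition valid_var (k : fieldType) (xi : k) (v : var k) : Prop :=
  match v with
  | VX C => exists al, al != 0 /\ C = xclass xi al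
  | _ => True
  end.

(* x_[alpha]^lambda = x_[c alpha] with c = lambda(a)^s; y, z fixed *)
Definition var_act (k : fieldType) (c : k) (v : var k) : var k :=
  match v with
  | VX C => VX ((fun b => c * b) @` C)
  | w => w
  end.

(* An element of Z[X] # \hat G is represented by a formal sum
   sum c . lambda . (monomial), a monomial being a list of variables
   (commuting: only the multiplicities matter). *)
Definition fskew (k : fieldType) (G : Type) :=
  seq (int * ((G -> k) * seq (var k))).

Definition valid_fskew (k : fieldType) (G : groupType) (xi : k)
    (f : fskew k G) : Prop :=
  forall t, List.In t f ->
    is_character t.2.1 /\ forall v, List.In v t.2.2 -> valid_var xi v.

Definition cnt (k : Type) (w : seq (var k)) (v : var k) : nat :=
  count (fun u => `[< u = v >]) w.

Definition coefA (k : fieldType) (G : Type) (f : fskew k G) (l : G -> k)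
    (w : seq (var k)) : int :=
  \sum_(t <- f | `[< t.2.1 = l >] && `[< forall v, cnt t.2.2 v = cnt w v >]) t.1.

Definition eqA (k : fieldType) (G : Type) (f g : fskew k G) : Prop :=
  forall l w, coefA f l w = coefA g l w.

Definition skmul (k : fieldType) (G : Type) (a : G) (s : nat)
    (f g : fskew k G) : fskew k G :=
  [seq (t.1 * u.1, (chr_mul t.2.1 u.2.1,
                    map (var_act (u.2.1 a ^+ s)) t.2.2 ++ u.2.2)) | t <- f, u <- g].

Definition skscale (k : fieldType) (G : Type) (c : int) (f : fskew k G) : fskew k G :=
  [seq (c * t.1, t.2) | t <- f].

Definition genJ1 (k : fieldType) (G : groupType) (a : G) (chi : G -> k)
    (s : nat) : fskew k G :=
  let eps := @chr_one k G in
  let S := [seq ((-1) ^+ i * ('C(s - 1 - i, i))%:Z,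
                 (chr_pow chi i, nseq (s - 1 - 2 * i) (@VY k)))
           | i <- iota 0 ((s - 1)./2).+1] in
  [:: (1, (eps, nseq s (@VY k)))]
  ++ skscale (-1) (skmul a s [:: (1, (eps, [::])); (1, (chi, [::]))] S)
  ++ skscale (-1) (flatten
       [seq [seq ((-1) ^+ j * (((s - 2 * i) * 'C(s - 1, i)) %/ (s - i))%:Z
                   * ('C(s - 2 * i - 1 - j, j))%:Z,
                  (chr_pow chi (i + j), nseq (s - 2 * i - 2 * j) (@VY k)))
            | j <- iota 0 ((s - 2 * i - 1)./2).+1]
       | i <- iota 1 ((s - 1)./2)]).

Definition genJ2 (k : fieldType) (G : groupType) (chi : G -> k) (xi al : k)
  : fskew k G :=
  [:: (1, (chi, [:: VX (xclass xi al)]));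
      (-1, (@chr_one k G, [:: VX (xclass xi al)]))].

Definition genJ3 (k : fieldType) (G : groupType) (xi al : k) : fskew k G :=
  [:: (1, (@chr_one k G, [:: VY; VX (xclass xi al)]));
      (-2, (@chr_one k G, [:: VX (xclass xi al)]))].

Definition genJ4 (k : fieldType) (G : groupType) (s s' : nat) (xi al be : k)
  : fskew k G :=
  [:: (1, (@chr_one k G, [:: VX (xclass xi al); VX (xclass xi be)]))]
  ++ [seq (- (s%:Z), (@chr_one k G, [:: VX (xclass xi (al + be * xi ^+ i))]))
     | i <- iota 0 s'].

Definition genJ5 (k : fieldType) (G : groupType) (chi : G -> k)
    (sb s s' : nat) (xi al : k) : fskew k G :=
  [:: (1, (@chr_one k G, [:: VX (xclass xi al); VX (xclass xi (- al))]))]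
  ++ [seq (- (s%:Z), (@chr_one k G, [:: VX (xclass xi ((1 - xi ^+ i) * al))]))
     | i <- iota 1 (s' - 1)]
  ++ skscale (-1) (flatten
       [seq [seq ((-1) ^+ j * ('C(s - 1 - j, j))%:Z,
                  (chr_pow chi i, nseq (s - 1 - 2 * j) (@VY k)))
            | j <- iota 0 ((s - 1)./2).+1]
       | i <- iota 0 sb]).

Definition isGenJ (k : fieldType) (G : groupType) (a : G) (chi : G -> k)
    (sb s s' : nat) (xi : k) (f : fskew k G) : Prop :=
  f = genJ1 a chi s \/
  (exists al, al != 0 /\
     [\/ f = genJ2 chi xi al, f = genJ3 G xi al | f = genJ5 chi sb s s' xi al]) \/
  (exists al be, [/\ al != 0, be != 0, xclass xi be <> xclass xi (- al)
                   & f = genJ4 G s s' xi al be]).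

Definition inJ (k : fieldType) (G : groupType) (a : G) (chi : G -> k)
    (sb s s' : nat) (xi : k) (f : fskew k G) : Prop :=
  exists L : seq (fskew k G * fskew k G * fskew k G),
    (forall t, List.In t L ->
       [/\ valid_fskew xi t.1.1, isGenJ a chi sb s s' xi t.1.2
         & valid_fskew xi t.2]) /\
    eqA f (flatten [seq skmul a s (skmul a s t.1.1 t.1.2) t.2 | t <- L]).

(* Main.v *)
(** Put T_0 = x and T_γ = x^sb - γ for γ ≠ 0. For a weight μ and n ≥ 0, the integer
    rank (T_γ^n on M_(μ)) - rank (T_γ^(n+1) on M_(μ)) is additive in M and invariant
    under isomorphism. Splitting off a generalized eigenvector of x^sb of maximal
    height shows that every weight module is a direct sum of the modules V_n(λ) and of
    the modules U_n(λ, γ) on which x^sb is a Jordan block of size n. These integers are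
    unitriangular on the indecomposables, ordered by n, so they separate the elements
    of the Green ring; they are still unitriangular on any family whose member of index
    (λ, γ, n) has the same top layer T_γ^(n-1) M.

    Two consequences are used. An identity in the Green ring can be checked on all
    additive invariants: the relations generating J then reduce to rank computations,
    and, for the relation in y alone, to V_2 ⊗ V_t = V_(t+1) + V_(t-1)(χ). And the normal
    monomials λ y^i z^j (i < s) and λ x_[α] z^j have the top layers of V_(js+i+1)(λ) and
    U_(j+1)(λ, α^s'), so their images form a basis of the Green ring. Since every
    monomial reduces modulo J to normal ones, the kernel is J and the map is onto. *)

Require Import Defs.
From mathcomp Require Import all_boot all_algebra.
From mathcomp Require Import boolp classical_sets.
From mathcomp.real_closed Require Import mxtens.
From mathcomp Require Import zify ring.
From Stdlib Require List.
Import GRing.Theory.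
Set Implicit Arguments.
Unset Strict Implicit.
Unset Printing Implicit Defensive.
Local Open Scope ring_scope.

(** * Formal sums *)

(** The relations rest on one fact. On modules whose weights are powers of [chi], [a ^ s] acts as 1,
    and the quantum binomial formula at the primitive [s]-th root of unity [chi a] makes [x ^ s] act
    on a tensor product as [x ^ s (x) 1 + 1 (x) x ^ s]. So on a product of two cyclic modules
    [x ^ s] has the eigenvalues [al xi^i + be xi^j], and the scalar [x ^ sb = (x ^ s) ^ s'] of a
    cyclic module is [al ^ s']: hence classes modulo [xi], sums over [s'] terms and the multiplicity
    [s]. The formula is symmetric, so the flip of the factors commutes with [x ^ s], but in general
    not with [x]; the eigenvalue 0, where [T_0] is [x] itself, needs separate arguments. The
    delicate case is [be = - al]: there [x] is not diagonalizable, and its ranks are squeezed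
    between the rank of [x ^ s], which is diagonalizable, and a lower bound for the rank of [x].
    Weights cost nothing in these products: an invertible cyclic factor supplies an operator that
    commutes with [x] and shifts weights by [chi], so only total ranks have to be compared. *)

Definition lin (T : Type) (phi : T -> int) (f : seq (int * T)) : int :=
  \sum_(t <- f) t.1 * phi t.2.

Section FormalSums.
Variable T : Type.
Implicit Types (phi : T -> int) (f g : seq (int * T)).

Lemma lin_nil phi : lin phi [::] = 0.
Proof. exact: big_nil. Qed.

Lemma lin_cons phi t f : lin phi (t :: f) = t.1 * phi t.2 + lin phi f.
Proof. exact: big_cons. Qed.

Lemma lin_cat phi f g : lin phi (f ++ g) = lin phi f + lin phi g.
Proof. exact: big_cat. Qed.

Lemma lin_scale phi c f : lin phi [seq (c * t.1, t.2) | t <- f] = c * lin phi f.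
Proof. by rewrite /lin big_map mulr_sumr; apply: eq_bigr => t _; rewrite mulrA. Qed.

Lemma lin_flatten phi (L : seq (seq (int * T))) :
  lin phi (flatten L) = \sum_(f <- L) lin phi f.
Proof.
by elim: L => [|f L IH] /=; rewrite ?big_nil ?lin_nil // lin_cat IH big_cons.
Qed.

Lemma eq_lin_In phi phi' f :
  (forall t, List.In t f -> phi t.2 = phi' t.2) -> lin phi f = lin phi' f.
Proof.
elim: f => [|t f IH] H; first by rewrite !lin_nil.
by rewrite !lin_cons (H t) ?IH //=; [move=> u Hu; apply: H; right | left].
Qed.

(** Induction on the length, removing the whole class of the head: [phi] is constant on it and its
    coefficients sum to zero, so it contributes nothing, and the remaining list still satisfies the
    hypothesis. *)
Lemma lin_group (R : T -> T -> Prop) phi f :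
  (forall x, R x x) ->
  (forall x y, R x y -> phi x = phi y) ->
  (forall x, \sum_(t <- f | `[< R t.2 x >]) t.1 = 0) ->
  (forall x y z, R x y -> R y z -> R x z) ->
  (forall x y, R x y -> R y x) -> lin phi f = 0.
Proof.
move=> Rxx Rphi + Rt Rs.
have [n le_n] := ubnP (size f); elim: n f le_n => // n IH [|t f] le_n H.
  by rewrite lin_nil.
rewrite /lin (bigID (fun u => `[< R u.2 t.2 >])) /=.
rewrite [X in X + _](_ : _ = (\sum_(u <- t :: f | `[< R u.2 t.2 >]) u.1) * phi t.2).
  rewrite H mul0r add0r -big_filter; apply: IH.
    rewrite /= (_ : `[< R t.2 t.2 >] = true) /=; last exact/asboolP.
    by rewrite size_filter (leq_ltn_trans (count_size _ _)).
  move=> x; rewrite big_filter_cond.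
  have [Rtx|nRtx] := pselect (R t.2 x).
    rewrite big1 // => u /andP [/negP Ru /asboolP Rux]; case: Ru.
    by apply/asboolP; apply: Rt Rux (Rs _ _ Rtx).
  rewrite -{2}(H x); apply: eq_bigl => u.
  case: (asboolP (R u.2 x)) => Rux; rewrite ?andbF ?andbT //.
  by apply/negP => /asboolP Rut; apply: nRtx; apply: Rt Rux; apply: Rs.
rewrite mulr_suml; apply: eq_bigr => u /asboolP Ru.
by rewrite (Rphi _ _ Ru).
Qed.

(** Converts equality of coefficients into equality of all pairings [lin phi], the form in which
    formal sums are compared from here on. The relation [R] is equality for modules and equality of
    multisets for monomials. *)
Lemma lin_eq_group (R : T -> T -> Prop) f g :
  (forall x, R x x) ->
  (forall x y z, R x y -> R y z -> R x z) -> (forall x y, R x y -> R y x) ->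
  (forall x, \sum_(t <- f | `[< R t.2 x >]) t.1 =
             \sum_(t <- g | `[< R t.2 x >]) t.1) ->
  forall phi, (forall x y, R x y -> phi x = phi y) -> lin phi f = lin phi g.
Proof.
move=> Rxx Rt Rs H phi Rphi.
have: lin phi (f ++ [seq (-1 * t.1, t.2) | t <- g]) = 0.
  apply: (@lin_group R) => // x; rewrite big_cat big_map /= H.
  rewrite [X in _ + X](eq_bigr (fun t => - t.1)).
    by rewrite sumrN subrr.
  by move=> t _; rewrite mulN1r.
by rewrite lin_cat lin_scale mulN1r => /eqP; rewrite subr_eq0 => /eqP.
Qed.

(** The function [phi] minus its value concentrated at [x0] pairs to zero with [f]: once the terms
    where it vanishes are dropped, all remaining coefficients are zero. This isolates one
    coefficient in a triangular system. *)
Lemma lin_single phi f x0 :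
  (forall x, phi x <> 0 -> x = x0 \/ \sum_(t <- f | `[< t.2 = x >]) t.1 = 0) ->
  lin phi f = (\sum_(t <- f | `[< t.2 = x0 >]) t.1) * phi x0.
Proof.
move=> H; set c := \sum_(t <- f | _) _.
pose psi x := phi x - indic (x = x0) * phi x0.
have ind_eq x : indic (x = x) = 1 by rewrite /indic (asboolT (erefl x)).
have psi0 : lin psi f = 0.
  pose f' := [seq t <- f | `[< psi t.2 <> 0 >]].
  have -> : lin psi f = lin psi f'.
    rewrite /lin big_filter [RHS]big_mkcond; apply: eq_bigr => t _.
    by case: asboolP => // /contrapT ->; rewrite mulr0.
  apply: (@lin_group eq) => // [x y ->//|x|x y z -> ->//].
  rewrite big_filter_cond.
  have [px0|px] := pselect (psi x = 0).
    by rewrite big1 // => t /andP [/asboolP tn /asboolP tx]; case: tn; rewrite tx.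
  rewrite (eq_bigl (fun t => `[< t.2 = x >])); last first.
    move=> t; case: (asboolP (t.2 = x)) => [->|]; rewrite ?andbF ?andbT //.
    exact/asboolP.
  have xx0 : x <> x0.
    by move=> e; apply: px; rewrite /psi e ind_eq mul1r subrr.
  have: phi x <> 0.
    move=> e; apply: px; rewrite /psi e /indic asboolF // ?mul0r ?subrr //.
  by case/H.
have: lin psi f = lin phi f - c * phi x0.
  rewrite /lin /psi /c mulr_suml [X in _ - X]big_mkcond /= -sumrB.
  apply: eq_bigr => t _; rewrite /indic.
  by case: asboolP => _; rewrite ?mul1r ?mul0r ?subr0 // mulrBr.
by rewrite psi0 => /eqP; rewrite eq_sym subr_eq0 => /eqP.
Qed.

End FormalSums.

Lemma lin_map (T U : Type) (h : T -> U) (phi : U -> int) (f : seq (int * T)) :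
  lin phi [seq (t.1, h t.2) | t <- f] = lin (phi \o h) f.
Proof. by rewrite /lin big_map. Qed.

Lemma lin_allpairs (T U V : Type) (h : T -> U -> V) (phi : V -> int) f g :
  lin phi [seq (t.1 * u.1, h t.2 u.2) | t <- f, u <- g] =
  lin (fun x => lin (fun y => phi (h x y)) g) f.
Proof.
rewrite /lin big_allpairs_dep; apply: eq_bigr => t _.
by rewrite mulr_sumr; apply: eq_bigr => u _ /=; rewrite mulrA.
Qed.

Lemma lin_exchange (T U : Type) (h : T -> U -> int) f g :
  lin (fun x => lin (h x) g) f = lin (fun y => lin (h^~ y) f) g.
Proof.
rewrite /lin (eq_bigr (fun t : int * T => \sum_(u <- g) t.1 * (u.1 * h t.2 u.2))).
  rewrite exchange_big; apply: eq_bigr => u _; rewrite mulr_sumr.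
  by apply: eq_bigr => t _; rewrite mulrCA.
by move=> t _; rewrite mulr_sumr.
Qed.

Lemma sum_In (T : Type) (L : seq T) (F : T -> int) :
  (forall t, List.In t L -> F t = 0) -> \sum_(t <- L) F t = 0.
Proof.
elim: L => [|t L IH] H; first by rewrite big_nil.
by rewrite big_cons H ?IH ?addr0 //=; [move=> u Hu; apply: H; right | left].
Qed.

Lemma List_In_map (T U : Type) (h : T -> U) (L : seq T) u :
  List.In u (map h L) -> exists2 t, List.In t L & u = h t.
Proof.
elim: L => //= t L IH [<-|/IH [t' ? ?]]; first by exists t => //; left.
by exists t' => //; right.
Qed.

Lemma List_In_cat (T : Type) (L M : seq T) u :
  List.In u (L ++ M) <-> List.In u L \/ List.In u M.
Proof.
elim: L => [|t L IH] /=; first by split; [right|case].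
rewrite IH; tauto.
Qed.

Lemma List_In_allpairs (T U V : Type) (h : T -> U -> V) L M v :
  List.In v [seq h t u | t <- L, u <- M] ->
  exists t u, [/\ List.In t L, List.In u M & v = h t u].
Proof.
elim: L => [//|t L IH] H.
have [H'|H'] : List.In v [seq h t u | u <- M] \/ List.In v [seq h t u | t <- L, u <- M].
  exact/List_In_cat.
  by have [u uM ->] := List_In_map H'; exists t, u; split=> //; left.
by have [t' [u [tL uM ->]]] := IH H'; exists t', u; split=> //; right.
Qed.

(** * The Green group and its additive functionals *)

Section Green.
Variables (k : fieldType) (G : groupType) (chi : G -> k).
Implicit Types (f g h : fsum k G) (M N U V : hmod k G) (phi : hmod k G -> int).
Notation wmod := (is_wmod chi).

Lemma coefRE f M : coefR f M = lin (fun N => indic (N = M)) f.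
Proof.
rewrite /coefR /lin big_mkcond; apply: eq_bigr => t _.
by rewrite /indic; case: asboolP => _; rewrite ?mulr1 ?mulr0.
Qed.

Lemma greenEqP f g :
  greenEq chi f g <->
  exists (I D : seq (int * (hmod k G * hmod k G))),
    [/\ forall t, List.In t I -> [/\ wmod t.2.1, wmod t.2.2 & hiso t.2.1 t.2.2],
        forall t, List.In t D -> wmod t.2.1 /\ wmod t.2.2
      & forall phi, lin phi f - lin phi g =
       \sum_(t <- I) t.1 * (phi t.2.1 - phi t.2.2) +
       \sum_(t <- D) t.1 * (phi (hdsum t.2.1 t.2.2) - phi t.2.1 - phi t.2.2)].
Proof.
split=> [[I [D [HI [HD H]]]]|[I [D [HI HD H]]]]; exists I, D; split=> //; last first.
  by split=> // M; rewrite !coefRE H.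
move=> phi.
(* [L] lists the opposites of [g] and of all the relations, so every coefficient of [f ++ L] is
   zero, and then so is every pairing. *)
pose L := [seq (-1 * t.1, t.2) | t <- g]
  ++ (flatten [seq [:: (- t.1, t.2.1); (t.1, t.2.2)] | t <- I]
  ++ flatten [seq [:: (- t.1, hdsum t.2.1 t.2.2); (t.1, t.2.1); (t.1, t.2.2)] | t <- D]).
have linL psi : lin psi L = - lin psi g - (\sum_(t <- I) t.1 * (psi t.2.1 - psi t.2.2) +
       \sum_(t <- D) t.1 * (psi (hdsum t.2.1 t.2.2) - psi t.2.1 - psi t.2.2)).
  rewrite /L !lin_cat lin_scale mulN1r !lin_flatten !big_map opprD -!sumrN.
  congr (_ + (_ + _)); apply: eq_bigr => t _; rewrite !lin_cons lin_nil /=; ring.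
have: lin phi (f ++ L) = lin phi [::].
  apply: (@lin_eq_group _ eq) => // [x y z -> ->//|M|x y ->//].
  rewrite big_nil -/(coefR (f ++ L) M) coefRE lin_cat linL.
  by rewrite -!coefRE -H; ring.
rewrite lin_cat linL lin_nil => E.
by apply/eqP; rewrite -subr_eq0 -[X in _ == X]E addrA.
Qed.

(** These are the functions that descend to homomorphisms from the Green group to the integers. *)
Definition functional phi :=
  (forall U V, wmod U -> wmod V -> hiso U V -> phi U = phi V) /\
  (forall U V, wmod U -> wmod V -> phi (hdsum U V) = phi U + phi V).

Lemma green_functional f g phi :
  greenEq chi f g -> functional phi -> lin phi f = lin phi g.
Proof.
move=> /greenEqP [I [D [HI HD H]]] [Piso Pdsum].
apply/eqP; rewrite -subr_eq0 H !sum_In ?addr0 // => t.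
  by move/HD => [? ?]; rewrite Pdsum // -addrA -opprD subrr mulr0.
by move/HI => [? ? ?]; rewrite (Piso _ t.2.2) // subrr mulr0.
Qed.

Lemma green_lin f g : (forall phi, lin phi f = lin phi g) -> greenEq chi f g.
Proof.
move=> H; apply/greenEqP; exists [::], [::]; split=> // phi.
by rewrite H !big_nil subrr addr0.
Qed.

Lemma green_refl f : greenEq chi f f.
Proof. exact: green_lin. Qed.

Lemma green_sym f g : greenEq chi f g -> greenEq chi g f.
Proof.
move=> /greenEqP [I [D [HI HD H]]]; apply/greenEqP.
exists [seq (- t.1, t.2) | t <- I], [seq (- t.1, t.2) | t <- D]; split.
- by move=> t Ht; have [u uI ->] := List_In_map Ht; exact: (HI u).
- by move=> t Ht; have [u uD ->] := List_In_map Ht; exact: (HD u).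
move=> phi; rewrite !big_map -opprB H opprD -!sumrN.
by congr (_ + _); apply: eq_bigr => t _; rewrite mulNr.
Qed.

Lemma green_cat f f' g g' :
  greenEq chi f f' -> greenEq chi g g' -> greenEq chi (f ++ g) (f' ++ g').
Proof.
move=> /greenEqP [I [D [HI HD H]]] /greenEqP [I' [D' [HI' HD' H']]].
apply/greenEqP; exists (I ++ I'), (D ++ D'); split.
- by move=> t /List_In_cat [/HI|/HI'].
- by move=> t /List_In_cat [/HD|/HD'].
move=> phi; rewrite !lin_cat !big_cat opprD addrACA H H' /=; ring.
Qed.

Lemma green_trans f g h : greenEq chi f g -> greenEq chi g h -> greenEq chi f h.
Proof.
move=> Hfg Hgh; have /greenEqP [I [D [HI HD H]]] := green_cat Hfg Hgh.
apply/greenEqP; exists I, D; split=> // phi; rewrite -H !lin_cat; ring.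
Qed.

Lemma green_scale c f g : greenEq chi f g ->
  greenEq chi [seq (c * t.1, t.2) | t <- f] [seq (c * t.1, t.2) | t <- g].
Proof.
move=> /greenEqP [I [D [HI HD H]]]; apply/greenEqP.
exists [seq (c * t.1, t.2) | t <- I], [seq (c * t.1, t.2) | t <- D]; split.
- by move=> t Ht; have [u uI ->] := List_In_map Ht; exact: (HI u).
- by move=> t Ht; have [u uD ->] := List_In_map Ht; exact: (HD u).
move=> phi; rewrite !big_map !lin_scale -mulrBr H mulrDr !mulr_sumr.
by congr (_ + _); apply: eq_bigr => t _; rewrite mulrA.
Qed.

Lemma green_iso c U V : wmod U -> wmod V -> hiso U V ->
  greenEq chi [:: (c, U)] [:: (c, V)].
Proof.
move=> wU wV UV; apply/greenEqP; exists [:: (c, (U, V))], [::]; split=> //.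
  by move=> t /= [<-|].
by move=> phi; rewrite !lin_cons !lin_nil !big_cons !big_nil /=; ring.
Qed.

Lemma green_dsum c U V : wmod U -> wmod V ->
  greenEq chi [:: (c, hdsum U V)] [:: (c, U); (c, V)].
Proof.
move=> wU wV; apply/greenEqP; exists [::], [:: (c, (U, V))]; split=> //.
  by move=> t /= [<-|].
by move=> phi; rewrite !lin_cons !lin_nil !big_cons !big_nil /=; ring.
Qed.

End Green.

(** * Tensor products of matrices *)

Section Tens.
Variable k : fieldType.

Lemma tensDl m n p q (A B : 'M[k]_(m, n)) (C : 'M[k]_(p, q)) :
  (A + B) *t C = A *t C + B *t C.
Proof. by apply/matrixP=> i j; rewrite !mxE mulrDl. Qed.

Lemma tensDr m n p q (A : 'M[k]_(m, n)) (B C : 'M[k]_(p, q)) :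
  A *t (B + C) = A *t B + A *t C.
Proof. by apply/matrixP=> i j; rewrite !mxE mulrDr. Qed.

Lemma tensZl m n p q c (A : 'M[k]_(m, n)) (C : 'M[k]_(p, q)) :
  (c *: A) *t C = c *: (A *t C).
Proof. by apply/matrixP=> i j; rewrite !mxE mulrA. Qed.

Lemma tensZr m n p q c (A : 'M[k]_(m, n)) (C : 'M[k]_(p, q)) :
  A *t (c *: C) = c *: (A *t C).
Proof. by apply/matrixP=> i j; rewrite !mxE mulrCA. Qed.

Lemma tens1 m n : 1%:M *t 1%:M = 1%:M :> 'M[k]_(m * n).
Proof.
apply/matrixP=> i j; case: (mxtens_indexP i) => i1 i2.
case: (mxtens_indexP j) => j1 j2; rewrite tensmxE !mxE -natrM mulnb -xpair_eqE.
by rewrite (can_eq (@mxtens_indexK m n)).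
Qed.

Lemma tensX m n (A : 'M[k]_m) (B : 'M[k]_n) e : (A *t B) ^+ e = A ^+ e *t B ^+ e.
Proof.
elim: e => [|e IH]; first by rewrite !expr0 tens1.
by rewrite !exprS IH -!mulmxE tensmx_mul.
Qed.

Lemma tens_diag m n (d : 'rV[k]_m) (e : 'rV[k]_n) :
  diag_mx d *t diag_mx e = diag_mx (\row_i (d 0 (mxtens_unindex i).1 * e 0 (mxtens_unindex i).2)).
Proof.
apply/matrixP=> i j; case: (mxtens_indexP i) => i1 i2.
case: (mxtens_indexP j) => j1 j2; rewrite tensmxE !mxE mxtens_indexK /=.
rewrite (can_eq (@mxtens_indexK m n)) xpair_eqE.
by case: (i1 == j1); case: (i2 == j2); rewrite /= ?mulr0n ?mul0r ?mulr0.
Qed.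

Lemma sum_mxtens (R : nmodType) m n (F : 'I_(m * n) -> R) :
  \sum_i F i = \sum_i \sum_j F (mxtens_index (i, j)).
Proof.
rewrite pair_big (reindex (fun p : 'I_m * 'I_n => mxtens_index p)) /=.
  by apply: eq_bigr => -[].
by exists (@mxtens_unindex m n) => p _; rewrite (mxtens_indexK, mxtens_unindexK).
Qed.

End Tens.

(** * Isomorphisms of modules *)

Section Iso.
Variables (k : fieldType) (G : groupType).
Implicit Types (M N U V K : hmod k G).

Lemma hiso_refl M : hiso M M.
Proof. by exists 1%:M, 1%:M; do !split=> //; move=> *; rewrite ?mul1mx ?mulmx1. Qed.

Lemma hiso_sym M N : hiso M N -> hiso N M.
Proof.
move=> [F [F' [FF [FF' [Hg Hx]]]]]; exists F', F; split=> //; split=> //.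
split=> [g|]; [have := Hg g | have := Hx];
  by move=> /(congr1 (fun A => F' *m A *m F')); rewrite !mulmxA FF mul1mx -!mulmxA FF' mulmx1 => ->.
Qed.

Lemma hiso_trans N M K : hiso M N -> hiso N K -> hiso M K.
Proof.
move=> [F [F' [FF [FF' [Hg Hx]]]]] [E [E' [EE [EE' [Eg Ex]]]]].
exists (E *m F), (F' *m E'); split.
  by rewrite mulmxA -(mulmxA F') EE mulmx1.
split; first by rewrite mulmxA -(mulmxA E) FF' mulmx1.
by split=> [g|]; rewrite -mulmxA (Hg, Hx) mulmxA (Eg, Ex) mulmxA.
Qed.

Lemma hiso_full M N (F : 'M[k]_(hdim N, hdim M)) :
  \rank F = hdim M -> \rank F = hdim N ->
  (forall g, F *m hg M g = hg N g *m F) -> F *m hx M = hx N *m F -> hiso M N.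
Proof.
move=> rM rN Hg Hx; have Ff : row_free F by rewrite /row_free rN.
have FF : row_full F by rewrite /row_full rM.
by exists F, (pinvmx F); rewrite mulVpmx // mulmxVp //.
Qed.

Lemma hiso_bij M N (f : 'I_(hdim M) -> 'I_(hdim N)) f' :
  cancel f f' -> cancel f' f ->
  (forall g i j, hg N g (f i) (f j) = hg M g i j) ->
  (forall i j, hx N (f i) (f j) = hx M i j) -> hiso M N.
Proof.
move=> fK fK' Hg Hx.
pose F : 'M[k]_(hdim N, hdim M) := \matrix_(i, j) (i == f j)%:R.
have FA (A : 'M[k]_(hdim M)) (B : 'M[k]_(hdim N)) :
    (forall i j, B (f i) (f j) = A i j) -> F *m A = B *m F.
  move=> H; apply/matrixP=> i j; rewrite !mxE (bigD1 (f' i)) //= big1 => [|l ne].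
    rewrite (bigD1 (f j)) //= big1 => [|l ne]; rewrite !mxE.
      by rewrite fK' !eqxx mulr1 mul1r -H fK'.
    by rewrite (negPf ne) mulr0.
  by rewrite mxE -(can_eq fK') fK eq_sym (negPf ne) mul0r.
exists F, (\matrix_(i, j) (i == f' j)%:R); split.
  apply/matrixP=> i j; rewrite !mxE (bigD1 (f j)) //= big1 => [|l ne].
    by rewrite !mxE fK eqxx mulr1 addr0.
  by rewrite !mxE (negPf ne) mulr0.
split; last by split=> [g|]; apply: FA.
apply/matrixP=> i j; rewrite !mxE (bigD1 (f' j)) //= big1 => [|l ne].
  by rewrite !mxE fK' eqxx mulr1 addr0.
by rewrite !mxE (negPf ne) mulr0.
Qed.

Lemma hiso_dsum M M' N N' : hiso M M' -> hiso N N' -> hiso (hdsum M N) (hdsum M' N').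
Proof.
move=> [F [F' [FF [FF' [Hg Hx]]]]] [E [E' [EE [EE' [Eg Ex]]]]].
exists (block_mx F 0 0 E), (block_mx F' 0 0 E') => /=.
rewrite !mulmx_block !mulmx0 !mul0mx !addr0 !add0r FF FF' EE EE' -!scalar_mx_block.
do 2!split=> //; split=> [g|]; last by rewrite Hx Ex.
by rewrite !mulmx_block !mulmx0 !mul0mx !addr0 !add0r Hg Eg.
Qed.

Variable a : G.
Local Notation "M ** N" := (htens a M N) (at level 40).

Lemma hiso_tens M M' N N' : hiso M M' -> hiso N N' -> hiso (M ** N) (M' ** N').
Proof.
move=> [F [F' [FF [FF' [Hg Hx]]]]] [E [E' [EE [EE' [Eg Ex]]]]].
exists (F *t E), (F' *t E') => /=; rewrite !tensmx_mul FF FF' EE EE' !tens1.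
split=> //; split=> //; split=> [g|]; rewrite ?tensmx_mul ?Hg ?Eg //.
by rewrite mulmxDl mulmxDr !tensmx_mul Hx Ex Eg mulmx1 mul1mx.
Qed.

(** The basis of [M ** hdsum U V] interleaves the two summands, so the isomorphism is assembled from
    the projections [p], [q] and the injections [p'], [q'] instead of a block form. *)
Lemma hiso_tens_dsumr M U V : hiso (M ** hdsum U V) (hdsum (M ** U) (M ** V)).
Proof.
pose p := row_mx 1%:M 0 : 'M[k]_(hdim U, hdim U + hdim V).
pose q := row_mx 0 1%:M : 'M[k]_(hdim V, hdim U + hdim V).
pose p' := col_mx 1%:M 0 : 'M[k]_(hdim U + hdim V, hdim U).
pose q' := col_mx 0 1%:M : 'M[k]_(hdim U + hdim V, hdim V).
have pp : p *m p' = 1%:M by rewrite mul_row_col ?(mulmx1, mulmx0, mul0mx, mul1mx, addr0, add0r).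
have pq : p *m q' = 0 by rewrite mul_row_col ?(mulmx1, mulmx0, mul0mx, mul1mx, addr0, add0r).
have qp : q *m p' = 0 by rewrite mul_row_col ?(mulmx1, mulmx0, mul0mx, mul1mx, addr0, add0r).
have qq : q *m q' = 1%:M by rewrite mul_row_col ?(mulmx1, mulmx0, mul0mx, mul1mx, addr0, add0r).
have pqE : p' *m p + q' *m q = 1%:M.
  rewrite !mul_col_row ?(mulmx1, mulmx0, mul0mx, mul1mx) add_block_mx ?(addr0, add0r).
  by rewrite -scalar_mx_block.
have pB (A : 'M[k]_(hdim U)) (B : 'M[k]_(hdim V)) : p *m block_mx A 0 0 B = A *m p.
  by rewrite mul_row_block mul_mx_row ?(mulmx1, mulmx0, mul0mx, mul1mx, addr0, add0r).
have qB (A : 'M[k]_(hdim U)) (B : 'M[k]_(hdim V)) : q *m block_mx A 0 0 B = B *m q.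
  by rewrite mul_row_block mul_mx_row ?(mulmx1, mulmx0, mul0mx, mul1mx, addr0, add0r).
exists (col_mx (1%:M *t p) (1%:M *t q)), (row_mx (1%:M *t p') (1%:M *t q')) => /=.
split; first by rewrite mul_row_col !tensmx_mul !mul1mx -tensDr pqE tens1.
split; first by rewrite mul_col_row !tensmx_mul !mul1mx pp pq qp qq !tens1 !tensmx0 -scalar_mx_block.
split=> [g|]; rewrite mul_col_mx mul_block_col !mul0mx addr0 add0r.
  by rewrite !tensmx_mul mulmx1 mul1mx pB qB.
by rewrite !mulmxDl !mulmxDr !tensmx_mul !mulmx1 !mul1mx !pB !qB.
Qed.

Lemma hiso_tens_dsuml M U V : hiso (hdsum U V ** M) (hdsum (U ** M) (V ** M)).
Proof.
pose p := row_mx 1%:M 0 : 'M[k]_(hdim U, hdim U + hdim V).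
pose q := row_mx 0 1%:M : 'M[k]_(hdim V, hdim U + hdim V).
pose p' := col_mx 1%:M 0 : 'M[k]_(hdim U + hdim V, hdim U).
pose q' := col_mx 0 1%:M : 'M[k]_(hdim U + hdim V, hdim V).
have pp : p *m p' = 1%:M by rewrite mul_row_col ?(mulmx1, mulmx0, mul0mx, mul1mx, addr0, add0r).
have pq : p *m q' = 0 by rewrite mul_row_col ?(mulmx1, mulmx0, mul0mx, mul1mx, addr0, add0r).
have qp : q *m p' = 0 by rewrite mul_row_col ?(mulmx1, mulmx0, mul0mx, mul1mx, addr0, add0r).
have qq : q *m q' = 1%:M by rewrite mul_row_col ?(mulmx1, mulmx0, mul0mx, mul1mx, addr0, add0r).
have pqE : p' *m p + q' *m q = 1%:M.
  rewrite !mul_col_row ?(mulmx1, mulmx0, mul0mx, mul1mx) add_block_mx ?(addr0, add0r).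
  by rewrite -scalar_mx_block.
have pB (A : 'M[k]_(hdim U)) (B : 'M[k]_(hdim V)) : p *m block_mx A 0 0 B = A *m p.
  by rewrite mul_row_block mul_mx_row ?(mulmx1, mulmx0, mul0mx, mul1mx, addr0, add0r).
have qB (A : 'M[k]_(hdim U)) (B : 'M[k]_(hdim V)) : q *m block_mx A 0 0 B = B *m q.
  by rewrite mul_row_block mul_mx_row ?(mulmx1, mulmx0, mul0mx, mul1mx, addr0, add0r).
exists (col_mx (p *t 1%:M) (q *t 1%:M)), (row_mx (p' *t 1%:M) (q' *t 1%:M)) => /=.
split; first by rewrite mul_row_col !tensmx_mul !mul1mx -tensDl pqE tens1.
split; first by rewrite mul_col_row !tensmx_mul !mul1mx pp pq qp qq !tens1 !tens0mx -scalar_mx_block.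
split=> [g|]; rewrite mul_col_mx mul_block_col !mul0mx addr0 add0r.
  by rewrite !tensmx_mul mulmx1 mul1mx pB qB.
by rewrite !mulmxDl !mulmxDr !tensmx_mul !mulmx1 !mul1mx !pB !qB.
Qed.

Lemma hiso_tensA M N K : hiso ((M ** N) ** K) (M ** (N ** K)).
Proof.
pose f (i : 'I_(hdim M * hdim N * hdim K)) :=
  let u := mxtens_unindex i in let v := mxtens_unindex u.1 in
  mxtens_index (v.1, mxtens_index (v.2, u.2)).
pose f' (i : 'I_(hdim M * (hdim N * hdim K))) :=
  let u := mxtens_unindex i in let v := mxtens_unindex u.2 in
  mxtens_index (mxtens_index (u.1, v.1), v.2).
apply: (@hiso_bij ((M ** N) ** K) (M ** (N ** K)) f f') => [i|i|g i j|i j].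
- case: (mxtens_indexP i) => i1 i2; case: (mxtens_indexP i1) => i3 i4.
  by rewrite /f /f' !mxtens_indexK.
- case: (mxtens_indexP i) => i1 i2; case: (mxtens_indexP i2) => i3 i4.
  by rewrite /f /f' !mxtens_indexK.
- rewrite /f; case: (mxtens_indexP i) => i1 i2; case: (mxtens_indexP i1) => i3 i4.
  case: (mxtens_indexP j) => j1 j2; case: (mxtens_indexP j1) => j3 j4.
  by rewrite !mxtens_indexK /= !tensmxE mulrA.
rewrite /f; case: (mxtens_indexP i) => i1 i2; case: (mxtens_indexP i1) => i3 i4.
case: (mxtens_indexP j) => j1 j2; case: (mxtens_indexP j1) => j3 j4.
rewrite !mxtens_indexK /= tensDr tensDl -!tens1.
do 4!rewrite [(_ + _ : 'M__) _ _]mxE; rewrite !tensmxE -!mulrA.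
by rewrite addrA.
Qed.

End Iso.

(** * Weights *)

Section Weights.
Variables (k : fieldType) (G : groupType).
Implicit Types (M N U V K : hmod k G).

Definition diagw n (w : 'I_n -> G -> k) (g : G) : 'M[k]_n := diag_mx (\row_i w i g).

Definition is_diag M (w : 'I_(hdim M) -> G -> k) := forall g, hg M g = diagw w g.

(** The projection onto the weight space of [mu], in a basis of weight vectors with weights [w]. *)
Definition pw n (w : 'I_n -> G -> k) (mu : G -> k) : 'M[k]_n :=
  diag_mx (\row_i (`[< w i = mu >])%:R).

Lemma mulmx_diagE m n (A : 'M[k]_(m, n)) d i j : (A *m diag_mx d) i j = A i j * d 0 j.
Proof. by rewrite mul_mx_diag mxE. Qed.

Lemma diag_mulmxE m n (A : 'M[k]_(m, n)) d i j : (diag_mx d *m A) i j = d 0 i * A i j.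
Proof. by rewrite mul_diag_mx mxE. Qed.

Lemma intertw_weight m n (w : 'I_m -> G -> k) (v : 'I_n -> G -> k) (c : G -> k)
    (F : 'M[k]_(n, m)) i j :
  (forall g, F *m diagw w g = c g *: (diagw v g *m F)) -> F i j != 0 ->
  w j = chr_mul c (v i).
Proof.
move=> H Fij; apply/funext => g; have /matrixP/(_ i j) := H g.
rewrite mulmx_diagE [RHS]mxE diag_mulmxE !mxE /chr_mul mulrA mulrC.
by move/(mulIf Fij).
Qed.

(** A nonzero entry of [F] forces the weights of its row and its column to differ by exactly [c], so
    both products keep the same entries of [F]. *)
Lemma intertw_pw m n (w : 'I_m -> G -> k) (v : 'I_n -> G -> k) c (F : 'M[k]_(n, m)) mu :
  (forall g, F *m diagw w g = c g *: (diagw v g *m F)) -> (forall g, c g != 0) ->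
  F *m pw w (chr_mul c mu) = pw v mu *m F.
Proof.
move=> H c0; apply/matrixP=> i j; rewrite mulmx_diagE diag_mulmxE !mxE.
have [->|Fij] := eqVneq (F i j) 0; first by rewrite mul0r mulr0.
rewrite mulrC (intertw_weight H Fij); congr (_ * _); congr (nat_of_bool _)%:R.
apply: asbool_equiv_eq; split=> [E|-> //]; apply/funext => g.
by have := congr1 (fun f => f g) E; rewrite /chr_mul => /(mulfI (c0 g)).
Qed.

Lemma chr_mul1 (c : G -> k) : chr_mul (@chr_one k G) c = c.
Proof. by apply/funext => g; rewrite /chr_mul mul1r. Qed.

Lemma chr_mulr1 (c : G -> k) : chr_mul c (@chr_one k G) = c.
Proof. by apply/funext => g; rewrite /chr_mul mulr1. Qed.

Lemma chr_mulC (c d : G -> k) : chr_mul c d = chr_mul d c.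
Proof. by apply/funext => g; rewrite /chr_mul mulrC. Qed.

Lemma chr_mulA (c d e : G -> k) : chr_mul c (chr_mul d e) = chr_mul (chr_mul c d) e.
Proof. by apply/funext => g; rewrite /chr_mul mulrA. Qed.

Lemma chr_pow0 (c : G -> k) : chr_pow c 0 = @chr_one k G.
Proof. by apply/funext => g; rewrite /chr_pow expr0. Qed.

Lemma chr_powS (c : G -> k) n : chr_pow c n.+1 = chr_mul c (chr_pow c n).
Proof. by apply/funext => g; rewrite /chr_pow exprS. Qed.

Lemma chr_powD (c : G -> k) m n : chr_pow c (m + n) = chr_mul (chr_pow c m) (chr_pow c n).
Proof. by apply/funext => g; rewrite /chr_pow exprD. Qed.

Lemma intertw_pw1 m n (w : 'I_m -> G -> k) (v : 'I_n -> G -> k) (F : 'M[k]_(n, m)) mu :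
  (forall g, F *m diagw w g = diagw v g *m F) ->
  F *m pw w mu = pw v mu *m F.
Proof.
move=> H; rewrite -{1}(chr_mul1 mu); apply: intertw_pw => g; last exact: oner_neq0.
by rewrite scale1r.
Qed.

Lemma sum_pw n (w : 'I_n -> G -> k) I (r : seq I) (P : pred I) (mu : I -> G -> k) :
  (forall i, \sum_(c <- r | P c) (`[< w i = mu c >])%:R = 1 :> k) ->
  \sum_(c <- r | P c) pw w (mu c) = 1%:M.
Proof.
move=> H; apply/matrixP=> i j; rewrite summxE [RHS]mxE.
rewrite (eq_bigr (fun c => (`[< w i = mu c >])%:R *+ (i == j))); last first.
  by move=> c _; rewrite !mxE.
by rewrite sumrMnl H.
Qed.

Lemma pwM n (w : 'I_n -> G -> k) mu nu :
  pw w mu *m pw w nu = if `[< mu = nu >] then pw w mu else 0.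
Proof.
apply/matrixP=> i j; rewrite mulmx_diagE; case: (asboolP (mu = nu)) => [<-|ne].
  rewrite !mxE; have [<-|_] := eqVneq i j; last by rewrite mulr0n mul0r.
  by rewrite mulr1n; case: asboolP => _; rewrite ?mulr1 ?mulr0.
rewrite !mxE; have [<-|_] := eqVneq i j; last by rewrite mulr0n mul0r.
rewrite mulr1n; case: asboolP => [E|_]; last by rewrite mul0r.
by rewrite asboolF ?mulr0 // => E'; apply: ne; rewrite -E -E'.
Qed.

Definition sumw m n (w : 'I_m -> G -> k) (v : 'I_n -> G -> k) (i : 'I_(m + n)) :=
  match split i with inl j => w j | inr j => v j end.

Definition tensw m n (w : 'I_m -> G -> k) (v : 'I_n -> G -> k) (i : 'I_(m * n)) :=
  chr_mul (w (mxtens_unindex i).1) (v (mxtens_unindex i).2).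

Lemma diag_dsum M N w v : @is_diag M w -> @is_diag N v -> @is_diag (hdsum M N) (sumw w v).
Proof.
move=> dM dN g; rewrite /= dM dN -diag_mx_row; congr diag_mx.
apply/matrixP=> i j; rewrite !mxE /sumw; case: split => c; by rewrite mxE.
Qed.

Lemma diag_tens a M N w v : @is_diag M w -> @is_diag N v ->
  @is_diag (htens a M N) (tensw w v).
Proof.
move=> dM dN g; rewrite /= dM dN tens_diag; congr diag_mx.
by apply/matrixP=> i j; rewrite !mxE.
Qed.

Lemma pw_sumw m n (w : 'I_m -> G -> k) (v : 'I_n -> G -> k) mu :
  pw (sumw w v) mu = block_mx (pw w mu) 0 0 (pw v mu).
Proof.
rewrite /pw -diag_mx_row; congr diag_mx.
apply/matrixP=> i j; rewrite !mxE /sumw; case: split => c; by rewrite mxE.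
Qed.

Lemma intertw_exp m n (F : 'M[k]_(n, m)) (A : 'M[k]_m) (B : 'M[k]_n) e :
  F *m A = B *m F -> F *m A ^+ e = B ^+ e *m F.
Proof.
move=> H; elim: e => [|e IH]; first by rewrite !expr0 mulmx1 mul1mx.
by rewrite !exprS -!mulmxE mulmxA H -mulmxA IH mulmxA.
Qed.

Lemma block_exp m n (A : 'M[k]_m) (B : 'M[k]_n) e :
  block_mx A 0 0 B ^+ e = block_mx (A ^+ e) 0 0 (B ^+ e).
Proof.
elim: e => [|e IH]; first by rewrite !expr0 -scalar_mx_block.
by rewrite !exprS IH -!mulmxE mulmx_block !mulmx0 !mul0mx !addr0 !add0r.
Qed.

Variable chi : G -> k.
Notation wmod := (is_wmod chi).

(* Images of a weight basis span, so some of them form a weight basis. *)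
Lemma wmod_surj M N (Y : 'M[k]_(hdim N, hdim M)) Z :
  wmod M -> Y *m Z = 1%:M -> (forall g, Y *m hg M g = hg N g *m Y) ->
  Y *m hx M = hx N *m Y -> wmod N.
Proof.
move=> [M1 [MM [Mx [P [Pu [mu Hmu]]]]]] YZ Hg Hx.
have Y_inj m (A B : 'M[k]_(m, hdim N)) : A *m Y = B *m Y -> A = B.
  by move=> /(congr1 (mulmx^~ Z)); rewrite -!mulmxA YZ !mulmx1.
split; first by apply: Y_inj; rewrite -Hg M1 mulmx1 mul1mx.
split; first by move=> g h; apply: Y_inj; rewrite -mulmxA -!Hg MM !mulmxA Hg.
split.
  move=> g; apply: Y_inj; rewrite -mulmxA -Hg mulmxA -Hx -mulmxA Mx.
  by rewrite -scalemxAr -scalemxAl; congr (_ *: _); rewrite mulmxA Hg -[LHS]mulmxA Hx mulmxA.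
have YPf : row_full (Y *m P)^T.
  apply/row_fullP; exists (invmx P *m Z)^T.
  by rewrite -trmx_mul mulmxA -(mulmxA Y) mulmxV // mulmx1 YZ trmx1.
pose f := fullrankfun YPf; pose Q := (rowsub f (Y *m P)^T)^T.
exists Q; split; first by rewrite unitmx_tr; apply: fullrowsub_unit.
exists (fun i => mu (f i)) => i g.
have -> : col i Q = Y *m col (f i) P by apply/matrixP=> r c; rewrite !mxE; apply: eq_bigr => l _; rewrite !mxE.
by rewrite mulmxA -Hg -mulmxA Hmu scalemxAr.
Qed.

Lemma wmod_iso M N : wmod M -> hiso M N -> wmod N.
Proof.
move=> wM [F [F' [FF [FF' [Hg Hx]]]]]; exact: (wmod_surj wM FF' Hg Hx).
Qed.

Lemma wmod_diag M w : @is_diag M w ->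
  (forall i, w i 1%g = 1) -> (forall i g h, w i (g * h)%g = w i g * w i h) ->
  (forall g, hx M *m hg M g = (chi g)^-1 *: (hg M g *m hx M)) -> wmod M.
Proof.
move=> dM w1 wM Hx; split.
  rewrite dM; apply/matrixP=> i j; rewrite !mxE w1 //.
split; last (split=> //).
  move=> g h; rewrite !dM mulmx_diag; congr diag_mx; apply/matrixP=> i j.
  by rewrite !mxE wM.
exists 1%:M; split; first exact: unitmx1.
exists w => i g; rewrite dM; apply/matrixP=> r c; rewrite diag_mulmxE !mxE.
by case: (r =P i) => [->|]; rewrite ?mulr0.
Qed.

(** Conjugation by a weight basis. It lets later arguments assume that [G] acts by diagonal
    matrices. *)
Lemma wmod_model M : wmod M -> exists N w, [/\ wmod N, @is_diag N w & hiso M N].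
Proof.
move=> wM; have [M1 [MM [Mx [P [Pu [mu Hmu]]]]]] := wM.
pose N := @HMod k G (hdim M) (diagw mu) (invmx P *m hx M *m P).
have HP g : hg M g *m P = P *m diagw mu g.
  apply/matrixP=> i j; have /matrixP/(_ i 0) := Hmu j g.
  rewrite mulmx_diagE !mxE [RHS]mulrC => <-; apply: eq_bigr => l _; by rewrite !mxE.
have MN : hiso M N.
  exists (invmx P), P; rewrite mulmxV // mulVmx //=; do 2!split=> //.
  split=> [g|]; last by rewrite -!mulmxA mulmxV // mulmx1.
  by rewrite -[LHS]mulmx1 -(mulmxV Pu) mulmxA -(mulmxA _ _ P) HP mulmxA mulVmx // mul1mx.
by exists N, mu; split=> //; apply: wmod_iso MN.
Qed.

Lemma diag_weight M w : wmod M -> @is_diag M w ->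
  [/\ forall i, w i 1%g = 1, forall i g h, w i (g * h)%g = w i g * w i h
    & forall i, is_character (w i)].
Proof.
move=> [M1 [MM _]] dM.
have w1 i : w i 1%g = 1.
  by have /matrixP/(_ i i) := M1; rewrite dM !mxE eqxx.
have wMM i g h : w i (g * h)%g = w i g * w i h.
  by have /matrixP/(_ i i) := MM g h; rewrite !dM mulmx_diagE !mxE eqxx.
split=> // i; split=> // g; apply: contra_eq_neq (w1 i) => wg.
by rewrite -(mulgV g) wMM wg mul0r eq_sym oner_neq0.
Qed.

Lemma wmod_dsum M N : wmod M -> wmod N -> wmod (hdsum M N).
Proof.
move=> wM wN; have [M' [w [wM' dM MM']]] := wmod_model wM.
have [N' [v [wN' dN NN']]] := wmod_model wN.
have: hiso (hdsum M' N') (hdsum M N) by apply: hiso_dsum; apply: hiso_sym.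
apply: wmod_iso; apply: (wmod_diag (diag_dsum dM dN)).
- have [w1 _ _] := diag_weight wM' dM; have [v1 _ _] := diag_weight wN' dN.
  by move=> i; rewrite /sumw; case: split.
- have [_ w1 _] := diag_weight wM' dM; have [_ v1 _] := diag_weight wN' dN.
  by move=> i; rewrite /sumw; case: split.
have [_ [_ [xM _]]] := wM'; have [_ [_ [xN _]]] := wN'.
move=> g /=; rewrite !mulmx_block !mulmx0 !mul0mx !addr0 !add0r xM xN.
by rewrite scale_block_mx !scaler0.
Qed.

Variable a : G.
Hypothesis a_central : forall g, (a * g = g * a)%g.

(** Centrality of [a] enters here: the term [x (x) a] of the coproduct satisfies the commutation
    rule with [g] because [a] and [g] commute on the second factor. *)
Lemma wmod_tens M N : wmod M -> wmod N -> wmod (htens a M N).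
Proof.
move=> wM wN; have [M' [w [wM' dM MM']]] := wmod_model wM.
have [N' [v [wN' dN NN']]] := wmod_model wN.
have: hiso (htens a M' N') (htens a M N) by apply: hiso_tens; apply: hiso_sym.
apply: wmod_iso; apply: (wmod_diag (diag_tens a dM dN)).
- have [w1 _ _] := diag_weight wM' dM; have [v1 _ _] := diag_weight wN' dN.
  by move=> i; rewrite /tensw /chr_mul w1 v1 mulr1.
- have [_ w1 _] := diag_weight wM' dM; have [_ v1 _] := diag_weight wN' dN.
  by move=> i g h; rewrite /tensw /chr_mul w1 v1 mulrACA.
have [_ [_ [xM _]]] := wM'; have [_ [gN [xN _]]] := wN'.
move=> g /=; rewrite mulmxDl mulmxDr !tensmx_mul xM xN mul1mx mulmx1.
by rewrite -!gN a_central tensZl tensZr scalerDr.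
Qed.

End Weights.

(** * Rank invariants *)

Section Ranks.
Variables (k : fieldType) (G : groupType) (chi : G -> k) (sb : nat).
Implicit Types (M N U V K : hmod k G).
Notation wmod := (is_wmod chi).

Definition Tgm (ga : k) n (X : 'M[k]_n) : 'M[k]_n :=
  if ga == 0 then X else X ^+ sb - ga%:M.

Definition rk M (w : 'I_(hdim M) -> G -> k) ga n mu : nat :=
  \rank (Tgm ga (hx M) ^+ n *m pw w mu).

Lemma intertw_Tg m n ga (F : 'M[k]_(n, m)) (A : 'M[k]_m) (B : 'M[k]_n) :
  F *m A = B *m F -> F *m Tgm ga A = Tgm ga B *m F.
Proof.
rewrite /Tgm; case: eqP => // _ H.
by rewrite mulmxBr mulmxBl (intertw_exp _ H) mul_mx_scalar mul_scalar_mx.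
Qed.

Lemma rk_iso M N w v ga n mu : @is_diag k G M w -> @is_diag k G N v -> hiso M N ->
  rk w ga n mu = rk v ga n mu.
Proof.
move=> dM dN; wlog suff: M N w v dM dN / hiso M N -> (rk w ga n mu <= rk v ga n mu)%N.
  by move=> H MN; apply/eqP; rewrite eqn_leq !H //; apply: hiso_sym.
move=> [F [F' [FF [FF' [Hg Hx]]]]]; rewrite /rk.
have HT := intertw_exp n (intertw_Tg ga Hx).
have Hp : F *m pw w mu = pw v mu *m F.
  by apply: intertw_pw1 => g; rewrite -dM Hg dN.
have -> : Tgm ga (hx M) ^+ n *m pw w mu = F' *m (Tgm ga (hx N) ^+ n *m pw v mu) *m F.
  by rewrite -[LHS]mul1mx -FF -!mulmxA (mulmxA F) HT -mulmxA Hp.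
by rewrite (leq_trans (mxrankM_maxl _ _)) // mxrankM_maxr.
Qed.

Lemma rk_dsum M N w v ga n mu :
  @rk (hdsum M N) (sumw w v) ga n mu = (rk w ga n mu + rk v ga n mu)%N.
Proof.
rewrite /rk /= pw_sumw.
have -> : Tgm ga (block_mx (hx M) 0 0 (hx N)) = block_mx (Tgm ga (hx M)) 0 0 (Tgm ga (hx N)).
  rewrite /Tgm; case: eqP => // _; rewrite block_exp scalar_mx_block opp_block_mx.
  by rewrite add_block_mx !oppr0 !addr0.
rewrite block_exp mulmx_block !mulmx0 !mul0mx !addr0 !add0r.
exact: rank_diag_block_mx.
Qed.

(* The rank is read off any model in which [G] acts diagonally. *)
Definition rho ga n mu M : nat :=
  xget 0%N [set r | exists N w, [/\ @is_diag k G N w, hiso M N & r = rk w ga n mu]].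

Lemma rhoE ga n mu M w : @is_diag k G M w -> rho ga n mu M = rk w ga n mu.
Proof.
move=> dM; rewrite /rho; case: xgetP => [r _ [N [v [dN MN ->]]]|H].
  by apply: rk_iso => //; apply: hiso_sym.
by case: (H (rk w ga n mu)); exists M, w; split=> //; apply: hiso_refl.
Qed.

Lemma rho_iso ga n mu M N : wmod M -> hiso M N -> rho ga n mu M = rho ga n mu N.
Proof.
move=> wM MN; rewrite /rho; congr xget; apply/seteqP; split=> r [K [w [dK MK ->]]];
  exists K, w; split=> //; apply: hiso_trans MK => //; exact: hiso_sym.
Qed.

(* The number of Jordan blocks of size [> n] of [Tgm ga] starting in weight [mu]. *)
Definition iotam mu ga n M : int := (rho ga n mu M)%:Z - (rho ga n.+1 mu M)%:Z.

Lemma functional_iota mu ga n : functional chi (iotam mu ga n).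
Proof.
split=> [U V wU wV UV|U V wU wV].
  by rewrite /iotam !(rho_iso _ _ _ wU UV).
have [U' [w [wU' dU UU']]] := wmod_model wU.
have [V' [v [wV' dV VV']]] := wmod_model wV.
rewrite /iotam !(rho_iso _ _ _ (wmod_dsum wU wV) (hiso_dsum UU' VV')).
rewrite !(rho_iso _ _ _ wU UU') !(rho_iso _ _ _ wV VV').
rewrite !(rhoE _ _ _ (diag_dsum dU dV)) !rk_dsum !(rhoE _ _ _ dU) !(rhoE _ _ _ dV).
by rewrite !PoszD; ring.
Qed.

End Ranks.

(** * Modules with a rank-one top layer *)

Section MatrixFacts.
Variable k : fieldType.

(** With [m] the scalar [- c], the factor [N - m] divides [N ^+ n - m ^+ n], which is a nonzero
    scalar; the cofactor gives the inverse. *)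
Lemma unitmx_shift_nilp d (N : 'M[k]_d) n c : N ^+ n = 0 -> c != 0 ->
  N + c%:M \in unitmx.
Proof.
move=> Nn c0; pose m := (- c)%:M : 'M[k]_d.
have cm : GRing.comm N m by rewrite /GRing.comm -!mulmxE scalar_mxC.
have mX e : m ^+ e = ((- c) ^+ e)%:M.
  by elim: e => [|e IH]; rewrite ?expr0 // !exprS IH -mulmxE -scalar_mxM.
have := subrXX_comm n cm; rewrite Nn sub0r mX.
have -> : N - m = N + c%:M by rewrite -raddfN opprK.
move=> H; have /mulmx1_unit [] // : (N + c%:M) *m ((- (- c) ^+ n)^-1 *:
    (\sum_(i < n) N ^+ (n.-1 - i) * m ^+ i)) = 1%:M.
rewrite -scalemxAr mulmxE -H -raddfN scale_scalar_mx mulVf //.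
by rewrite oppr_eq0 expf_neq0 // oppr_eq0.
Qed.

Lemma unitmx_exp d (A : 'M[k]_d) n : A \in unitmx -> A ^+ n \in unitmx.
Proof.
move=> uA; elim: n => [|n IH]; first by rewrite expr0 unitmx1.
by rewrite exprS -mulmxE unitmx_mul uA.
Qed.

Lemma unitmx_expV d (A : 'M[k]_d) n : (0 < n)%N -> A ^+ n \in unitmx -> A \in unitmx.
Proof. by case: n => // n _; rewrite exprS -mulmxE unitmx_mul => /andP[]. Qed.

End MatrixFacts.

Section Top.
Variables (k : fieldType) (G : groupType) (chi : G -> k) (sb : nat).
Hypothesis sb_gt0 : (0 < sb)%N.
Implicit Types (M N U V K : hmod k G).
Notation wmod := (is_wmod chi).
Notation Tg := (Tgm sb).
Notation iota_ := (iotam sb).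

Lemma iota_unit mu ga m M : wmod M -> Tg ga (hx M) \in unitmx ->
  iota_ mu ga m M = 0.
Proof.
move=> wM uT; have [N [w [wN dN MN]]] := wmod_model wM.
rewrite /iotam !(rho_iso _ _ _ _ wM MN) !(rhoE _ _ _ _ dN) /rk.
have uN : Tg ga (hx N) \in unitmx.
  have [F [F' [FF [FF' [_ Hx]]]]] := MN.
  have HT := intertw_Tg sb ga Hx.
  have /mulmx1_unit [] // : Tg ga (hx N) *m (F *m invmx (Tg ga (hx M)) *m F') = 1%:M.
  by rewrite !mulmxA -HT -(mulmxA F) mulmxV // mulmx1.
rewrite exprS -mulmxE -mulmxA.
by rewrite (eqmxMfull (_ *m _)) ?subrr // row_full_unit.
Qed.

(* The last nonzero power of [Tgm ga] is [P *m Q] with [P] injective and [Q] onto,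
   the rows of [Q] being weight covectors of weights [w]. *)
Definition TopM c M ga n (w : 'I_c -> G -> k) :=
  (0 < n)%N /\ exists (P : 'M[k]_(hdim M, c)) (P' : 'M[k]_(c, hdim M))
    (Q : 'M[k]_(c, hdim M)) (Q' : 'M[k]_(hdim M, c)),
    [/\ P' *m P = 1%:M, Q *m Q' = 1%:M, forall g, Q *m hg M g = diagw w g *m Q,
        Tg ga (hx M) ^+ n.-1 = P *m Q & Tg ga (hx M) ^+ n = 0].

Lemma Top_iso c M N ga n (w : 'I_c -> G -> k) : hiso M N -> TopM M ga n w -> TopM N ga n w.
Proof.
move=> [F [F' [FF [FF' [Hg Hx]]]]] [n0 [P [P' [Q [Q' [PP QQ Qg TP T0]]]]]].
have HT e := intertw_exp e (intertw_Tg sb ga Hx).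
split=> //; exists (F *m P), (P' *m F'), (Q *m F'), (F *m Q'); split.
- by rewrite mulmxA -(mulmxA P') FF mulmx1.
- by rewrite mulmxA -(mulmxA Q) FF mulmx1.
- move=> g; have -> : hg N g = F *m hg M g *m F' by rewrite Hg -mulmxA FF' mulmx1.
  by rewrite !mulmxA -(mulmxA Q) FF mulmx1 Qg.
- by rewrite -[LHS]mulmx1 -FF' mulmxA -HT TP !mulmxA.
by rewrite -[LHS]mulmx1 -FF' mulmxA -HT T0 mulmx0 mul0mx.
Qed.

(** Beyond [T ^+ n.-1] all powers vanish, so a single rank remains. In [P *m pw w mu *m Q] the
    injective [P] and the surjective [Q] do not change the rank. *)
Lemma iota_top c M ga n (w : 'I_c -> G -> k) mu m : wmod M -> TopM M ga n w ->
  (n <= m.+1)%N ->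
  iota_ mu ga m M = if m.+1 == n then (\rank (pw w mu))%:Z else 0.
Proof.
move=> wM; have [N [v [wN dN MN]]] := wmod_model wM; move=> /(Top_iso MN).
rewrite /iotam !(rho_iso _ _ _ _ wM MN) !(rhoE _ _ _ _ dN) /rk.
move=> [n0 [P [P' [Q [Q' [PP QQ Qg TP T0]]]]]] nm.
have T1 e : (n <= e)%N -> Tg ga (hx N) ^+ e = 0.
  by move=> /subnKC <-; rewrite exprD T0 mul0r.
rewrite (T1 m.+1) // mul0mx mxrank0 subr0.
case: eqP => [E|ne]; last first.
  by rewrite T1 ?mul0mx ?mxrank0 // -ltnS ltn_neqAle nm andbT eq_sym; apply/eqP.
have QD : Q *m pw v mu = pw w mu *m Q by apply: intertw_pw1 => g; rewrite -dN.
have -> : m = n.-1 by rewrite -E.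
rewrite TP -mulmxA QD; congr (Posz _); apply/eqP; rewrite eqn_leq.
rewrite (leq_trans (mxrankM_maxr _ _) (mxrankM_maxl _ _)) /=.
have {1}-> : pw w mu = P' *m (P *m (pw w mu *m Q)) *m Q'.
  by rewrite !mulmxA PP mul1mx -mulmxA QQ mulmx1.
by rewrite (leq_trans (mxrankM_maxl _ _)) // mxrankM_maxr.
Qed.

(** Nilpotency of [T] at [ga] leaves [ga] as the only eigenvalue of [x ^+ sb], so [T] at any other
    value is a nilpotent matrix plus a nonzero scalar, or has such a power, and is invertible. *)
Lemma iota_top_neq c M ga n (w : 'I_c -> G -> k) mu ga' m : wmod M -> TopM M ga n w ->
  ga' != ga -> iota_ mu ga' m M = 0.
Proof.
move=> wM [n0 [P [P' [Q [Q' [_ _ _ _ T0]]]]]] ne; apply: iota_unit => //.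
move: T0 ne; rewrite {1 2}/Tgm; set X := hx M; rewrite /hmod.
have [->|g0] := eqVneq ga 0 => T0 ne.
  rewrite (negPf ne) -scalemx1 -scaleNr scalemx1; apply: (@unitmx_shift_nilp _ _ _ n).
    by rewrite exprAC T0 expr0n eqn0Ngt sb_gt0.
  by rewrite oppr_eq0.
have XE : X ^+ sb = (X ^+ sb - ga%:M) + ga%:M by rewrite subrK.
case: eqP => [_|g1].
  apply: (unitmx_expV sb_gt0); rewrite XE; exact: (unitmx_shift_nilp T0).
have -> : X ^+ sb - ga'%:M = (X ^+ sb - ga%:M) + (ga - ga')%:M.
  by rewrite raddfB /= addrA subrK.
by apply: (unitmx_shift_nilp T0); rewrite subr_eq0 eq_sym.
Qed.

Lemma rank_pw c (w : 'I_c -> G -> k) mu : injective w ->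
  \rank (pw w mu) = `[< exists i, w i = mu >] :> nat.
Proof.
move=> wI; case: asboolP => [[i <-]|H].
  have -> : pw w (w i) = delta_mx i i; last exact: mxrank_delta.
  apply/matrixP=> r j; rewrite !mxE.
  have -> : `[< w r = w i >] = (r == i) by apply/asboolP/eqP => [/wI|->].
  case: eqP => [->|/eqP nr]; rewrite ?mul0rn // eq_sym; by case: (j == i).
have -> : pw w mu = 0; last exact: mxrank0.
apply/matrixP=> r j; rewrite !mxE asboolF ?mul0rn // => E; apply: H; by exists r.
Qed.

Hypothesis chi_ord : chr_order chi sb.

Lemma chi_pow_inj i j : (i < sb)%N -> (j < sb)%N -> chr_pow chi i = chr_pow chi j ->
  (forall g, chi g != 0) -> i = j.
Proof.
move=> + + + chi0; wlog ij : i j / (i <= j)%N => [H Hi Hj E|Hi Hj E].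
  by case: (leqP i j) => [|/ltnW] ij; [apply: H | apply/esym/H].
case: (posnP (j - i)) => [/eqP|ji]; first by rewrite subn_eq0 => ji; apply/eqP; rewrite eqn_leq ij.
case: chi_ord => _ [_ H]; case: (H (j - i)%N).
  by rewrite ji (leq_ltn_trans (leq_subr _ _)).
apply/funext => g; have := congr1 (fun f => f g) E; rewrite /chr_pow /chr_one.
rewrite -{1}(subnKC ij) exprD -{1}[chi g ^+ i]mulr1 => /(mulfI _) -> //.
exact: expf_neq0.
Qed.

Definition orbw (la : G -> k) (i : 'I_sb) : G -> k := chr_mul (chr_pow chi i) la.

Lemma orbw_inj la : (forall g, chi g != 0) -> (forall g, la g != 0) -> injective (orbw la).
Proof.
move=> chi0 la0 i j E; apply/val_inj; apply: (chi_pow_inj (ltn_ord i) (ltn_ord j)) => //.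
apply/funext => g; have := congr1 (fun f => f g) E; rewrite /orbw /chr_mul => /(mulIf (la0 g)) . exact.
Qed.

(** A chosen representative of the coset of [la] modulo the powers of [chi]. For nonzero [ga] the
    module depends on this coset only, so indexing the modules requires such a choice. The default
    value is never taken, since the coset contains [la]. *)
Definition crep (la : G -> k) : G -> k :=
  xget (@chr_one k G) [set mu | exists n, mu = chr_mul (chr_pow chi n) la].

Lemma chr_powsb : chr_pow chi sb = @chr_one k G.
Proof. by case: chi_ord => _ []. Qed.

Lemma chr_pow_mod n : chr_pow chi n = chr_pow chi (n %% sb).
Proof.
apply/funext => g; rewrite {1}(divn_eq n sb) /chr_pow exprD mulnC exprM.
by rewrite -[chi g ^+ sb]/(chr_pow chi sb g) chr_powsb /chr_one expr1n mul1r.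
Qed.

Lemma crep_spec la : exists n, crep la = chr_mul (chr_pow chi n) la.
Proof.
rewrite /crep; case: xgetP => [mu _ //|H]; case: (H la).
by exists 0%N; rewrite chr_pow0 chr_mul1.
Qed.

Lemma crep_shift la n : crep (chr_mul (chr_pow chi n) la) = crep la.
Proof.
rewrite /crep; set S := (X in xget _ X); set S' := (X in _ = xget _ X).
rewrite (_ : S = S') //.
  apply/seteqP; split=> mu [m ->] /=.
  by exists (m + n)%N; rewrite chr_powD chr_mulA.
(* Exponents are natural numbers; [sb * n - n] stands for [- n] modulo [sb]. *)
exists (m + (sb * n - n))%N; rewrite chr_mulA -chr_powD -addnA subnK ?leq_pmull //.
by rewrite [in RHS]chr_powD [chr_pow chi (_ * _)]chr_pow_mod modnMr chr_pow0 chr_mulr1.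
Qed.

End Top.

(** * Indecomposable modules and the decomposition theorem *)

Section Split.
Variables (k : fieldType) (G : groupType) (chi : G -> k).
Implicit Types (M N U V K : hmod k G).
Notation wmod := (is_wmod chi).

Lemma hiso_dim M N : hiso M N -> hdim M = hdim N.
Proof.
move=> [F [F' [FF [FF' _]]]]; apply/eqP; rewrite eqn_leq.
by rewrite -{1}(mxrank1 k (hdim M)) -FF mulmx_max_rank -(mxrank1 k (hdim N)) -FF' mulmx_max_rank.
Qed.

(** Correcting [Pi] by the inverse of [Pi *m I] gives a retraction [Q] of [I]; the complement is the
    image of the idempotent [1 - I Q], realized by a full-rank factorization [Z *m Y]. Only
    invertibility of [Pi *m I] is required because the pairings constructed below are triangular
    rather than the identity. *)
Lemma split_summand M U (I : 'M[k]_(hdim M, hdim U)) (Pi : 'M[k]_(hdim U, hdim M)) :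
  wmod M -> Pi *m I \in unitmx ->
  (forall g, I *m hg U g = hg M g *m I) -> I *m hx U = hx M *m I ->
  (forall g, Pi *m hg M g = hg U g *m Pi) -> Pi *m hx M = hx U *m Pi ->
  exists M', wmod M' /\ hiso M (hdsum U M').
Proof.
move=> wM uPI Ig Ix Pg Px; have [th thE] : exists th, th = Pi *m I by exists (Pi *m I).
rewrite -thE in uPI.
have thV (A : 'M[k]_(hdim U)) : th *m A = A *m th -> invmx th *m A = A *m invmx th.
  move=> H; rewrite -[LHS]mulmx1 -(mulmxV uPI) -!mulmxA (mulmxA A) -H.
  by rewrite -mulmxA mulKmx.
pose Q := invmx th *m Pi.
have QI : Q *m I = 1%:M by rewrite /Q -mulmxA -thE mulVmx.
have Qg g : Q *m hg M g = hg U g *m Q.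
  by rewrite /Q -mulmxA Pg !mulmxA thV // thE -mulmxA Ig mulmxA Pg mulmxA.
have Qx : Q *m hx M = hx U *m Q.
  by rewrite /Q -mulmxA Px !mulmxA thV // thE -mulmxA Ix mulmxA Px mulmxA.
pose f := 1%:M - I *m Q.
have fI : f *m I = 0 by rewrite mulmxBl mul1mx -mulmxA QI mulmx1 subrr.
have Qf : Q *m f = 0 by rewrite mulmxBr mulmx1 mulmxA QI mul1mx subrr.
have ff : f *m f = f by rewrite {2}/f mulmxBr mulmx1 mulmxA fI mul0mx subr0.
have fC (A : 'M[k]_(hdim M)) B : I *m B = A *m I -> Q *m A = B *m Q -> f *m A = A *m f.
  by move=> IA QA; rewrite mulmxBl mulmxBr mul1mx mulmx1 -mulmxA QA !mulmxA IA.
have [r [Z [Z' [Y [Y' [ZY Z'Z YY']]]]]] : exists r (Z : 'M[k]_(hdim M, r)) Z' Y Y',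
    [/\ Z *m Y = f, Z' *m Z = 1%:M & Y *m Y' = 1%:M].
  have [Z' Z'Z] := row_fullP (col_base_full f).
  have [Y' YY'] := row_freeP (row_base_free f).
  by exists (\rank f), (col_base f), Z', (row_base f), Y'; split=> //; apply: mulmx_base.
have YZ : Y *m Z = 1%:M.
  have := congr1 (fun A => Z' *m A *m Y') (etrans (congr2 mulmx ZY ZY) (etrans ff (esym ZY))).
  by rewrite /= !mulmxA Z'Z mul1mx -!mulmxA YY' !mulmx1.
have Yf : Y *m f = Y by rewrite -ZY mulmxA YZ mul1mx.
have fZ : f *m Z = Z by rewrite -ZY -mulmxA YZ mulmx1.
pose M' := @HMod k G r (fun g => Y *m hg M g *m Z) (Y *m hx M *m Z).
have YA (A : 'M[k]_(hdim M)) : f *m A = A *m f -> Y *m A = (Y *m A *m Z) *m Y.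
  by move=> fA; rewrite -(mulmxA (_ *m A)) ZY -mulmxA -fA mulmxA Yf.
have Yg g : Y *m hg M g = hg M' g *m Y by apply: YA; apply: fC (Ig g) (Qg g).
have Yx : Y *m hx M = hx M' *m Y by apply: YA; apply: fC Ix Qx.
exists M'; split; first exact: (@wmod_surj _ _ chi M M' Y Z wM YZ Yg Yx).
exists (col_mx Q Y), (row_mx I Z); split.
  by rewrite mul_row_col ZY /f addrC subrK.
split.
  rewrite mul_col_row QI YZ -fZ mulmxA Qf mul0mx -Yf -mulmxA fI mulmx0.
  by rewrite -scalar_mx_block.
split=> [g|] /=; rewrite mul_col_mx mul_block_col !mul0mx addr0 add0r.
  by congr col_mx; [exact: Qg | exact: Yg].
by congr col_mx; [exact: Qx | exact: Yx].
Qed.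

End Split.

(** * The nilpotent shift and coordinate vectors *)

Section Shift.
Variable k : fieldType.

Definition Jm n : 'M[k]_n := \matrix_(i < n, j < n) (i == j.+1 :> nat)%:R.

(** The index is a natural number and an index out of range gives the zero vector, so that [Jm]
    raises the index without a side condition. *)
Definition dc n (c : nat) : 'cV[k]_n := \col_i (i == c :> nat)%:R.

Lemma Jm_dc n c : Jm n *m dc n c = dc n c.+1.
Proof.
apply/matrixP=> i j; rewrite !mxE.
have [cn|nc] := ltnP c n; last first.
  rewrite big1 => [|l _]; last first.
    by rewrite !mxE [_ == c](_ : _ = false) ?mulr0 //; apply/eqP => E; move: (ltn_ord l); rewrite E ltnNge nc.
  case: eqP => // E; by move: (ltn_ord i); rewrite E ltnNge ltnW.
rewrite (bigD1 (Ordinal cn)) //= big1 => [|l ne]; rewrite !mxE.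
  by rewrite /= eqxx mulr1 addr0.
rewrite [_ == c](_ : _ = false) ?mulr0 //; apply/eqP => E; case/eqP: ne; exact: val_inj.
Qed.

Lemma dc0 n c : (n <= c)%N -> dc n c = 0.
Proof.
move=> nc; apply/matrixP=> i j; rewrite !mxE; case: eqP => // E.
by move: (ltn_ord i); rewrite E ltnNge nc.
Qed.

Lemma mulmx_dcE m n (A : 'M[k]_(m, n)) (c : 'I_n) i j : (A *m dc n c) i j = A i c.
Proof.
rewrite mxE (bigD1 c) //= big1 => [|l ne]; rewrite !mxE ?eqxx ?mulr1 ?addr0 //.
by rewrite val_eqE (negPf ne) mulr0.
Qed.

Lemma dc_ext m n (A B : 'M[k]_(m, n)) : (forall c, (c < n)%N -> A *m dc n c = B *m dc n c) -> A = B.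
Proof.
move=> H; apply/matrixP=> i j; have /matrixP/(_ i 0) := H j (ltn_ord j).
by rewrite !mulmx_dcE.
Qed.

Lemma JmX_dc n e c : Jm n ^+ e *m dc n c = dc n (c + e).
Proof.
elim: e c => [|e IH] c; first by rewrite expr0 mul1mx addn0.
by rewrite exprSr -mulmxE -mulmxA Jm_dc IH addSnnS.
Qed.

Lemma JmX0 n e : (n <= e)%N -> Jm n ^+ e = 0.
Proof.
move=> ne; apply: dc_ext => c _; rewrite JmX_dc mul0mx dc0 //.
by rewrite (leq_trans ne) ?leq_addl.
Qed.

Lemma dc_dc n c d : (d < n)%N -> (dc n c)^T *m dc n d = (c == d)%:R%:M.
Proof.
move=> dn; rewrite -[d]/(val (Ordinal dn)); apply/matrixP=> i j.
by rewrite mulmx_dcE !mxE !ord1 mulr1n eq_sym.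
Qed.

Lemma JmX_top n : (0 < n)%N -> Jm n ^+ n.-1 = dc n n.-1 *m (dc n 0)^T.
Proof.
case: n => // n _; apply: dc_ext => c cn; rewrite JmX_dc -mulmxA dc_dc //.
case: c cn => [|c] cn /=; first by rewrite mulmx1.
by rewrite raddf0 mulmx0 dc0 // addSn ltnS leq_addl.
Qed.

Lemma mul_diag_dc n (d : 'rV[k]_n) (c : 'I_n) : diag_mx d *m dc n c = d 0 c *: dc n c.
Proof.
apply/matrixP=> i j; rewrite diag_mulmxE !mxE.
by case: (i =P c :> nat) => [/val_inj->|]; rewrite ?mulr0.
Qed.

Lemma tens_dc_ext r m n (A B : 'M[k]_(r, m * n)) :
  (forall c, (c < m)%N -> A *m (dc m c *t 1%:M) = B *m (dc m c *t 1%:M)) -> A = B.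
Proof.
move=> H; apply/matrixP=> i j; case: (mxtens_indexP j) => c l.
have E (C : 'M[k]_(r, m * n)) :
    (C *m (dc m c *t 1%:M)) i (mxtens_index (0 : 'I_1, l)) = C i (mxtens_index (c, l)).
  rewrite mxE (bigD1 (mxtens_index (c, l))) //= big1 => [|z].
    by rewrite tensmxE !mxE !eqxx !mulr1 addr0.
  case: (mxtens_indexP z) => x y; rewrite (can_eq (@mxtens_indexK _ _)) xpair_eqE => ne.
  rewrite tensmxE !mxE -val_eqE /=; move: ne; rewrite -!val_eqE /=.
  by case: eqP; case: eqP; rewrite ?mulr0 ?mul0r ?mulr0.
by rewrite -E H ?E.
Qed.

End Shift.

(** * The nilpotent indecomposables *)

Section Indec.
Variables (k : fieldType) (G : groupType) (chi : G -> k) (sb : nat).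
Hypothesis sb_gt0 : (0 < sb)%N.
Hypothesis chi_ord : chr_order chi sb.
Hypothesis chi_char : is_character chi.
Implicit Types (M N U V K : hmod k G).
Notation wmod := (is_wmod chi).
Notation Tg := (Tgm sb).
Notation Top := (TopM sb).

Let chi0 g : chi g != 0.
Proof. by case: chi_char. Qed.

Lemma chr1 (l : G -> k) : is_character l -> l 1%g = 1.
Proof.
move=> [l0 lM]; apply: (mulfI (l0 1%g)); by rewrite -lM mulg1 mulr1.
Qed.

Lemma char_one : is_character (@chr_one k G).
Proof. by split=> *; rewrite /chr_one ?oner_neq0 // mulr1. Qed.

Lemma char_mul (l m : G -> k) : is_character l -> is_character m -> is_character (chr_mul l m).
Proof.
move=> [l0 lM] [m0 mM]; split=> *; rewrite /chr_mul ?mulf_neq0 //.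
by rewrite lM mM mulrACA.
Qed.

Lemma char_pow (l : G -> k) n : is_character l -> is_character (chr_pow l n).
Proof.
move=> cl; elim: n => [|n IH]; first by rewrite chr_pow0; apply: char_one.
by rewrite chr_powS; apply: char_mul.
Qed.

Definition Vw n (la : G -> k) (i : 'I_n) := chr_mul (chr_pow chi i) la.

Lemma Vt_diag n la : @is_diag k G (Vt chi n la) (@Vw n la).
Proof.
move=> g; apply/matrixP=> i j; rewrite !mxE /Vw /chr_mul /chr_pow.
by case: eqP => [->|]; rewrite ?mul1r ?mul0r ?mulr1n.
Qed.

Lemma Vt_hx n la : hx (Vt chi n la) = Jm k n.
Proof. by []. Qed.

Lemma diagw_dc n (w : 'I_n -> G -> k) g (c : 'I_n) : diagw w g *m dc k n c = w c g *: dc k n c.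
Proof. by rewrite mul_diag_dc mxE. Qed.

Lemma Vt_wmod n la : is_character la -> wmod (Vt chi n la).
Proof.
move=> cl; apply: (wmod_diag (@Vt_diag n la)).
- by move=> i; apply: chr1; apply: char_mul => //; apply: char_pow.
- by move=> i g h; have [_ H] := char_mul (char_pow i chi_char) cl; apply: H.
move=> g; rewrite Vt_hx Vt_diag; apply: dc_ext => c cn.
have cE : c = Ordinal cn by []; rewrite -mulmxA cE diagw_dc -scalemxAr Jm_dc -cE.
rewrite -scalemxAl -mulmxA Jm_dc; have [cn1|cn1] := ltnP c.+1 n; last first.
  by rewrite dc0 // mulmx0 !scaler0.
have -> : c.+1 = Ordinal cn1 by []; rewrite diagw_dc scalerA; congr (_ *: _).
by rewrite /Vw /chr_mul /chr_pow /= exprS -mulrA mulKf.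
Qed.

(** The last nonzero power of the shift sends [m_0] to [m_(n-1)] and kills the other basis vectors.
    Its covector is the coordinate of [m_0], hence of weight [la]. *)
Lemma Vt_top n la : (0 < n)%N -> Top (Vt chi n la) 0 n (fun _ : 'I_1 => la).
Proof.
move=> n0; split=> //; rewrite /TopM /Tgm eqxx Vt_hx.
exists (dc k n n.-1), (dc k n n.-1)^T, (dc k n 0)^T, (dc k n 0); split.
- by rewrite dc_dc ?eqxx // prednK.
- by rewrite dc_dc ?eqxx.
- move=> g; rewrite Vt_diag; apply/matrixP=> i j; rewrite mulmx_diagE diag_mulmxE !mxE.
  rewrite /Vw /chr_mul /chr_pow; case: eqP => [->|]; last by rewrite mul0r mulr0.
  by rewrite expr0 !mul1r mulr1.
- exact: JmX_top.
exact: JmX0.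
Qed.

End Indec.

(** * The indecomposables on which [x] is invertible *)

Section Cyclic.
Variables (k : fieldType) (G : groupType) (chi : G -> k) (sb : nat).
Hypothesis sb_gt0 : (0 < sb)%N.
Hypothesis chi_ord : chr_order chi sb.
Hypothesis chi_char : is_character chi.
Implicit Types (M N U V K : hmod k G).
Notation wmod := (is_wmod chi).
Notation Tg := (Tgm sb).

Let chi0 g : chi g != 0.
Proof. by case: chi_char. Qed.

Let chisb g : chi g ^+ sb = 1.
Proof. by have := congr1 (fun f => f g) (chr_powsb chi_ord). Qed.

Definition Em n : 'M[k]_n := \matrix_(i < n, j < n) ((i == 0%N :> nat) && (j.+1 == n))%:R.

Lemma Em_dc n c : Em n *m dc k n c = (c.+1 == n)%:R *: dc k n 0.
Proof.
have [cn|nc] := ltnP c n; last first.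
  rewrite dc0 // mulmx0 [_ == n](_ : _ = false) ?scale0r //.
  by apply/eqP => E; move: nc; rewrite -E ltnn.
have -> : c = Ordinal cn by []; apply/matrixP=> i j; rewrite mulmx_dcE !mxE /=.
by rewrite -natrM mulnb andbC.
Qed.

(* [x ^+ sb] acts as the Jordan block [ga%:M + Jm n] on every weight space. *)
Definition Ut n (la : G -> k) (ga : k) : hmod k G :=
  @HMod k G (sb * n) (fun g => diagw (@Vw k G chi sb la) g *t 1%:M)
    (Jm k sb *t 1%:M + Em sb *t (ga%:M + Jm k n)).

Lemma Ut_hx_dc n la ga m c (B : 'M[k]_(n, m)) :
  hx (Ut n la ga) *m (dc k sb c *t B) =
  dc k sb c.+1 *t B + (c.+1 == sb)%:R *: (dc k sb 0 *t ((ga%:M + Jm k n) *m B)).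
Proof. by rewrite mulmxDl !tensmx_mul mul1mx Jm_dc Em_dc tensZl. Qed.

Lemma Ut_hxX_dc n la ga m c e (B : 'M[k]_(n, m)) : (c + e < sb)%N ->
  hx (Ut n la ga) ^+ e *m (dc k sb c *t B) = dc k sb (c + e) *t B.
Proof.
elim: e c => [|e IH] c ce; first by rewrite expr0 mul1mx addn0.
rewrite exprSr -mulmxE -mulmxA Ut_hx_dc [_ == sb](_ : _ = false); last first.
  by apply/eqP => E; move: ce; rewrite -E addnS ltnS ltnNge leq_addr.
by rewrite scale0r addr0 IH addSnnS.
Qed.

(** On block 0, [sb] steps go once around the cycle and meet the Jordan block at the last one. Block
    [c] is the image of block 0 under [x ^+ c], which commutes with [x ^+ sb]. *)
Lemma Ut_hx_sb n la ga : hx (Ut n la ga) ^+ sb = 1%:M *t (ga%:M + Jm k n).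
Proof.
have H0 m (B : 'M[k]_(n, m)) : hx (Ut n la ga) ^+ sb *m (dc k sb 0 *t B) =
    dc k sb 0 *t ((ga%:M + Jm k n) *m B).
  have -> : hx (Ut n la ga) ^+ sb = hx (Ut n la ga) *m hx (Ut n la ga) ^+ sb.-1.
    by rewrite mulmxE -exprS prednK.
  rewrite -mulmxA Ut_hxX_dc ?prednK // add0n.
  rewrite Ut_hx_dc prednK // eqxx scale1r dc0 // .
  by rewrite tens0mx add0r.
apply: tens_dc_ext => c cs; rewrite tensmx_mul mul1mx mulmx1.
have {1}-> : dc k sb c *t 1%:M = hx (Ut n la ga) ^+ c *m (dc k sb 0 *t (1%:M : 'M[k]_n)).
  by rewrite Ut_hxX_dc.
rewrite mulmxA mulmxE -exprD addnC exprD -mulmxE -mulmxA H0 mulmx1.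
by rewrite Ut_hxX_dc.
Qed.

Definition Uw n la (i : 'I_(sb * n)) := @Vw k G chi sb la (mxtens_unindex i).1.

Lemma Ut_diag n la ga : @is_diag k G (Ut n la ga) (@Uw n la).
Proof.
move=> g; rewrite /= -diag_const_mx tens_diag; congr diag_mx.
by apply/matrixP=> i j; rewrite !mxE mulr1.
Qed.

Lemma Ut_hg_dc n la ga m c (B : 'M[k]_(n, m)) g : (c < sb)%N ->
  hg (Ut n la ga) g *m (dc k sb c *t B) = (chi g ^+ c * la g) *: (dc k sb c *t B).
Proof.
move=> cs; rewrite /= tensmx_mul mul1mx; have cE : c = Ordinal cs by [].
by rewrite cE diagw_dc tensZl.
Qed.

Lemma Ut_wmod n la ga : is_character la -> wmod (Ut n la ga).
Proof.
move=> cl; apply: (wmod_diag (@Ut_diag n la ga)).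
- by move=> i; apply: chr1; apply: char_mul => //; apply: char_pow.
- move=> i g h; rewrite /Uw /Vw.
  by have [_ H] := char_mul (char_pow (mxtens_unindex i).1 chi_char) cl; apply: H.
move=> g; apply: tens_dc_ext => c cs; rewrite -mulmxA Ut_hg_dc // -scalemxAr.
rewrite -scalemxAl -mulmxA Ut_hx_dc.
have [cs1|cs1] := ltnP c.+1 sb.
  rewrite [_ == sb](_ : _ = false) ?scale0r ?addr0; last by rewrite ltn_eqF.
  by rewrite Ut_hg_dc // scalerA; congr (_ *: _); rewrite exprS -mulrA mulKf.
(* At the wrap-around the weight falls from [chi ^+ sb.-1 * la] back to [la]; this is compatible
   with [x] because [chi g ^+ sb = 1]. *)
have E : c.+1 = sb by apply/eqP; rewrite eqn_leq cs.
rewrite E eqxx dc0 // tens0mx add0r scale1r Ut_hg_dc // scalerA expr0 mul1r.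
congr (_ *: _); apply: (mulfI (chi0 g)).
by rewrite mulVKf // mulrA -exprS E chisb mul1r.
Qed.

(* Top layer of a module of type [(la, ga, n)]: for [ga != 0] it is a full
   orbit of weights. *)
Definition TopB M la ga n := exists c (w : 'I_c -> G -> k),
  [/\ TopM sb M ga n w, injective w
    & forall mu, (exists i, w i = mu) <->
        if ga == 0 then mu = la else exists m, mu = chr_mul (chr_pow chi m) la].

Lemma TopB_iso M N la ga n : hiso M N -> TopB M la ga n -> TopB N la ga n.
Proof.
by move=> MN [c [w [H wI wE]]]; exists c, w; split=> //; apply: Top_iso H.
Qed.

Lemma Vt_topB n la : (0 < n)%N -> TopB (Vt chi n la) la 0 n.
Proof.
move=> n0; exists 1%N, (fun _ => la); split; first exact: Vt_top.
  by move=> i j _; rewrite !ord1.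
by move=> mu; rewrite eqxx; split=> [[]|->] //; exists 0.
Qed.

Lemma Uw_inj la : is_character la -> injective (@Uw 1 la).
Proof.
move=> [la0 _] i j; case: (mxtens_indexP i) => i1 i2; case: (mxtens_indexP j) => j1 j2.
rewrite /Uw !mxtens_indexK /= => /(orbw_inj chi_ord chi0 la0) ->.
by rewrite !ord1.
Qed.

Lemma Uw_orbit la mu :
  (exists i, @Uw 1 la i = mu) <-> exists m, mu = chr_mul (chr_pow chi m) la.
Proof.
split=> [[i <-]|[m ->]]; first by exists (mxtens_unindex i).1.
have ms : (m %% sb < sb)%N by rewrite ltn_mod.
exists (mxtens_index (Ordinal ms, 0)); rewrite /Uw mxtens_indexK /Vw /=.
by rewrite -chr_pow_mod.
Qed.

(** After subtraction of [ga] the operator is [1 *t Jm]: one copy of a nilpotent block for each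
    weight of the orbit, so the top layer is the tensor of the identity with that of one block. *)
Lemma Ut_topB n la ga : is_character la -> (0 < n)%N -> ga != 0 -> TopB (Ut n la ga) la ga n.
Proof.
move=> cl n0 g0; exists (sb * 1)%N, (@Uw 1 la); split; last first.
- by move=> mu; rewrite (negPf g0); apply: Uw_orbit.
- exact: Uw_inj.
have TE : Tg ga (hx (Ut n la ga)) = 1%:M *t Jm k n.
  rewrite /Tgm (negPf g0) Ut_hx_sb tensDr addrAC; set A := (X in X - _).
  have -> : A = ga%:M; last by rewrite subrr add0r.
  by rewrite /A -[ga%:M in LHS]scalemx1 tensZr tens1 scalemx1.
split=> //; rewrite TE.
exists (1%:M *t dc k n n.-1), (1%:M *t (dc k n n.-1)^T), (1%:M *t (dc k n 0)^T), (1%:M *t dc k n 0).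
split.
- by rewrite tensmx_mul mul1mx dc_dc ?eqxx ?tens1 // prednK.
- by rewrite tensmx_mul mul1mx dc_dc ?eqxx ?tens1.
- move=> g; rewrite (_ : diagw _ g = diagw (@Vw k G chi sb la) g *t 1%:M); last first.
    by have <- := @Ut_diag 1 la 0 g.
  by rewrite !tensmx_mul !mul1mx !mulmx1.
- by rewrite tensX expr1n JmX_top // tensmx_mul mul1mx.
by rewrite tensX JmX0 ?tensmx0.
Qed.

Lemma Ut_hx_unit n la ga : ga != 0 -> hx (Ut n la ga) \in unitmx.
Proof.
move=> g0; apply: (unitmx_expV sb_gt0); rewrite Ut_hx_sb addrC.
have uL := unitmx_shift_nilp (JmX0 k (leqnn n)) g0.
have /mulmx1_unit [] // : (1%:M *t (Jm k n + ga%:M)) *m (1%:M *t invmx (Jm k n + ga%:M)) = 1%:M :> 'M_(sb * n).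
by rewrite tensmx_mul mul1mx mulmxV // tens1.
Qed.

(** The isomorphism is [x] itself: invertible for nonzero [ga], it shifts weights by [chi]. *)
Lemma Ut_shift n la ga : is_character la -> ga != 0 ->
  hiso (Ut n (chr_mul chi la) ga) (Ut n la ga).
Proof.
move=> cl g0; have u := Ut_hx_unit n la g0.
have [_ [_ [Hx _]]] := Ut_wmod n ga cl.
exists (hx (Ut n la ga)), (invmx (hx (Ut n la ga))); split; first exact: mulVmx.
split; first exact: mulmxV.
split=> // g.
have -> : hg (Ut n (chr_mul chi la) ga) g = chi g *: hg (Ut n la ga) g.
  rewrite !Ut_diag; apply/matrixP=> i j; rewrite !mxE mulrnAr; congr (_ *+ _).
  by rewrite /Uw /Vw /chr_mul mulrCA.
by rewrite -scalemxAr Hx scalerA mulfV // scale1r.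
Qed.

Lemma Ut_crep n la ga : is_character la -> ga != 0 -> hiso (Ut n la ga) (Ut n (crep chi la) ga).
Proof.
move=> cl g0; have [m ->] := crep_spec chi la.
elim: m => [|m IH]; first by rewrite chr_pow0 chr_mul1; apply: hiso_refl.
apply: hiso_trans IH _; apply: hiso_sym; rewrite chr_powS -chr_mulA.
by apply: Ut_shift => //; apply: char_mul => //; apply: char_pow.
Qed.

(** ** Splitting off an indecomposable summand *)

Section TopPair.
Variables (M : hmod k G) (ga : k) (n : nat) (la : G -> k).
Variables (v : 'cV[k]_(hdim M)) (phi : 'rV[k]_(hdim M)).
Local Notation X := (hx M).
Local Notation T := (Tg ga (hx M)).
Hypotheses (wM : wmod M) (n0 : (0 < n)%N) (cla : is_character la).
Hypothesis (Tv : T ^+ n *m v = 0) (phT : phi *m T ^+ n = 0).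
Hypothesis phTv : phi *m T ^+ n.-1 *m v = 1%:M.
Hypothesis gv : forall g, hg M g *m v = la g *: v.

Definition krylov : 'M[k]_(hdim M, n) := \matrix_(i, j) (T ^+ j *m v) i 0.
(** The exponents decrease with the row index so that this map intertwines [T] with [Jm] itself, and
    not with its transpose. *)
Definition krow : 'M[k]_(n, hdim M) := \matrix_(i, j) (phi *m T ^+ (n.-1 - i)) 0 j.

Lemma kv_dc c : (c < n)%N -> krylov *m dc k n c = T ^+ c *m v.
Proof.
move=> cn; have cE : c = Ordinal cn by []; apply/matrixP=> i j.
by rewrite {1}cE mulmx_dcE mxE ord1.
Qed.

Lemma kv_J : krylov *m Jm k n = T *m krylov.
Proof.
apply: dc_ext => c cn; rewrite -!mulmxA Jm_dc (kv_dc cn) mulmxA mulmxE -exprS.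
have [cn1|cn1] := ltnP c.+1 n; first by rewrite kv_dc.
by rewrite dc0 // mulmx0 (_ : c.+1 = n) ?Tv //; apply/eqP; rewrite eqn_leq cn.
Qed.

Lemma kphi_dc c : (c < n)%N -> (dc k n c)^T *m krow = phi *m T ^+ (n.-1 - c).
Proof.
move=> cn; have cE : c = Ordinal cn by []; apply: trmx_inj.
rewrite trmx_mul trmxK; apply/matrixP=> i j; rewrite {1}cE mulmx_dcE.
by rewrite [LHS]mxE [LHS]mxE [RHS]mxE ord1.
Qed.

Lemma dcT_ext m d (A B : 'M[k]_(m, d)) :
  (forall c, (c < m)%N -> (dc k m c)^T *m A = (dc k m c)^T *m B) -> A = B.
Proof.
move=> H; apply: trmx_inj; apply: dc_ext => c cn; apply: trmx_inj.
by rewrite !trmx_mul !trmxK H.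
Qed.

Lemma dcT_J m c : (dc k m c)^T *m Jm k m = if c is c'.+1 then (if (c < m)%N then (dc k m c')^T else 0) else 0.
Proof.
apply: dc_ext => d dm; rewrite -mulmxA Jm_dc.
have [d1|d1] := ltnP d.+1 m; last first.
  rewrite (dc0 k d1) mulmx0; case: c => [|c]; rewrite ?mul0mx //.
  case: ltnP => cm; rewrite ?mul0mx // dc_dc //; case: eqP => [E|]; last by rewrite raddf0.
  by move: cm; rewrite E ltnNge d1.
rewrite dc_dc //; case: c => [|c]; first by rewrite raddf0 mul0mx.
case: ltnP => cm; first by rewrite dc_dc // eqSS.
rewrite mul0mx; case: eqP => [E|]; last by rewrite raddf0.
by move: cm; rewrite E leqNgt d1.
Qed.

Lemma J_kphi : Jm k n *m krow = krow *m T.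
Proof.
apply: dcT_ext => c cn; rewrite !mulmxA kphi_dc // dcT_J.
case: c cn => [|c] cn.
  by rewrite mul0mx subn0 -mulmxA mulmxE -exprSr prednK // phT.
rewrite cn kphi_dc; last exact: ltnW.
have -> : (n.-1 - c = (n.-1 - c.+1).+1)%N by lia.
by rewrite exprSr -mulmxE mulmxA.
Qed.

Lemma entry_dc m d (A : 'M[k]_(m, d)) (i : 'I_m) (j : 'I_d) :
  A i j = ((dc k m i)^T *m A *m dc k d j) 0 0.
Proof.
rewrite mulmx_dcE mxE (bigD1 i) //= big1 => [|l ne]; rewrite !mxE ?eqxx ?mul1r ?addr0 //.
by rewrite val_eqE (negPf ne) mul0r.
Qed.

(* Unipotent up to the scalar [c]. *)
Lemma kphi_kv_unit (B : 'M[k]_(hdim M)) c : c != 0 -> GRing.comm B T ->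
  phi *m B *m T ^+ n.-1 *m v = c%:M -> krow *m B *m krylov \in unitmx.
Proof.
move=> c0 BT H; have E (i j : 'I_n) : (krow *m B *m krylov) i j =
    (phi *m B *m T ^+ (n.-1 - i + j) *m v) 0 0.
  rewrite [LHS]entry_dc.
  rewrite !mulmxA kphi_dc // -!mulmxA kv_dc // !mulmxA; congr ((_ *m v) 0 0).
  by rewrite -!mulmxA; congr (phi *m _); rewrite !mulmxE mulrA -(commrX _ BT) -mulrA exprD.
rewrite unitmxE det_trig.
  rewrite (eq_bigr (fun=> c)) => [|i _]; first by rewrite prodr_const unitfE expf_neq0.
  have i_n : (i <= n.-1)%N by rewrite -ltnS prednK.
  by rewrite E (subnK i_n) H mxE eqxx mulr1n.
(* Above the diagonal the exponent of [T] is at least [n], and [phi *m T ^+ n] vanishes. *)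
apply/is_trig_mxP => i j ij; rewrite E.
have -> : (n.-1 - i + j = n + (j - i).-1)%N by move: (ltn_ord j) ij n0; lia.
rewrite exprD; have -> : phi *m B *m (T ^+ n * T ^+ (j - i).-1) = phi *m T ^+ n *m (B *m T ^+ (j - i).-1).
  rewrite -!mulmxA; congr (phi *m _).
  by rewrite !mulmxE mulrA (commrX _ BT) mulrA.
by rewrite phT mul0mx mul0mx mxE.
Qed.

End TopPair.

End Cyclic.

(** * Splitting off a string or a cycle of Jordan blocks *)

Section Decomposition.
Variables (k : closedFieldType) (G : groupType) (chi : G -> k) (sb : nat).
Hypothesis sb_gt0 : (0 < sb)%N.
Hypothesis chi_ord : chr_order chi sb.
Hypothesis chi_char : is_character chi.
Implicit Types (M N U V K : hmod k G).
Notation wmod := (is_wmod chi).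
Notation Tg := (Tgm sb).
Notation Ut := (Ut chi sb).
Notation TopB := (TopB chi sb).

Let chi0 g : chi g != 0.
Proof. by case: chi_char. Qed.

Let chisb g : chi g ^+ sb = 1.
Proof. by have := congr1 (fun f => f g) (chr_powsb chi_ord). Qed.

Lemma hg_hx M g : wmod M -> hg M g *m hx M = chi g *: (hx M *m hg M g).
Proof. by move=> [_ [_ [H _]]]; rewrite H scalerA mulfV // scale1r. Qed.

Lemma hg_hxX M g e : wmod M -> hg M g *m hx M ^+ e = chi g ^+ e *: (hx M ^+ e *m hg M g).
Proof.
move=> wM; elim: e => [|e IH]; first by rewrite !expr0 mul1mx mulmx1 scale1r.
rewrite exprS -mulmxE mulmxA hg_hx // -scalemxAl -mulmxA IH -scalemxAr scalerA.
by rewrite -exprS mulmxA.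
Qed.

Lemma hx_hgX M g e : wmod M -> hx M ^+ e *m hg M g = (chi g ^+ e)^-1 *: (hg M g *m hx M ^+ e).
Proof. by move=> wM; rewrite hg_hxX // scalerA mulVf ?scale1r // expf_neq0. Qed.

Lemma hg_hxsb M g : wmod M -> GRing.comm (hg M g) (hx M ^+ sb).
Proof. by move=> wM; rewrite /GRing.comm -!mulmxE hg_hxX // chisb scale1r. Qed.

Lemma hg_Tg M g ga : wmod M -> ga != 0 -> GRing.comm (hg M g) (Tg ga (hx M)).
Proof.
move=> wM g0; rewrite /Tgm (negPf g0); apply: commrB; first exact: hg_hxsb.
by rewrite /GRing.comm -!mulmxE scalar_mxC.
Qed.

Lemma hx_Tg M ga : GRing.comm (hx M) (Tg ga (hx M)).
Proof.
rewrite /Tgm; case: eqP => // _; apply: commrB; first exact: commrX.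
by rewrite /GRing.comm -!mulmxE scalar_mxC.
Qed.

Lemma diagw_dcT n (w : 'I_n -> G -> k) g (c : 'I_n) :
  (dc k n c)^T *m diagw w g = w c g *: (dc k n c)^T.
Proof. by apply: trmx_inj; rewrite trmx_mul trmxK tr_diag_mx diagw_dc linearZ /= trmxK. Qed.

(** The vector [v] starts a string of length [n], and [phi] has the weight of the end of that
    string. With these weights [krylov] and [krow] are module maps to and from [M], and their
    composite is unitriangular. *)
Lemma split_nilp M n la (v : 'cV[k]_(hdim M)) (phi : 'rV[k]_(hdim M)) :
  wmod M -> (0 < n)%N -> is_character la ->
  hx M ^+ n *m v = 0 -> phi *m hx M ^+ n = 0 -> phi *m hx M ^+ n.-1 *m v = 1%:M ->
  (forall g, hg M g *m v = la g *: v) ->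
  (forall g, phi *m hg M g = (chi g ^+ n.-1 * la g) *: phi) ->
  exists M', wmod M' /\ hiso M (hdsum (Vt chi n la) M').
Proof.
move=> wM n0 cla; have TE : Tg 0 (hx M) = hx M by rewrite /Tgm eqxx.
rewrite -{1 2 3}TE => Tv phT phTv gv phg.
have kJ := kv_J Tv; have Jk := J_kphi sb_gt0 n0 phT.
apply: (@split_summand _ _ chi M (Vt chi n la) (krylov sb 0 n v) (krow sb 0 n phi)) => //.
- have := @kphi_kv_unit _ _ sb sb_gt0 M 0 n v phi n0 phT 1%:M 1; rewrite !mulmx1; apply.
  + exact: oner_neq0.
  + exact/commr_sym/commr1.
  exact: phTv.
- move=> g; rewrite Vt_diag; apply: dc_ext => c cn.
  have cE : c = Ordinal cn by []; rewrite -mulmxA {1}cE diagw_dc -scalemxAr -mulmxA.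
  rewrite (kv_dc sb 0 v cn) TE mulmxA hg_hxX // -scalemxAl -mulmxA gv -scalemxAr scalerA.
  by [].
- by rewrite -TE -kJ.
- move=> g; rewrite Vt_diag; apply: dcT_ext => c cn.
  have cE : c = Ordinal cn by []; rewrite !mulmxA {2}cE diagw_dcT -scalemxAl.
  rewrite (kphi_dc sb 0 phi cn) TE -mulmxA hx_hgX // -scalemxAr mulmxA phg -scalemxAl scalerA.
  congr (_ *: _); rewrite /Vw /chr_mul /chr_pow /= mulrA; congr (_ * _).
  have cn' : (c < n)%N := cn.
  have -> : n.-1 = (n.-1 - c + c)%N by clear -cn'; lia.
  by rewrite exprD addnK mulKf // expf_neq0.
by rewrite -{1}TE -Jk.
Qed.

Lemma tens_dc_ext2 r m n (A B : 'M[k]_(r, m * n)) :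
  (forall c e, (c < m)%N -> (e < n)%N ->
     A *m (dc k m c *t dc k n e) = B *m (dc k m c *t dc k n e)) -> A = B.
Proof.
move=> H; apply/matrixP=> i j; case: (mxtens_indexP j) => c l.
have E (C : 'M[k]_(r, m * n)) :
    (C *m (dc k m c *t dc k n l)) i (mxtens_index (0 : 'I_1, 0 : 'I_1)) = C i (mxtens_index (c, l)).
  rewrite mxE (bigD1 (mxtens_index (c, l))) //= big1 => [|z].
    by rewrite tensmxE !mxE !eqxx !mulr1 addr0.
  case: (mxtens_indexP z) => x y; rewrite (can_eq (@mxtens_indexK _ _)) xpair_eqE => ne.
  rewrite tensmxE !mxE; move: ne; rewrite -!val_eqE /=.
  by case: eqP; case: eqP; rewrite ?mulr0 ?mul0r ?mulr0.
by rewrite -E H ?E.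
Qed.

Lemma tens_dcT_ext2 r m n (A B : 'M[k]_(m * n, r)) :
  (forall c e, (c < m)%N -> (e < n)%N ->
     ((dc k m c)^T *t (dc k n e)^T) *m A = ((dc k m c)^T *t (dc k n e)^T) *m B) -> A = B.
Proof.
move=> H; apply: trmx_inj; apply: tens_dc_ext2 => c e cm en; apply: trmx_inj.
by rewrite !trmx_mul !trmxK !trmx_tens H.
Qed.

Lemma dcT_Em c : (c < sb)%N -> (dc k sb c)^T *m Em k sb = (c == 0%N)%:R *: (dc k sb sb.-1)^T.
Proof.
move=> cs; apply: dc_ext => d ds; rewrite -mulmxA Em_dc -scalemxAr -scalemxAl !dc_dc //.
rewrite !scale_scalar_mx -!natrM !mulnb; congr (_%:R%:M); congr nat_of_bool.
by rewrite andbC; congr (_ && _); rewrite -[X in _ == X](prednK sb_gt0) eqSS eq_sym.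
Qed.

(** The summand is spanned by the vectors [X ^+ c *m (T ^+ e *m v)], and the dual map has the rows
    [phi *m T ^+ (n.-1 - e) *m X ^+ (sb - c)]. Comparison of weights makes the composite block
    diagonal, with the same invertible block [Q] for every [c]. *)
Lemma split_cyc M n la ga (v : 'cV[k]_(hdim M)) (phi : 'rV[k]_(hdim M)) :
  wmod M -> (0 < n)%N -> is_character la -> ga != 0 ->
  Tg ga (hx M) ^+ n *m v = 0 -> phi *m Tg ga (hx M) ^+ n = 0 ->
  phi *m Tg ga (hx M) ^+ n.-1 *m v = 1%:M ->
  (forall g, hg M g *m v = la g *: v) -> (forall g, phi *m hg M g = la g *: phi) ->
  exists M', wmod M' /\ hiso M (hdsum (Ut n la ga) M').
Proof.
move=> wM n0 cla g0; set X := hx M; set T := Tg ga X => Tv phT phTv gv phg.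
have kJ := kv_J Tv; have Jk := J_kphi sb_gt0 n0 phT.
have uK := kphi_kv_unit (v := v) sb_gt0 n0 phT.
have kvE := @kv_dc _ _ sb M ga n v; have kpE := @kphi_dc _ _ sb M ga n phi.
move: kJ Jk uK kvE kpE; set kv := krylov _ _ _ _; set kp := krow _ _ _ _ => kJ Jk uK kvE kpE.
rewrite -/X -/T in kJ Jk kvE kpE uK.
have cXT : GRing.comm X T by apply: hx_Tg.
have XTX e1 e2 : X ^+ e1 *m T ^+ e2 = T ^+ e2 *m X ^+ e1.
  exact: (commrX _ (commr_sym (commrX _ (commr_sym cXT)))).
have XT e : X ^+ e *m T = T *m X ^+ e by have := XTX e 1%N; rewrite expr1.
have Xsb : X ^+ sb = T + ga%:M by rewrite /T /Tgm (negPf g0) subrK.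
pose I : 'M[k]_(hdim M, sb * n) := \matrix_(b, c)
   (X ^+ (mxtens_unindex c).1 *m kv) b (mxtens_unindex c).2.
(* The exponent [sb - c] replaces [- c], so that the diagonal blocks of [P *m I] all carry
   [X ^+ sb]. *)
pose P : 'M[k]_(sb * n, hdim M) := \matrix_(c, b)
   (kp *m X ^+ (sb - (mxtens_unindex c).1)) (mxtens_unindex c).2 b.
have IE c (B : 'cV[k]_n) : (c < sb)%N -> I *m (dc k sb c *t B) = X ^+ c *m kv *m B.
  move=> cs; have cE : c = Ordinal cs by []; apply/matrixP=> i j.
  rewrite mxE sum_mxtens (bigD1 (Ordinal cs)) //= [X in _ + X]big1 ?addr0 => [|l ne].
    rewrite [RHS]mxE; apply: eq_bigr => e _.
    rewrite [I _ _]mxE mxtens_indexK /= [(_ *t B) _ _]mxE mxtens_indexK /= [dc _ _ _ _ _]mxE /= eqxx mul1r.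
    by congr (_ * B _ _); rewrite !ord1.
  rewrite big1 // => e _; rewrite [(_ *t B) _ _]mxE mxtens_indexK /= [dc _ _ _ _ _]mxE.
  by rewrite {1}cE val_eqE (negPf ne) mul0r mulr0.
have PE c (B : 'rV[k]_n) : (c < sb)%N ->
    ((dc k sb c)^T *t B) *m P = B *m (kp *m X ^+ (sb - c)).
  move=> cs; have cE : c = Ordinal cs by []; apply/matrixP=> i j.
  rewrite mxE sum_mxtens (bigD1 (Ordinal cs)) //= [X in _ + X]big1 ?addr0 => [|l ne].
    rewrite [RHS]mxE; apply: eq_bigr => e _.
    rewrite [P _ _]mxE mxtens_indexK /= [(_ *t B) _ _]mxE mxtens_indexK /= [(_^T) _ _]mxE [dc _ _ _ _ _]mxE /= eqxx mul1r.
    by congr (B _ _ * _); rewrite !ord1.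
  rewrite big1 // => e _; rewrite [(_ *t B) _ _]mxE mxtens_indexK /= [(_^T) _ _]mxE [dc _ _ _ _ _]mxE.
  by rewrite {1}cE val_eqE (negPf ne) mul0r mul0r.
(* As [X ^+ sb = T + ga] and [T ^+ n *m v = 0], the vector [phi] pairs with
   [X ^+ sb *m T ^+ n.-1 *m v] to [ga]; hence [Q] is triangular with diagonal [ga]. *)
pose Q := kp *m X ^+ sb *m kv.
have uQ : Q \in unitmx.
  apply: (uK _ ga g0); first exact: XT.
  rewrite Xsb mulmxDr mul_mx_scalar !mulmxDl -!scalemxAl phTv.
  rewrite -(mulmxA phi T) mulmxE -exprS prednK // -[_ *m v]mulmxA Tv mulmx0 add0r.
  by rewrite scale_scalar_mx mulr1.
have phX e g : phi *m X ^+ e *m hg M g = (chi g ^+ e)^-1 *: (la g *: (phi *m X ^+ e)).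
  by rewrite -mulmxA hx_hgX // -scalemxAr mulmxA phg -scalemxAl.
(* [phi] has weight [la], whereas [X ^+ e] moves a vector of weight [la] to weight [chi ^+ e * la];
   the pairing vanishes unless [chi ^+ e] is trivial. *)
have orth0 e e' : ~~ (sb %| e)%N -> phi *m X ^+ e *m (T ^+ e' *m v) = 0.
  move=> ne; apply/eqP; apply: contraT => nz.
  have Tg' g : hg M g *m (T ^+ e' *m v) = la g *: (T ^+ e' *m v).
    rewrite mulmxA (_ : hg M g *m T ^+ e' = T ^+ e' *m hg M g).
      by rewrite -mulmxA gv scalemxAr.
    exact: (commrX e' (hg_Tg g wM g0)).
  have E : chr_pow chi e = @chr_one k G.
    apply/funext => g; have [la0 _] := cla.
    have : phi *m X ^+ e *m hg M g *m (T ^+ e' *m v) = la g *: (phi *m X ^+ e *m (T ^+ e' *m v)).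
      by rewrite -mulmxA Tg' -scalemxAr.
    rewrite phX scalerA -scalemxAl => /eqP; rewrite -subr_eq0 -scalerBl scaler_eq0 (negPf nz) orbF.
    rewrite subr_eq0 => /eqP /(congr1 (fun x => x / la g)).
    rewrite mulfK // divff // => /(congr1 (fun x => x^-1)).
    by rewrite invrK invr1.
  rewrite (chr_pow_mod chi_ord) in E; case: chi_ord => _ [_ H].
  case: (H (e %% sb)%N) => //; rewrite ltn_mod sb_gt0 andbT lt0n.
  by rewrite -/(dvdn sb e).
have PI : P *m I = 1%:M *t Q.
  apply: tens_dc_ext2 => c' e' c's e'n; apply: tens_dcT_ext2 => c e cs en.
  rewrite -[P *m I *m _]mulmxA IE // mulmxA PE // !mulmxA kpE // !tensmx_mul mulmx1 dc_dc //.
  rewrite -!mulmxA kvE // !mulmxA.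
  rewrite -(mulmxA _ (X ^+ (sb - c))) mulmxE -exprD.
  rewrite -(mulmxA phi) -XTX (mulmxA phi) -!mulmxA.
  have -> : T ^+ (n.-1 - e) *m (T ^+ e' *m v) = T ^+ (n.-1 - e + e') *m v.
    by rewrite exprD -mulmxE mulmxA.
  case: eqP => [<-|ne]; last first.
    rewrite [X in _ = X](_ : _ = 0); last by rewrite raddf0 tens0mx.
    (* For distinct [c] and [c'] the exponent [sb - c + c'] lies strictly between 0 and [2 * sb] and
       is not [sb], so [sb] does not divide it. *)
    rewrite mulmxA orth0 //; apply/negP => /dvdnP [m E].
    have : (m < 2)%N by rewrite -(ltn_pmul2r sb_gt0) -E; lia.
    case: m E => [|[|//]] E _; first by move: E; lia.
    by apply: ne; move: E; lia.
  rewrite subnK; last exact: ltnW.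
  rewrite !mulmxA kpE // -(mulmxA _ (T ^+ _) (X ^+ sb)) -XTX.
  rewrite !mulmxA -(mulmxA _ (T ^+ _) (T ^+ _)) mulmxE -exprD.
  apply/matrixP=> i j; case: (mxtens_indexP i) => i1 i2; case: (mxtens_indexP j) => j1 j2.
  rewrite tensmxE !ord1 [_%:M _ _]mxE /= mul1r; congr (_ _ _); exact: val_inj.
have Ldc e : (ga%:M + Jm k n) *m dc k n e = ga *: dc k n e + dc k n e.+1.
  by rewrite mulmxDl mul_scalar_mx Jm_dc.
apply: (@split_summand _ _ chi M (Ut n la ga) I P) => //.
- rewrite PI; have /mulmx1_unit [] // : (1%:M *t Q) *m (1%:M *t invmx Q) = 1%:M :> 'M_(sb * n).
  by rewrite tensmx_mul mul1mx mulmxV // tens1.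
- move=> g; apply: tens_dc_ext2 => c e cs en; rewrite -mulmxA Ut_hg_dc // -scalemxAr -mulmxA !IE //.
  rewrite -mulmxA kvE // !mulmxA hg_hxX // -!scalemxAl -scalerA; congr (_ *: _).
  have gT : hg M g *m T ^+ e = T ^+ e *m hg M g := commrX e (hg_Tg g wM g0).
  rewrite -[hx M ^+ c *m hg M g *m T ^+ e]mulmxA gT.
  by rewrite -!mulmxA gv -!scalemxAr.
- apply: tens_dc_ext2 => c e cs en; rewrite -mulmxA Ut_hx_dc mulmxDr -mulmxA IE //.
  have RE : hx M *m (X ^+ c *m kv *m dc k n e) = X ^+ c.+1 *m kv *m dc k n e.
    by rewrite !mulmxA mulmxE -exprS.
  rewrite {}RE; have [cs1|cs1] := ltnP c.+1 sb.
    rewrite IE // [_ == sb](_ : _ = false) ?scale0r ?mulmx0 ?addr0 //.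
    by rewrite ltn_eqF.
  have E : c.+1 = sb by apply/eqP; rewrite eqn_leq cs.
  rewrite E dc0 // tens0mx mulmx0 add0r eqxx scale1r IE // expr0 mul1mx mulmxA.
  by rewrite mulmxDr kJ mul_mx_scalar Xsb [in RHS]mulmxDl mul_scalar_mx addrC.
- move=> g; apply: tens_dcT_ext2 => c e cs en; rewrite !mulmxA PE // !mulmxA kpE // !tensmx_mul mulmx1.
  have cE : c = Ordinal cs by []; rewrite {2}cE diagw_dcT tensZl -scalemxAl PE // !mulmxA kpE //.
  have -> : phi *m T ^+ (n.-1 - e) *m X ^+ (sb - c) = phi *m X ^+ (sb - c) *m T ^+ (n.-1 - e).
    by rewrite -!mulmxA XTX.
  rewrite -[LHS]mulmxA [T ^+ _ *m _](_ : _ = hg M g *m T ^+ (n.-1 - e)); last first.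
    exact/esym/(commrX _ (hg_Tg g wM g0)).
  rewrite mulmxA phX -!scalemxAl scalerA; congr (_ *: _).
  rewrite /Vw /chr_mul /chr_pow; congr (_ * _).
  apply: (mulfI (expf_neq0 (sb - c) (chi0 g))).
  by rewrite mulfV ?expf_neq0 // -exprD subnK ?chisb // ltnW.
apply: tens_dcT_ext2 => c e cs en; rewrite !mulmxA PE // !mulmxA kpE // mulmxDr !tensmx_mul.
rewrite !mulmx1 dcT_J dcT_Em // mulmxDl tensZl -scalemxAl.
case: c cs => [|c] cs; last first.
  rewrite cs scale0r addr0 (PE _ _ (ltnW cs)) mulmxA (kpE _ en).
  have -> : (sb - c = (sb - c.+1).+1)%N by rewrite subnSK // ltnW.
  by rewrite exprSr -mulmxE mulmxA.
rewrite tens0mx mul0mx add0r scale1r PE ?prednK // subn0.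
have -> : (sb - sb.-1 = 1)%N by rewrite -{1}(prednK sb_gt0) subSnn.
have HK : (ga%:M + Jm k n) *m kp = kp *m (ga%:M + T).
  by rewrite mulmxDl mulmxDr Jk mul_scalar_mx mul_mx_scalar.
rewrite expr1 mulmxA -[(dc k n e)^T *m _ *m kp]mulmxA HK mulmxA (kpE _ en).
by rewrite Xsb [ga%:M + T]addrC.
Qed.

End Decomposition.

(** * Decomposition, and bases of the Green group *)

Section Basis.
Variables (k : closedFieldType) (G : groupType) (chi : G -> k) (sb : nat).
Hypothesis sb_gt0 : (0 < sb)%N.
Hypothesis chi_ord : chr_order chi sb.
Hypothesis chi_char : is_character chi.
Implicit Types (M N U V K : hmod k G).
Notation wmod := (is_wmod chi).
Notation Tg := (Tgm sb).
Notation Ut := (Ut chi sb).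
Notation TopB := (TopB chi sb).

Let chi0 g : chi g != 0.
Proof. by case: chi_char. Qed.

(* A generalized eigenvalue [ga] of [x ^+ sb], written as [minpoly = u * (X - ga)^m]
   with [u ga != 0], splits off through [e = u(B) T^(n-1) u(B) != 0]. *)
Lemma top_pair M w : wmod M -> @is_diag k G M w -> (0 < hdim M)%N ->
  exists ga n (i j : 'I_(hdim M)) (v : 'cV[k]_(hdim M)) (phi : 'rV[k]_(hdim M)),
  [/\ (0 < n)%N, Tg ga (hx M) ^+ n *m v = 0, phi *m Tg ga (hx M) ^+ n = 0 &
      phi *m Tg ga (hx M) ^+ n.-1 *m v = 1%:M] /\
  [/\ forall g, hg M g *m v = w j g *: v, forall g, phi *m hg M g = w i g *: phi &
      forall g, w i g = (if ga == 0 then chi g ^+ n.-1 else 1) * w j g].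
Proof.
move=> wM dM; have gxX g e := hg_hxX chi_char g e wM.
have gT g ga := hg_Tg chi_ord chi_char g wM (ga := ga).
have gB g : GRing.comm (hg M g) (hx M ^+ sb) := hg_hxsb chi_ord chi_char g wM.
move: gxX gT gB; case: M w dM {wM} => [[|d] H X] //= w dM gxX gT gB _.
pose B := X ^+ sb; pose p := mxminpoly B.
have p_neq0 : p != 0 by rewrite monic_neq0 // mxminpoly_monic.
have [ga rga] : exists x, root p x.
  by apply/closed_rootP; rewrite size_mxminpoly eqSS -lt0n mxminpoly_nonconstant.
have [u [m [uga pE]]] : exists u m, ~~ root u ga /\ p = u * ('X - ga%:P) ^+ m.
  by have [m [u uga ->]] := multiplicity_XsubC p ga; exists u, m; split=> //; apply: (implyP uga).
pose A := horner_mx B u; pose T := Tg ga X.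
have AX : GRing.comm A X.
  by apply: comm_horner_mx; apply: commr_sym; apply: commrX.
have AH g : GRing.comm A (H g) by apply: comm_horner_mx; apply/commr_sym/gB.
have AT : GRing.comm A T.
  rewrite /T /Tgm; case: eqP => // _; apply: commrB; first exact: commrX.
  by rewrite /GRing.comm -!mulmxE scalar_mxC.
have A0 : A != 0.
  apply: contra uga => /eqP /mxminpoly_min /dvdpP [q ->].
  by rewrite rootM -/p rga orbT.
have ABm : A * (B - ga%:M) ^+ m = 0.
  rewrite -(mx_root_minpoly B) -/p pE rmorphM rmorphXn rmorphB /=.
  by rewrite horner_mx_X horner_mx_C.
(* The [m]-th power of [B - ga] kills [A]. At [ga = 0] the operator [T] is [X], a root of [B], so
   the exponent is multiplied by [sb]. *)
have exn : exists n, A * T ^+ n == 0.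
  rewrite /T /Tgm; have [g0|g0] := eqVneq ga 0; last by exists m; rewrite -/B ABm.
  by exists (sb * m)%N; rewrite exprM -/B -ABm g0 raddf0 subr0.
pose n := ex_minn exn.
have [n0 ATn ATn1] : [/\ (0 < n)%N, A * T ^+ n = 0 & A * T ^+ n.-1 != 0].
  rewrite /n; case: ex_minnP => -[|r] /eqP ATr Hr.
    by case/negP: A0; apply/eqP; rewrite -[LHS]mulr1 -(expr0 T).
  split=> //; apply/negP => /Hr; by rewrite ltnn.
clearbody n; pose W := A * T ^+ n.-1.
(* [B - ga] is [T], or [X ^+ sb] when [ga = 0]; either way it is a multiple of [T], and one more
   factor [T] kills [W]. *)
have BW : (B - ga%:M) * W = 0.
  have cB : GRing.comm (B - ga%:M) A.
    apply: commr_sym; apply: commrB; first exact: commrX.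
    by rewrite /GRing.comm -!mulmxE scalar_mxC.
  rewrite /W mulrA cB -mulrA.
  suff [Y ->] : exists Y, (B - ga%:M) * T ^+ n.-1 = T ^+ n * Y by rewrite mulrA ATn mul0r.
  rewrite /T /Tgm; have [g0|g0] := eqVneq ga 0.
    exists (X ^+ sb.-1); rewrite g0 raddf0 subr0 /B -!exprD; congr (X ^+ _).
    by clear -sb_gt0 n0; lia.
  by exists 1; rewrite mulr1 -exprS prednK.
(* Dividing [u] by the linear factor at [ga] shows that [A] acts on [W] as the nonzero scalar
   [u.[ga]]; so [A * W] has a nonzero entry. *)
have [r uE] : exists r, u = u.[ga]%:P + r * ('X - ga%:P).
  have /factor_theorem [r rE] : root (u - u.[ga]%:P) ga.
    by rewrite /root !hornerE subrr.
  by exists r; rewrite -rE addrC subrK.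
have AW : A * W = u.[ga] *: W.
  have := congr1 (horner_mx B) uE.
  rewrite -/A rmorphD rmorphM rmorphB /= horner_mx_X !horner_mx_C => AE.
  by rewrite {1}AE mulrDl -mulrA BW mulr0 addr0 -mulmxE mul_scalar_mx.
have [i [j eij]] : exists i j, (A * W) i j != 0.
  apply: contrapT => H0; case/eqP: ATn1.
  have ug0 : u.[ga] != 0 by [].
  apply: (scalerI ug0); rewrite -/W scaler0 -AW; apply/matrixP=> i j; rewrite [RHS]mxE.
  by apply: contrapT => /eqP ?; apply: H0; exists i, j.
(* [phi] is row [i] of [A] and [v] is column [j], rescaled. Both are weight vectors because [A]
   commutes with the diagonal action of [G], and the pairing to be normalized is the entry [(i, j)]
   of [A * W]. *)
exists ga, n, i, j, (((A * W) i j)^-1 *: (A *m dc k d.+1 j)), ((dc k d.+1 i)^T *m A).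
have TnA : T ^+ n * A = 0 by rewrite -(commrX n AT).
split; first split=> //.
- by rewrite -scalemxAr mulmxA mulmxE -/T TnA mul0mx scaler0.
- by rewrite -mulmxA mulmxE -/T ATn mulmx0.
- rewrite -/T -scalemxAr; apply/matrixP=> x y; rewrite !ord1 mxE.
  have -> : (dc k d.+1 i)^T *m A *m T ^+ n.-1 *m (A *m dc k d.+1 j) =
            (dc k d.+1 i)^T *m (A * W) *m dc k d.+1 j.
    by rewrite !mulmxA -!(mulmxA (dc k d.+1 i)^T) !mulmxE -!mulrA -(commrX n.-1 AT) /W.
  by rewrite -entry_dc mulVf // mxE eqxx mulr1n.
have dM' g : H g = diagw w g by apply: dM.
split.
- move=> g; rewrite -scalemxAr mulmxA (_ : H g *m A = A *m H g); last exact/esym/AH.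
  by rewrite -mulmxA dM' diagw_dc -!scalemxAr scalerA scalerA mulrC.
- move=> g; rewrite -mulmxA (_ : A *m H g = H g *m A); last exact/AH.
  by rewrite mulmxA dM' diagw_dcT scalemxAl.
(* Moving [H g] across [A * W] and reading off the nonzero entry compares the weights of row [i] and
   column [j]. *)
move=> g; pose c := if ga == 0 then chi g ^+ n.-1 else 1.
have HT : H g * T ^+ n.-1 = c *: (T ^+ n.-1 * H g).
  rewrite /c /T; have [g0|g0] := eqVneq ga 0.
    by rewrite /Tgm g0 eqxx; apply: gxX.
  by rewrite scale1r; apply: (commrX n.-1 (gT g ga g0)).
have HAW : H g *m (A * W) = c *: ((A * W) *m H g).
  rewrite /W !mulmxE !mulrA -(AH g) -[A * H g * A]mulrA -(AH g) !mulrA.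
  by rewrite -[A * A * H g * _]mulrA HT -!scalerAr !mulrA.
have := congr1 (fun Z : 'M_(d.+1) => Z i j) HAW.
rewrite dM' diag_mulmxE [RHS]mxE mulmx_diagE ![(\row_(_ < _) _) _ _]mxE => E.
by apply: (mulIf eij); rewrite -/c E -mulrA; congr (_ * _); exact: mulrC.
Qed.


Definition bidx := ((G -> k) * k * nat)%type.
Implicit Types b : bidx.

Definition validb b :=
  [/\ is_character b.1.1, (0 < b.2)%N & b.1.2 != 0 -> crep chi b.1.1 = b.1.1].

Definition Vb b : hmod k G :=
  if b.1.2 == 0 then Vt chi b.2 b.1.1 else Ut b.2 b.1.1 b.1.2.

Lemma Vb_wmod b : validb b -> wmod (Vb b).
Proof.
by move=> [cl _ _]; rewrite /Vb; case: ifP => _; [apply: Vt_wmod | apply: Ut_wmod].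
Qed.

Lemma Vb_topB b : validb b -> TopB (Vb b) b.1.1 b.1.2 b.2.
Proof.
move=> [cl b0 _]; rewrite /Vb; case: eqP => [->|/eqP g0]; first exact: Vt_topB.
exact: Ut_topB.
Qed.

(** A zero module is isomorphic to its double, so its class equals twice itself. *)
Lemma green_dim0 M : wmod M -> hdim M = 0%N -> greenEq chi [:: (1, M)] [::].
Proof.
move=> wM E; have iso : hiso (hdsum M M) M.
  have F m n (A B : 'M[k]_(m, n)) : (m = 0)%N -> A = B.
    by move=> m0; apply/matrixP=> i; have := ltn_ord i; rewrite [X in (_ < X)%N]m0.
  by exists 0, 0; do !split; intros; apply: F; rewrite /= ?E.
have wMM := wmod_dsum wM wM.
have H := green_trans (green_sym (green_iso 1 wMM wM iso)) (green_dsum 1 wM wM).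
have := green_cat H (green_refl chi [:: (-1, M)]).
move=> H2; apply: green_trans (green_trans (green_sym H2) _).
  apply: green_lin => phi; rewrite /lin !big_cons big_nil /=; ring.
by apply: green_lin => phi; rewrite /lin !big_cons big_nil /=; ring.
Qed.

Theorem decomposition M : wmod M -> exists L : seq (int * bidx),
  (forall t, List.In t L -> validb t.2) /\
  greenEq chi [:: (1, M)] [seq (t.1, Vb t.2) | t <- L].
Proof.
have [n] := ubnP (hdim M); elim: n M => // n IH M Mn wM.
have [M0|M0] := posnP (hdim M).
  by exists [::]; split=> //; apply: green_dim0.
have [N [w [wN dN MN]]] := wmod_model wM.
have N0 : (0 < hdim N)%N by rewrite -(hiso_dim MN).
have [ga [m [i [j [v [phi [[m0 Tv phT phTv] [gv phg gij]]]]]]]] := top_pair wN dN N0.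
have [_ _ cw] := diag_weight wN dN.
have [b [M' [vb [wM' iso]]]] : exists b M', validb b /\ (wmod M' /\ hiso N (hdsum (Vb b) M')).
  have [g0|g0] := eqVneq ga 0.
    have TE : Tg ga (hx N) = hx N by rewrite /Tgm g0 eqxx.
    rewrite TE in Tv phT phTv.
    have [|M' H] := split_nilp sb_gt0 chi_char wN m0 (cw j) Tv phT phTv gv.
      by move=> g; rewrite phg gij g0 eqxx.
    exists (w j, 0, m), M'; split; last by rewrite /Vb /= eqxx.
    by split; rewrite //= eqxx.
  have [|M' [wM' H]] := split_cyc sb_gt0 chi_ord chi_char wN m0 (cw j) g0 Tv phT phTv gv.
    by move=> g; rewrite phg gij (negPf g0) mul1r.
  have [c cE] := crep_spec chi (w j).
  exists (crep chi (w j), ga, m), M'; split.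
    split=> //=; first by rewrite cE; apply: char_mul => //; apply: char_pow.
    by rewrite {1}cE (crep_shift sb_gt0 chi_ord).
  split=> //; apply: hiso_trans H _; apply: hiso_dsum (hiso_refl _).
  by rewrite /Vb /= (negPf g0); apply: Ut_crep.
have wb := Vb_wmod vb.
have dimM : hdim M = (hdim (Vb b) + hdim M')%N.
  by rewrite (hiso_dim MN) (hiso_dim iso).
have b_gt0 : (0 < hdim (Vb b))%N.
  by case: vb => _ b0 _; rewrite /Vb; case: ifP => _ //=; rewrite muln_gt0 sb_gt0.
have [|L [vL gL]] := IH M' _ wM'.
  by rewrite -ltnS (leq_trans _ Mn) // dimM ltnS -[X in (X < _)%N]add0n ltn_add2r.
exists ((1, b) :: L); split; first by move=> t [<-|/vL].
apply: green_trans (green_iso 1 wM (wmod_dsum wb wM') (hiso_trans MN iso)) _.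
apply: green_trans (green_dsum 1 wb wM') _.
by rewrite /= -cat1s -[X in greenEq _ _ X]cat1s; apply: green_cat gL; apply: green_refl.
Qed.

(** Counts the Jordan blocks of size at least [b.2] at the eigenvalue and weight given by [b]. *)
Definition topinv b : hmod k G -> int := iotam sb b.1.1 b.1.2 b.2.-1.

(** * Triangularity and linear independence *)

Section Triangular.
Variable v : bidx -> hmod k G.
Hypothesis v_wmod : forall b, validb b -> wmod (v b).
Hypothesis v_top : forall b, validb b -> TopB (v b) b.1.1 b.1.2 b.2.

Lemma topinv_tri b b' : validb b -> validb b' -> (b'.2 <= b.2)%N ->
  topinv b (v b') = indic (b' = b).
Proof.
move=> vb vb' bb'; have [c [w [T wI wE]]] := v_top vb'; have [cb b0 rb] := vb.
have [cb' b0' rb'] := vb'.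
rewrite /topinv; have [E|ne] := eqVneq b.1.2 b'.1.2; last first.
  rewrite (iota_top_neq sb_gt0 _ _ (v_wmod vb') T ne) /indic asboolF // => E.
  by rewrite E eqxx in ne.
rewrite E (iota_top _ (v_wmod vb') T) prednK //.
case: eqP => [E2|ne2]; last first.
  by rewrite /indic asboolF // => E3; apply: ne2; rewrite E3.
rewrite rank_pw // /indic; congr (Posz (nat_of_bool _)); apply: asbool_equiv_eq.
rewrite wE -E; case: eqP => [g0|/eqP g0]; split.
- by case: (b) (b') E E2 => [[l g] n] [[l' g'] n'] /= -> -> ->.
- by move=> ->.
- move=> [m bE].
  have lE : b.1.1 = b'.1.1.
    by rewrite -rb // bE (crep_shift sb_gt0 chi_ord) rb' // -E.
  by case: (b) (b') E E2 lE => [[l g] n] [[l' g'] n'] /= -> -> ->.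
by move=> ->; exists 0%N; rewrite chr_pow0 chr_mul1.
Qed.

(** Descending induction on the level [b.2], starting above all levels in [L]. Coefficients at
    higher levels vanish by induction, and among the indices of level at most [b.2] the functional
    [topinv b] sees only [b]. The threshold [l] serves the case where the pairings vanish only from
    a certain level on. *)
Lemma triangular_indep (L : seq (int * bidx)) l :
  (forall t, List.In t L -> validb t.2) ->
  (forall b, validb b -> (l <= b.2)%N -> lin (topinv b \o v) L = 0) ->
  forall b, validb b -> (l <= b.2)%N -> \sum_(t <- L | `[< t.2 = b >]) t.1 = 0.
Proof.
move=> vL H; have [m mL] : exists m, forall t, List.In t L -> (t.2.2 < m)%N.
  elim: L {vL H} => [|t L [m IH]]; first by exists 0%N.
  exists (maxn t.2.2.+1 m) => u [<-|/IH]; first exact: leq_maxl.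
  by move=> /leq_trans; apply; apply: leq_maxr.
suff main d b : validb b -> (l <= b.2)%N -> (m <= b.2 + d)%N ->
    \sum_(t <- L | `[< t.2 = b >]) t.1 = 0.
  by move=> b vb lb; apply: (main m) => //; apply: leq_addl.
elim: d b => [|d IH] b vb lb mb.
  rewrite big_mkcond; apply: sum_In => t /mL tm; rewrite asboolF // => E.
  by move: tm; rewrite E ltnNge; rewrite addn0 in mb; rewrite mb.
(* Zero at invalid indices, where triangularity says nothing; none of them occurs in [L]. *)
pose phi b' : int := if `[< validb b' >] then topinv b (v b') else 0.
have lphi : lin phi L = 0.
  rewrite -[RHS](H b) //; apply: eq_lin_In => t /vL vt; by rewrite /phi (asboolT vt).
have := @lin_single _ phi L b; rewrite lphi.
have -> : phi b = 1 by rewrite /phi (asboolT vb) topinv_tri // /indic asboolT.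
rewrite mulr1 => <- // b'; rewrite /phi; case: asboolP => // vb' nz.
have [le|lt] := leqP b'.2 b.2.
  by left; move: nz; rewrite topinv_tri // /indic; case: asboolP.
right; apply: IH => //; first exact: ltnW (leq_ltn_trans lb lt).
by rewrite (leq_trans mb) // addnS -addSn leq_add2r.
Qed.

End Triangular.

Lemma functional_topinv b : functional chi (topinv b).
Proof. exact: functional_iota. Qed.

Lemma lin_comp (T U : Type) (h : T -> U) (phi : U -> int) (f : seq (int * T)) :
  lin (phi \o h) f = lin phi [seq (t.1, h t.2) | t <- f].
Proof. by rewrite lin_map. Qed.

Lemma sum_coef (T : Type) (f : seq (int * T)) phi :
  (forall x, \sum_(t <- f | `[< t.2 = x >]) t.1 = 0) -> lin phi f = 0.
Proof. by move=> H; apply: (@lin_group _ eq) => // [x y ->|x y z -> ->]. Qed.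

Lemma sum_coef_In (T : Type) (f : seq (int * T)) x :
  (forall t, List.In t f -> t.2 <> x) -> \sum_(t <- f | `[< t.2 = x >]) t.1 = 0.
Proof.
by move=> H; rewrite big_mkcond; apply: sum_In => t /H ne; rewrite asboolF.
Qed.

Lemma green_bind_valid (T U : Type) (h : T -> hmod k G) (h' : U -> hmod k G) (P : U -> Prop)
    (f : seq (int * T)) :
  (forall t, List.In t f -> exists g : seq (int * U), (forall u, List.In u g -> P u.2) /\
     greenEq chi [:: (1, h t.2)] [seq (u.1, h' u.2) | u <- g]) ->
  exists g : seq (int * U), (forall u, List.In u g -> P u.2) /\
    greenEq chi [seq (t.1, h t.2) | t <- f] [seq (u.1, h' u.2) | u <- g].
Proof.
elim: f => [|t f IH] H; first by exists [::]; split=> //; apply: green_refl.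
have [|g [Pg Hg]] := IH; first by move=> u Hu; apply: H; right.
have [|g' [Pg' Hg']] := H t; first by left.
exists ([seq (t.1 * u.1, u.2) | u <- g'] ++ g); split.
  move=> u /List_In_cat [Ht|/Pg //]; have [u' uL ->] := List_In_map Ht; exact: (Pg' u').
rewrite map_cat -map_comp /= -cat1s; apply: green_cat => //.
have := green_scale t.1 Hg'; rewrite /= mulr1 -map_comp; exact.
Qed.

Lemma green_fsum f : valid_fsum chi f -> exists L : seq (int * bidx),
  (forall t, List.In t L -> validb t.2) /\ greenEq chi f [seq (t.1, Vb t.2) | t <- L].
Proof.
move=> vf; have [t Ht|L HL] := @green_bind_valid _ _ id Vb validb f.
  exact/decomposition/vf.
exists L; move: HL; rewrite (_ : [seq (t.1, id t.2) | t <- f] = f) //.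
by elim: f {vf} => [|[c M] f IH] //=; rewrite IH.
Qed.

Theorem green_of_topinv f g : valid_fsum chi f -> valid_fsum chi g ->
  (forall b, validb b -> lin (topinv b) f = lin (topinv b) g) -> greenEq chi f g.
Proof.
move=> vf vg H; pose h := f ++ [seq (-1 * t.1, t.2) | t <- g].
have vh : valid_fsum chi h.
  move=> t /List_In_cat [/vf //|Ht]; have [u /vg ug ->] := List_In_map Ht; exact: ug.
have [L [vL gL]] := green_fsum vh.
have L0 phi : lin phi L = 0.
  apply: sum_coef => b; have [vb|nvb] := pselect (validb b); last first.
    by apply: sum_coef_In => t /vL vt E; apply: nvb; rewrite -E.
  apply: (@triangular_indep Vb Vb_wmod Vb_topB _ 0) => // b' vb' _.
  rewrite lin_comp -(green_functional gL (functional_topinv b')).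
  by rewrite lin_cat lin_scale H ?mulN1r ?subrr //.
have h0 : greenEq chi h [::].
  apply: green_trans gL _; apply: green_lin => phi; by rewrite lin_map L0 lin_nil.
have := green_cat h0 (green_refl chi g); rewrite cat0s; apply: green_trans.
by apply: green_lin => phi; rewrite !lin_cat lin_scale; ring.
Qed.

Lemma green_of_functionals f g : valid_fsum chi f -> valid_fsum chi g ->
  (forall phi, functional chi phi -> lin phi f = lin phi g) -> greenEq chi f g.
Proof. by move=> vf vg H; apply: green_of_topinv => // b _; apply/H/functional_topinv. Qed.

(* Induction on the level [b.2]: [Vb b] and [v b] agree up to lower level. *)
Theorem triangular_span v : (forall b, validb b -> wmod (v b)) ->
  (forall b, validb b -> TopB (v b) b.1.1 b.1.2 b.2) ->
  forall f, valid_fsum chi f -> exists L : seq (int * bidx),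
    (forall t, List.In t L -> validb t.2) /\ greenEq chi f [seq (t.1, v t.2) | t <- L].
Proof.
move=> v_wmod v_top.
have main n b : validb b -> (b.2 < n)%N -> exists L : seq (int * bidx),
    (forall t, List.In t L -> validb t.2) /\ greenEq chi [:: (1, Vb b)] [seq (t.1, v t.2) | t <- L].
  elim: n b => // n IH b vb bn.
  have [K [vK gK]] := decomposition (v_wmod _ vb).
  (* [K'] represents [v b - Vb b] in the indecomposables. Both families have the same [topinv]
     values from level [b.2] on, so only lower levels keep nonzero coefficients. *)
  pose K' := (-1, b) :: K.
  have K0 b' : validb b' -> (b.2 <= b'.2)%N -> \sum_(t <- K' | `[< t.2 = b' >]) t.1 = 0.
    apply: (@triangular_indep Vb Vb_wmod Vb_topB K') => [t [<- //|/vK //]|b2 vb2 l2].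
    rewrite /K' lin_cons /= -/Vb lin_comp.
    rewrite -(green_functional gK (functional_topinv b2)) lin_cons lin_nil /=.
    by rewrite (topinv_tri Vb_wmod Vb_topB) // (topinv_tri v_wmod v_top) // addr0 mulN1r mul1r addNr.
  (* Terms of higher level can still occur in [K'] with cancelling coefficients; dropping them
     leaves every pairing unchanged. *)
  pose K1 := [seq t <- K' | (t.2.2 < b.2)%N].
  have K1E phi : lin phi K' = lin phi K1.
    rewrite /lin big_filter [RHS]big_mkcond /=.
    apply/eqP; rewrite -subr_eq0 -sumrB; apply/eqP.
    pose K2 := [seq t <- K' | ~~ (t.2.2 < b.2)%N].
    transitivity (lin phi K2).
      rewrite /lin big_filter [RHS]big_mkcond; apply: eq_bigr => t _.
      by case: ltnP => _; rewrite ?subrr ?subr0.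
    apply: sum_coef => x; rewrite big_filter_cond.
    have [lx|lx] := ltnP x.2 b.2.
      rewrite big1 // => t /andP [tb /asboolP tx]; by rewrite tx lx in tb.
    have [vx|nvx] := pselect (validb x); last first.
      rewrite big_mkcond; apply: sum_In => t Ht.
      rewrite [`[< _ >]]asboolF ?andbF // => E; apply: nvx; rewrite -E.
      by case: Ht => [<-|/vK].
    rewrite -[RHS](K0 x vx lx); apply: eq_bigl => t.
    by case: asboolP => [->|]; rewrite ?andbF // -leqNgt lx.
  have vK1 t : List.In t K1 -> validb t.2 /\ (t.2.2 < b.2)%N.
    have : forall t, List.In t K' -> validb t.2 by move=> u [<- //|/vK].
    rewrite /K1; elim: (K') => //= u K3 IH3 vK3; case: ifP => [ub|_]; last first.
      by apply: IH3 => x Hx; apply: vK3; right.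
    case=> [<-|]; first by split=> //; apply: vK3; left.
    by apply: IH3 => x Hx; apply: vK3; right.
  have [|L [vL gL]] := @green_bind_valid _ _ Vb v validb K1.
    by move=> t /vK1 [vt tb]; apply: IH => //; apply: leq_trans tb _.
  exists ((1, b) :: [seq (-1 * t.1, t.2) | t <- L]); split.
    by move=> t [<- //|Ht]; have [u /vL ? ->] := List_In_map Ht.
  rewrite /= -map_comp.
  apply: green_of_functionals => [t [<- //|[]]|t [<-|Ht]|phi fphi].
  - exact: Vb_wmod.
  - exact: v_wmod.
  - by have [u /vL ? ->] := List_In_map Ht; apply: v_wmod.
  have := green_functional gK fphi; have := green_functional gL fphi.
  have := K1E (phi \o Vb); rewrite !lin_map => <-.
  rewrite !lin_cons !lin_nil /= => E1 E2.
  rewrite [X in _ = _ + X](_ : _ = - lin (phi \o v) L); last first.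
    rewrite /lin !big_map -sumrN; apply: eq_bigr => t _ /=; ring.
  by rewrite -E1 -E2; ring.
move=> f vf; have [K [vK gK]] := green_fsum vf.
have [|L [vL gL]] := @green_bind_valid _ _ Vb v validb K.
  by move=> t /vK vt; apply: (main t.2.2.+1).
by exists L; split=> //; apply: green_trans gL.
Qed.

End Basis.

(** * The quantum binomial formula *)

Section Quantum.
Variables (k : fieldType) (p : k).

Definition qn n : k := \sum_(i < n) p ^+ i.

Lemma qn0 : qn 0 = 0. Proof. exact: big_ord0. Qed.
Lemma qnSr n : qn n.+1 = qn n + p ^+ n. Proof. exact: big_ord_recr. Qed.

Lemma qnD m n : qn (m + n) = qn m + p ^+ m * qn n.
Proof.
elim: n => [|n IH]; first by rewrite addn0 qn0 mulr0 addr0.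
by rewrite addnS !qnSr IH mulrDr addrA exprD.
Qed.

Lemma qnS n : qn n.+1 = 1 + p * qn n.
Proof. by rewrite -add1n qnD qnSr qn0 add0r expr0 expr1. Qed.

(** Gaussian binomial coefficients at [p], defined by the Pascal rule because a quotient of quantum
    factorials is meaningless at a root of unity. *)
Fixpoint gb n i : k :=
  match n, i with
  | _, 0 => 1
  | 0, _.+1 => 0
  | n'.+1, i'.+1 => p ^+ i * gb n' i + gb n' i'
  end.

Lemma gb0 n : gb n 0 = 1. Proof. by case: n. Qed.

Lemma gb_gt n i : (n < i)%N -> gb n i = 0.
Proof.
elim: n i => [|n IH] [|i] //= ni; rewrite !IH ?mulr0 ?addr0 //.
exact: ltnW.
Qed.

Lemma gb_qn n i : (i <= n)%N -> gb n i.+1 * qn i.+1 = gb n i * qn (n - i).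
Proof.
elim: n i => [|n IH] i ni.
  by case: i ni => // _; rewrite gb_gt // mul0r qn0 mulr0.
have L : gb n.+1 i.+1 * qn i.+1 = gb n i * qn n.+1.
  have [E|ne] := eqVneq i n.+1.
    by rewrite gb_gt ?E // gb_gt // !mul0r.
  have in' : (i <= n)%N by rewrite -ltnS ltn_neqAle ne.
  rewrite /= mulrDl -mulrA IH // mulrCA -mulrDr; congr (_ * _).
  by rewrite addrC -qnD addSn subnKC.
rewrite {}L; case: i ni => [|i] ni; first by rewrite subn0 !gb0.
rewrite /= mulrDl -mulrA subSS -IH; last by [].
rewrite mulrCA -mulrDr; congr (_ * _); rewrite addrC -qnD; congr (qn _).
by rewrite addSn subnKC.
Qed.

(** By [gb_qn] each coefficient, times the nonzero quantum integer of its lower index, is a multiple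
    of the preceding one; the chain starts with [qn s = 0]. *)
Lemma gb_prim s i : s.-primitive_root p -> p != 1 -> (0 < i < s)%N -> gb s i = 0.
Proof.
move=> sp p1; elim: i => // i IH /= /[dup] lt_is /ltnW is'.
have qn_neq0 j : (0 < j < s)%N -> qn j != 0.
  move=> /andP [j0 js]; apply/eqP => E.
  have : p ^+ j - 1 = 0 by rewrite subrX1 -/(qn j) E mulr0.
  move/eqP; rewrite subr_eq0 -(prim_order_dvd sp) gtnNdvd //.
apply: (mulIf (qn_neq0 i.+1 lt_is)); rewrite mul0r gb_qn ?(ltnW is') //.
case: (posnP i) => [->|i0]; last by rewrite IH ?mul0r // i0.
have : (p - 1) * qn s = 0 by rewrite -subrX1 (prim_expr_order sp) subrr.
by rewrite subn0 => /eqP; rewrite mulf_eq0 subr_eq0 (negPf p1) /= => /eqP ->; rewrite mulr0.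
Qed.

Lemma sclAl n c (A B : 'M[k]_n) : (c *: A) * B = c *: (A * B).
Proof. exact/esym/scalemxAl. Qed.

Lemma sclAr n c (A B : 'M[k]_n) : A * (c *: B) = c *: (A * B).
Proof. exact/esym/scalemxAr. Qed.

Lemma qcommX n (P Q : 'M[k]_n) e : P * Q = p *: (Q * P) -> P * Q ^+ e = p ^+ e *: (Q ^+ e * P).
Proof.
move=> H; elim: e => [|e IH]; first by rewrite !expr0 mul1r mulr1 scale1r.
by rewrite exprSr mulrA IH sclAl -mulrA H sclAr scalerA mulrA -exprSr.
Qed.

Lemma qbinomial n (P Q : 'M[k]_n) e : P * Q = p *: (Q * P) ->
  (P + Q) ^+ e = \sum_(i < e.+1) gb e i *: (Q ^+ i * P ^+ (e - i)).
Proof.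
move=> H; elim: e => [|e IH].
  by rewrite big_ord_recl big_ord0 addr0 !expr0 mulr1 scale1r.
pose F i := gb e i *: (Q ^+ i * P ^+ (e.+1 - i)).
have PF (i : 'I_e.+1) : P * (gb e i *: (Q ^+ i * P ^+ (e - i))) = p ^+ i *: F i.
  rewrite sclAr mulrA (qcommX _ H) sclAl -mulrA -exprS -subSn; last by rewrite -ltnS.
  by rewrite scalerA mulrC -scalerA.
rewrite exprS IH mulrDl !mulr_sumr (eq_bigr _ (fun i _ => PF i)).
rewrite [RHS]big_ord_recl [X in X + _ = _]big_ord_recl /= expr0 scale1r -addrA; congr (_ + _).
  by rewrite /F gb0 !scale1r expr0 mul1r subn0.
transitivity (\sum_(i < e.+1) (p ^+ i.+1 *: F i.+1) +
   \sum_(i < e.+1) gb e i *: (Q ^+ i.+1 * P ^+ (e - i))); last first.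
  rewrite -big_split; apply: eq_bigr => i _; rewrite /bump add1n /F subSS.
  by rewrite scalerA [RHS]scalerDl add0n.
rewrite [X in _ = X + _]big_ord_recr /= {3}/F gb_gt // scale0r scaler0 addr0.
congr (_ + _).
by apply: eq_bigr => i _; rewrite sclAr mulrA -exprS.
Qed.

Lemma qbinomial_prim s n (P Q : 'M[k]_n) : s.-primitive_root p -> p != 1 ->
  P * Q = p *: (Q * P) -> (P + Q) ^+ s = P ^+ s + Q ^+ s.
Proof.
move=> sp p1 H; have := prim_order_gt0 sp; case: s sp => // s sp _.
rewrite (qbinomial _ H); pose F i := gb s.+1 i *: (Q ^+ i * P ^+ (s.+1 - i)).
have F0 : F 0%N = P ^+ s.+1 by rewrite /F gb0 scale1r expr0 mul1r subn0.
have gnn m : gb m m = 1 by elim: m => //= m IH; rewrite IH gb_gt // mulr0 add0r.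
have FS : F s.+1 = Q ^+ s.+1 by rewrite /F gnn scale1r subnn expr0 mulr1.
rewrite -[LHS]/(\sum_(i < s.+2) F i) big_ord_recl big_ord_recr.
rewrite big1 => [|i _]; first by rewrite -F0 -FS [X in _ + X]add0r.
by rewrite /F (gb_prim sp p1) ?scale0r //; apply: (ltn_ord i).
Qed.

End Quantum.

(** * Tensor products with the standard modules *)

Section Standard.
Variables (k : closedFieldType) (G : groupType) (a : G) (chi : G -> k) (sb s s' : nat) (xi : k).
Hypothesis ch0 : [pchar k] =i pred0.
Hypothesis a_central : forall g, (a * g = g * a)%g.
Hypothesis chi_char : is_character chi.
Hypothesis chi_a : chi a != 1.
Hypothesis chi_ord : chr_order chi sb.
Hypothesis q_prim : s.-primitive_root (chi a)^-1.
Hypothesis sbE : sb = (s * s')%N.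
Hypothesis xi_prim : s'.-primitive_root xi.
Implicit Types (M N U V K : hmod k G) (la mu : G -> k).
Notation wmod := (is_wmod chi).
Notation Tg := (Tgm sb).
Notation TopB := (TopB chi sb).
Notation eps := (@chr_one k G).
Notation p := (chi a).
Local Notation "M ** N" := (htens a M N) (at level 40, left associativity).

Lemma sb_pos : (0 < sb)%N. Proof. by case: chi_ord. Qed.
Lemma s_pos : (0 < s)%N. Proof. exact: prim_order_gt0 q_prim. Qed.
Lemma s'_pos : (0 < s')%N. Proof. by have := sb_pos; rewrite sbE muln_gt0 => /andP[]. Qed.
Lemma chi_neq0 g : chi g != 0. Proof. by case: chi_char. Qed.
Lemma p_prim : s.-primitive_root p.
Proof.
have /andP [s0 /forallP H] := q_prim; apply/andP; split=> //; apply/forallP => i.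
have := H i; rewrite !unity_rootE exprVn => /eqP <-; apply/eqP.
by rewrite -(inj_eq (@invr_inj _)) invr1.
Qed.

Lemma s_gt1 : (1 < s)%N.
Proof.
have := p_prim; case: s s_pos => [|[|]] // _ /prim_expr_order; rewrite expr1 => E.
by move: chi_a; rewrite E eqxx.
Qed.

Lemma nat_neq0 n : (0 < n)%N -> n%:R != 0 :> k.
Proof. by move=> n0; move/pcharf0P: ch0 => ->; rewrite -lt0n. Qed.

(** * Twists by characters, and the action of [x ^+ s] on tensor products *)

Definition twist M la : hmod k G := @HMod k G (hdim M) (fun g => la g *: hg M g) (hx M).

(** The factor [a] in the coproduct of [x] makes tensoring with a character on the right rescale
    [x], while tensoring on the left does not. This asymmetry is the source of the skew
    multiplication. *)
Definition twistx M la : hmod k G :=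
  @HMod k G (hdim M) (fun g => la g *: hg M g) (la a *: hx M).

Lemma Jm1 : Jm k 1 = 0.
Proof. by apply/matrixP=> i j; rewrite !mxE !ord1. Qed.

Lemma tens_twist M la : hiso (Vt chi 1 la ** M) (twist M la).
Proof.
apply: (@hiso_bij _ _ (Vt chi 1 la ** M) (twist M la)
  (fun i : 'I_(1 * hdim M) => (mxtens_unindex i).2) (fun j => mxtens_index (0, j))).
- by move=> i; case: (mxtens_indexP i) => i1 i2; rewrite mxtens_indexK /= ord1.
- by move=> j; rewrite mxtens_indexK.
- move=> g i j; case: (mxtens_indexP i) => i1 i2; case: (mxtens_indexP j) => j1 j2.
  by rewrite !mxtens_indexK /= tensmxE !mxE !ord1 eqxx expr0 !mul1r.
move=> i j; case: (mxtens_indexP i) => i1 i2; case: (mxtens_indexP j) => j1 j2.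
rewrite !mxtens_indexK /= -/(Jm k 1) Jm1 tens0mx add0r tensmxE mxE !ord1 eqxx.
by rewrite mul1r.
Qed.

Lemma tens_twistx M la : hiso (M ** Vt chi 1 la) (twistx M la).
Proof.
apply: (@hiso_bij _ _ (M ** Vt chi 1 la) (twistx M la)
  (fun i : 'I_(hdim M * 1) => (mxtens_unindex i).1) (fun j => mxtens_index (j, 0))).
- by move=> i; case: (mxtens_indexP i) => i1 i2; rewrite mxtens_indexK /= ord1.
- by move=> j; rewrite mxtens_indexK.
- move=> g i j; case: (mxtens_indexP i) => i1 i2; case: (mxtens_indexP j) => j1 j2.
  by rewrite !mxtens_indexK /= tensmxE !mxE !ord1 eqxx expr0 !mul1r mulrC.
move=> i j; case: (mxtens_indexP i) => i1 i2; case: (mxtens_indexP j) => j1 j2.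
rewrite !mxtens_indexK /= -/(Jm k 1) Jm1 tensmx0 addr0 tensmxE !mxE !ord1 eqxx.
by rewrite expr0 !mul1r mulrC.
Qed.

Lemma chr_mulI la : is_character la -> injective (chr_mul la).
Proof.
move=> [la0 _] x y E; apply/funext => g.
by have := congr1 (fun f => f g) E; rewrite /chr_mul; apply: (mulfI (la0 g)).
Qed.

Lemma twist_top M la mu ga n : is_character la -> TopB M mu ga n ->
  TopB (twist M la) (chr_mul la mu) ga n.
Proof.
move=> cl [c [w [[n0 [P [P' [Q [Q' [PP QQ Qg TP T0]]]]]] wI wE]]].
exists c, (fun i => chr_mul la (w i)); split.
- split=> //; exists P, P', Q, Q'; split=> // g.
  rewrite -scalemxAr Qg scalemxAl; congr (_ *m _).
  by apply/matrixP=> i j; rewrite !mxE mulrnAr.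
- by move=> i j /(chr_mulI cl) /wI.
move=> mu'; split=> [[i <-]|].
  have := (wE (w i)).1 (ex_intro _ i erefl); case: ifP => _; first by move=> ->.
  by move=> [m ->]; exists m; rewrite !chr_mulA [chr_mul la _]chr_mulC.
case: ifP => g0; last case=> m; move=> ->.
  by have [i <-] : exists i, w i = mu; [apply/wE; rewrite g0 | exists i].
have [i wi] : exists i, w i = chr_mul (chr_pow chi m) mu.
  by apply/wE; rewrite g0; exists m.
by exists i; rewrite wi !chr_mulA [chr_mul la _]chr_mulC.
Qed.

Lemma diagw_exp n (w : 'I_n -> G -> k) g e :
  diagw w g ^+ e = diagw (fun i => chr_pow (w i) e) g.
Proof.
elim: e => [|e IH].
  rewrite expr0; apply/matrixP=> i j; rewrite !mxE /chr_pow expr0; by case: eqP.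
rewrite exprS IH -mulmxE mulmx_diag; congr diag_mx; apply/matrixP=> i j.
by rewrite !mxE /chr_pow exprS.
Qed.

Lemma diagw_id n (w : 'I_n -> G -> k) g : (forall i, w i g = 1) -> diagw w g = 1%:M.
Proof.
move=> H; apply/matrixP=> i j; rewrite !mxE H; by case: eqP.
Qed.

(** Holds when all weights are powers of [chi], because [chi a ^+ s = 1]; it removes [a] from the
    formula for [x ^+ s] on a tensor product. *)
Definition as1 M := hg M a ^+ s = 1.

Lemma as1_diag M w : @is_diag k G M w -> (forall i, w i a ^+ s = 1) -> as1 M.
Proof. by move=> dM H; rewrite /as1 dM diagw_exp; apply: diagw_id. Qed.

Lemma as1_Vw n (i : 'I_n) : Vw chi eps i a ^+ s = 1.
Proof.
by rewrite /Vw /chr_mul /chr_pow /chr_one mulr1 exprAC (prim_expr_order p_prim) expr1n.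
Qed.

Lemma as1_Vt n : as1 (Vt chi n eps).
Proof. by apply: (as1_diag (@Vt_diag _ _ chi n eps)) => i; apply: as1_Vw. Qed.

Lemma as1_tens M N : as1 M -> as1 N -> as1 (M ** N).
Proof. by rewrite /as1 /= tensX => -> ->; apply: tens1. Qed.

Lemma hg_unit M g : wmod M -> hg M g \in unitmx.
Proof.
move=> [M1 [MM _]]; have /mulmx1_unit [] // : hg M g *m hg M (g^-1)%g = 1%:M.
by rewrite -MM mulgV.
Qed.

(** The two terms of the coproduct of [x] commute up to the scalar [chi a], a primitive [s]-th root
    of unity, so the mixed terms of the [s]-th power disappear. *)
Lemma hx_tens_s M N : wmod M -> wmod N ->
  hx (M ** N) ^+ s = hx M ^+ s *t hg N a ^+ s + 1%:M *t hx N ^+ s.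
Proof.
move=> wM wN; rewrite /= (@qbinomial_prim _ p s) ?p_prim //.
  by rewrite !tensX expr1n.
by rewrite -!mulmxE !tensmx_mul !mulmx1 !mul1mx (hg_hx chi_char) // tensZr.
Qed.

Lemma diagw1 la g : diagw (fun _ : 'I_1 => la) g = (la g)%:M.
Proof. by apply/matrixP=> i j; rewrite !mxE !ord1. Qed.

(* [x^e] on [V_2 (x) M]: the quantum integer [qn e] is what makes the top
   layer survive exactly when [s] does not divide [n]. *)
Lemma top_Vt2 M n la : wmod M -> TopM sb M 0 n (fun _ : 'I_1 => la) -> ~~ (s %| n)%N ->
  TopM sb (Vt chi 2 eps ** M) 0 n.+1 (fun _ : 'I_1 => la).
Proof.
move=> wM [n0 [P [P' [Q [Q' [PP QQ Qg]]]]]]; rewrite /Tgm eqxx => TP T0 sn.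
set X := hx M in TP T0; set A := hg M a.
have XA : X *m A = p^-1 *: (A *m X).
  by rewrite [A *m X](hg_hx chi_char) // scalerA mulVf ?scale1r // chi_neq0.
have J2 : Jm k 2 *m Jm k 2 = 0 by have := JmX0 k (leqnn 2); rewrite expr2.
pose Y := hx (Vt chi 2 eps ** M).
have YE : Y = Jm k 2 *t A + 1%:M *t X by [].
(* As [Jm k 2] has square zero, only words with at most one factor [Jm *t A] survive; moving the
   factors [X] past [A] in them adds up to a quantum integer. *)
have YX e : Y ^+ e.+1 = 1%:M *t X ^+ e.+1 + qn p^-1 e.+1 *: (Jm k 2 *t (A *m X ^+ e)).
  elim: e => [|e IH].
    by rewrite !expr1 expr0 mulmx1 qnSr qn0 expr0 add0r scale1r YE addrC.
  rewrite exprS IH -mulmxE YE mulmxDr !mulmxDl -!scalemxAr !tensmx_mul J2 !mul1mx !mulmx1.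
  rewrite tens0mx !(scaler0, addr0) !mulmxE -!exprS (mulrA X A) -!mulmxE XA -scalemxAl tensZr.
  rewrite -mulmxA !mulmxE -exprS scalerA [in RHS]qnS scalerDl scale1r [qn _ _ * _]mulrC.
  by rewrite add0r [X in X + _]addrC addrA.
have q0 : qn p^-1 n != 0.
  apply: contra sn => /eqP E; rewrite (prim_order_dvd q_prim) -subr_eq0 subrX1.
  by rewrite -/(qn p^-1 n) E mulr0.
have Yn : Y ^+ n = qn p^-1 n *: (Jm k 2 *t (A *m X ^+ n.-1)).
  by rewrite -{1}(prednK n0) YX (prednK n0) T0 tensmx0 add0r.
split=> //; exists (qn p^-1 n *: (dc k 2 1 *t (A *m P))),
  ((qn p^-1 n)^-1 *: ((dc k 2 1)^T *t (P' *m invmx A))),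
  ((dc k 2 0)^T *t Q), (dc k 2 0 *t Q'); split.
- rewrite -scalemxAl -scalemxAr scalerA mulVf // scale1r (@tensmx_mul k 1 2 1 _ 1 1) dc_dc //.
  by rewrite mulmxA -(mulmxA P') mulVmx ?hg_unit // mulmx1 PP tens1.
- by rewrite (@tensmx_mul k 1 2 1 _ 1 1) dc_dc // QQ tens1.
- move=> g; have gE : hg (Vt chi 2 eps ** M) g = diagw (@Vw k G chi 2 eps) g *t hg M g.
    exact: (congr1 (fun A => A *t hg M g) (@Vt_diag _ _ chi 2 eps g)).
  have Qg' := Qg g; rewrite diagw1 mul_scalar_mx in Qg'.
  rewrite gE (@tensmx_mul k 1 2 1 _ 2) Qg'.
  have -> : (dc k 2 0)^T *m diagw (@Vw k G chi 2 eps) g = (dc k 2 0)^T.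
    by rewrite (diagw_dcT _ _ (0 : 'I_2)) /Vw /chr_mul /chr_pow /chr_one expr0 mulr1 scale1r.
  by rewrite tensZr (diagw1 la g : diagw _ g = _) mul_scalar_mx.
- rewrite /Tgm eqxx -/Y -[n.+1.-1]/n Yn TP -scalemxAl (@tensmx_mul k 2 1 _ 1) -mulmxA; congr (_ *: (_ *t _)).
  exact: (JmX_top k (n:=2)).
rewrite /Tgm eqxx -/Y exprSr Yn -mulmxE -scalemxAl YE mulmxDr !tensmx_mul J2 tens0mx add0r mulmx1.
by rewrite -mulmxA mulmxE -exprSr prednK // T0 ?mulmx0 ?mulr0 tensmx0 scaler0.
Qed.

(** On [V_(s+1)] the power [Z] of [x] with exponent [s] has square zero, so the [(j+1)]-st power of
    [Z *t 1 + 1 *t X ^+ s] reduces to [j+1] times [Z *t X ^+ (s * j)]. Characteristic zero keeps it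
    nonzero, and multiplication by [z] raises the level by exactly [s]. *)
Lemma top_Vz M j la : wmod M -> as1 M -> TopM sb M 0 (s * j).+1 (fun _ : 'I_1 => la) ->
  TopM sb (Vt chi s.+1 eps ** M) 0 (s * j.+1).+1 (fun _ : 'I_1 => la).
Proof.
move=> wM aM [n0 [P [P' [Q [Q' [PP QQ Qg]]]]]]; rewrite /Tgm eqxx => TP T0.
set X := hx M in TP T0; pose Y := hx (Vt chi s.+1 eps ** M); pose Z := Jm k s.+1 ^+ s.
have ZE : Z = dc k s.+1 s *m (dc k s.+1 0)^T by apply: (@JmX_top k s.+1).
have Z2 : Z *m Z = 0.
  rewrite mulmxE -exprD JmX0 // -[s.+1]addn1 leq_add2l; exact: s_pos.
have YE : Y = Jm k s.+1 *t hg M a + 1%:M *t X by [].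
have Ys : Y ^+ s = Z *t 1%:M + 1%:M *t X ^+ s.
  by rewrite /Y hx_tens_s //; [rewrite (aM : hg M a ^+ s = 1) | apply: Vt_wmod; [|apply: char_one]].
have Yse e : Y ^+ (s * e.+1) = 1%:M *t X ^+ (s * e.+1) + e.+1%:R *: (Z *t X ^+ (s * e)).
  elim: e => [|e IH].
    by rewrite muln1 Ys muln0 expr0 scale1r addrC.
  have XX : X ^+ s *m X ^+ (s * e) = X ^+ (s * e.+1) by rewrite mulmxE -exprD -mulnS.
  have XX2 : X ^+ s *m X ^+ (s * e.+1) = X ^+ (s * e.+2) by rewrite mulmxE -exprD -mulnS.
  rewrite mulnS exprD Ys IH -mulmxE mulmxDr !mulmxDl -!scalemxAr !tensmx_mul Z2 !mul1mx !mulmx1.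
  rewrite tens0mx scaler0 add0r XX XX2 -addrA addrC -addrA; congr (_ + _).
    by rewrite -mulnS.
  by rewrite -[X in _ = X *: _]natr1 scalerDl scale1r.
have Yn : Y ^+ (s * j.+1) = j.+1%:R *: (Z *t X ^+ (s * j)).
  rewrite Yse (_ : X ^+ (s * j.+1) = 0) ?tensmx0 ?add0r //.
  have -> : (s * j.+1 = (s * j).+1 + s.-1)%N by rewrite mulnS addSn -addnS (prednK s_pos) addnC.
  by rewrite exprD T0 mul0r.
have c0 : j.+1%:R != 0 :> k by apply: nat_neq0.
split=> //; exists (j.+1%:R *: (dc k s.+1 s *t P)), (j.+1%:R^-1 *: ((dc k s.+1 s)^T *t P')),
  ((dc k s.+1 0)^T *t Q), (dc k s.+1 0 *t Q'); split.
- rewrite -scalemxAl -scalemxAr scalerA mulVf // scale1r (@tensmx_mul k 1 s.+1 1 _ 1 1).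
  by rewrite dc_dc // eqxx PP tens1.
- by rewrite (@tensmx_mul k 1 s.+1 1 _ 1 1) dc_dc // QQ tens1.
- move=> g; have gE : hg (Vt chi s.+1 eps ** M) g = diagw (@Vw k G chi s.+1 eps) g *t hg M g.
    exact: (congr1 (fun A => A *t hg M g) (@Vt_diag _ _ chi s.+1 eps g)).
  have Qg' := Qg g; rewrite diagw1 mul_scalar_mx in Qg'.
  rewrite gE (@tensmx_mul k 1 s.+1 1 _ s.+1) Qg'.
  have -> : (dc k s.+1 0)^T *m diagw (@Vw k G chi s.+1 eps) g = (dc k s.+1 0)^T.
    by rewrite (diagw_dcT _ _ (0 : 'I_s.+1)) /Vw /chr_mul /chr_pow /chr_one expr0 mulr1 scale1r.
  by rewrite tensZr (diagw1 la g : diagw _ g = _) mul_scalar_mx.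
- rewrite /Tgm eqxx -/Y (_ : Y ^+ _.-1 = Y ^+ (s * j.+1)) // Yn ZE.
  by rewrite (TP : X ^+ (s * j) = _) -scalemxAl (@tensmx_mul k s.+1 1 _ 1).
rewrite /Tgm eqxx -/Y exprS Yn -mulmxE -scalemxAr YE mulmxDl !tensmx_mul mul1mx.
rewrite mulmxE -exprS JmX0 // tens0mx add0r mulmxE -exprS T0 tensmx0 scaler0 //.
Qed.

(** The module [Vtb] at [t = 1] in dimension [sb] instead of [1 * sb]: the common form to which [Ut]
    at [n = 1] and [Vtb] are compared. *)
Definition Cyc la be : hmod k G :=
  @HMod k G sb (diagw (@Vw k G chi sb la)) (Jm k sb + be *: Em k sb).

Lemma Cyc_diag la be : @is_diag k G (Cyc la be) (@Vw k G chi sb la).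
Proof. by []. Qed.

Lemma Cyc_dc la be c : hx (Cyc la be) *m dc k sb c = dc k sb c.+1 + ((c.+1 == sb)%:R * be) *: dc k sb 0.
Proof. by rewrite mulmxDl Jm_dc -scalemxAl Em_dc scalerA mulrC. Qed.

Lemma Ut_Cyc la be : hiso (Ut chi sb 1 la be) (Cyc la be).
Proof.
apply: (@hiso_bij _ _ (Ut chi sb 1 la be) (Cyc la be)
  (fun i : 'I_(sb * 1) => (mxtens_unindex i).1) (fun j => mxtens_index (j, 0))).
- by move=> i; case: (mxtens_indexP i) => i1 i2; rewrite mxtens_indexK /= ord1.
- by move=> j; rewrite mxtens_indexK.
- move=> g i j; case: (mxtens_indexP i) => i1 i2; case: (mxtens_indexP j) => j1 j2.
  by rewrite !mxtens_indexK /= tensmxE !mxE !ord1 eqxx mulr1.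
move=> i j; case: (mxtens_indexP i) => i1 i2; case: (mxtens_indexP j) => j1 j2.
rewrite !mxtens_indexK /= Jm1 addr0 [RHS]mxE !tensmxE [LHS]mxE ![_%:M _ _]mxE !ord1 eqxx.
by rewrite !mulr1n mulr1; congr (_ + _); rewrite [LHS]mxE mulrC.
Qed.

Lemma Cyc_Vtb la be : hiso (Cyc la be) (Vtb chi sb 1 la be).
Proof.
pose E := esym (mul1n sb).
apply: (@hiso_bij _ _ (Cyc la be) (Vtb chi sb 1 la be) (cast_ord E) (cast_ord (esym E))).
- exact: cast_ordK.
- exact: cast_ordKV.
- move=> g i j; rewrite !mxE /Vw /chr_mul /chr_pow /=.
  rewrite (_ : (cast_ord E i == cast_ord E j) = (i == j)) //.
  by case: (i == j); rewrite ?mul1r ?mul0r.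
move=> i j; rewrite !mxE /=; congr (_ + _); rewrite mul1n.
case: (j.+1 == sb); rewrite ?andbF ?mul0r ?mulr0 // andbT /=.
have [i0|i0] := eqVneq (i : nat) 0%N.
  by rewrite i0 dvdn0 div0n /alpha_coef expr1 coefB coefX coefC /= sub0r opprK mul1r mulr1.
by rewrite gtnNdvd ?lt0n // mul0r mulr0.
Qed.

Lemma Cyc_wmod la be : is_character la -> wmod (Cyc la be).
Proof.
by move=> cl; apply: wmod_iso (Ut_Cyc la be); apply: Ut_wmod => //; apply: sb_pos.
Qed.

Lemma Cyc_hx_sb la be : hx (Cyc la be) ^+ sb = be%:M.
Proof.
have [F [F' [FF [FF' [_ Hx]]]]] := Ut_Cyc la be.
have := intertw_exp sb Hx; rewrite Ut_hx_sb ?sb_pos // Jm1 addr0.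
rewrite -[be%:M in X in X -> _]scalemx1 tensZr tens1 scalemx1 => H.
by rewrite -[LHS]mulmx1 -FF' mulmxA -H mul_mx_scalar -scalemxAl FF' scalemx1.
Qed.

Lemma Cyc_hx_unit la be : be != 0 -> hx (Cyc la be) \in unitmx.
Proof.
move=> b0; apply: (unitmx_expV sb_pos); rewrite Cyc_hx_sb.
by rewrite unitmxE det_scalar unitfE expf_neq0.
Qed.

Lemma as1_Cyc be : as1 (Cyc eps be).
Proof. by apply: (as1_diag (Cyc_diag eps be)) => i; apply: as1_Vw. Qed.

Lemma expr_sb d (Y : 'M[k]_d) : Y ^+ sb = (Y ^+ s) ^+ s'.
Proof. by rewrite sbE exprM. Qed.

(** Here [x ^+ s = S1 + S2], where [S1] and [S2] commute, [S1 ^+ s'] is the scalar [be] and [S2] is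
    nilpotent; so [T], a difference of [s']-th powers, factors as [S2 * R]. In front of [S2 ^+ j]
    the factor [R] becomes [s'] times a power of [S1], invertible in characteristic zero. The top
    layer is that of [S2], up to an invertible matrix. *)
Lemma Cyc_tens_top K j be : wmod K -> as1 K -> be != 0 ->
  TopM sb K 0 (s * j).+1 (fun _ : 'I_1 => eps) -> TopB (Cyc eps be ** K) eps be j.+1.
Proof.
move=> wK aK b0 [_ [P [P' [Q [Q' [PP QQ Qg]]]]]]; rewrite /Tgm eqxx => TP T0.
have wC : wmod (Cyc eps be) by apply: Cyc_wmod; apply: char_one.
set X := hx K in TP T0; pose A := hx (Cyc eps be) ^+ s; pose N := X ^+ s.
have Nj : N ^+ j = P *m Q by rewrite /N -exprM; apply: TP.
have Nj1 : N ^+ j.+1 = 0.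
  have -> : N ^+ j.+1 = X ^+ ((s * j).+1 + s.-1).
    by rewrite /N -exprM mulnS addSn -addnS (prednK s_pos) addnC.
  by rewrite exprD T0 mul0r.
have As : A ^+ s' = be%:M by rewrite /A -expr_sb Cyc_hx_sb.
have uA : A \in unitmx by apply: unitmx_exp; apply: Cyc_hx_unit.
pose S1 : 'M[k]_(sb * hdim K) := A *t 1%:M; pose S2 : 'M[k]_(sb * hdim K) := 1%:M *t N.
have S12 : GRing.comm S1 S2.
  by rewrite /GRing.comm -!mulmxE !tensmx_mul !mulmx1 !mul1mx.
have Ys : hx (Cyc eps be ** K) ^+ s = S1 + S2.
  by rewrite hx_tens_s // (aK : hg K a ^+ s = 1).
have S1s : S1 ^+ s' = be%:M.
  by rewrite tensX expr1n As -[be%:M in LHS]scalemx1 tensZl tens1 scalemx1.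
have S2X e : S2 ^+ e = 1%:M *t N ^+ e by rewrite tensX expr1n.
have S2j1 : S2 ^+ j.+1 = 0 by rewrite S2X Nj1 tensmx0.
pose R := \sum_(i < s') (S1 + S2) ^+ (s'.-1 - i) * S1 ^+ i.
have c1 : GRing.comm (S1 + S2) S1.
  apply: commr_sym; apply: commrD => //; exact: commr_refl.
have TE : Tg be (hx (Cyc eps be ** K)) = S2 * R.
  rewrite /Tgm (negPf b0) expr_sb Ys -S1s (subrXX_comm s' c1).
  by rewrite addrAC subrr add0r.
have c2 : GRing.comm S2 (S1 + S2).
  by apply: commrD; [apply: commr_sym | apply: commr_refl].
have cR : GRing.comm S2 R.
  apply: commr_sum => i _; apply: commrM; apply: commrX => //; exact: commr_sym.
pose W : 'M[k]_(sb * hdim K) := (s'%:R *: A ^+ s'.-1) *t 1%:M.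
(* [S2 ^+ j] kills [S2], so next to it [S1 + S2] acts as [S1], and the [s'] summands of [R] all
   become equal. *)
have S2jx e : S2 ^+ j * (S1 + S2) ^+ e = S2 ^+ j * S1 ^+ e.
  elim: e => [|e IH]; first by rewrite !expr0.
  rewrite exprSr mulrA IH -mulrA mulrDr mulrDr.
  have cc : GRing.comm (S1 ^+ e) S2 by apply/commr_sym/commrX/commr_sym.
  have -> : S2 ^+ j * (S1 ^+ e * S2) = 0 by rewrite cc mulrA -exprSr S2j1 mul0r.
  by rewrite addr0 -exprSr.
have S2jR : S2 ^+ j * R = S2 ^+ j * W.
  have -> : W = s'%:R *: (S1 ^+ s'.-1) by rewrite /W tensZl tensX expr1n.
  rewrite /R mulr_sumr (eq_bigr (fun=> S2 ^+ j * S1 ^+ s'.-1)) => [|i _].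
    by rewrite sumr_const card_ord -scaler_nat sclAr.
  rewrite mulrA S2jx -mulrA -exprD subnK //.
  by have := ltn_ord i; rewrite -{2}(prednK s'_pos).
have cRW : GRing.comm R W.
  have cW : GRing.comm W (S1 + S2).
    have -> : W = s'%:R *: (S1 ^+ s'.-1) by rewrite /W tensZl tensX expr1n.
    rewrite /GRing.comm sclAl sclAr; congr (_ *: _).
    by apply/commr_sym/commrX.
  have cW1 : GRing.comm W S1.
    by rewrite /GRing.comm -!mulmxE !tensmx_mul -scalemxAl -scalemxAr !mulmxE -exprSr -exprS.
  by apply: commr_sym; apply: commr_sum => i _; apply: commrM; apply: commrX.
have S2jRe e : S2 ^+ j * R ^+ e = S2 ^+ j * W ^+ e.
  elim: e => [|e IH]; first by rewrite !expr0.
  rewrite exprSr mulrA IH -mulrA -(commrX e cRW : R * W ^+ e = W ^+ e * R) mulrA S2jR.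
  by rewrite -mulrA -exprS.
have Te e : Tg be (hx (Cyc eps be ** K)) ^+ e = S2 ^+ e * R ^+ e.
  by rewrite TE; apply: exprMn_comm.
pose B := (s'%:R *: A ^+ s'.-1) ^+ j.
have uB : B \in unitmx.
  apply: unitmx_exp; rewrite unitmxZ ?unitfE ?nat_neq0 ?s'_pos //.
  exact: unitmx_exp.
exists (sb * 1)%N, (@Uw k G chi sb 1 eps); split; last first.
- move=> mu; rewrite (negPf b0); apply: Uw_orbit => //; exact: sb_pos.
- apply: Uw_inj => //; exact: char_one.
split=> //; exists (B *t P), (invmx B *t P'), (1%:M *t Q), (1%:M *t Q'); split.
- by rewrite tensmx_mul mulVmx // PP tens1.
- by rewrite tensmx_mul mul1mx QQ tens1.
- move=> g; have -> : hg (Cyc eps be ** K) g = diagw (@Vw k G chi sb eps) g *t hg K g by [].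
  rewrite (_ : diagw (@Uw k G chi sb 1 eps) g = diagw (@Vw k G chi sb eps) g *t 1%:M); last first.
    by have <- := @Ut_diag k G chi sb 1 eps 0 g.
  have QK : Q *m hg K g = Q by rewrite Qg diagw1 /chr_one mul1mx.
  by rewrite !tensmx_mul QK !mul1mx mulmx1.
- rewrite Te S2jRe S2X tensX expr1n -mulmxE !tensmx_mul !mul1mx !mulmx1 Nj.
  by [].
by rewrite Te S2j1 mul0r.
Qed.

Lemma twist_eps M : hiso (twist M eps) M.
Proof.
exists 1%:M, 1%:M; rewrite !mul1mx; do !split=> //; last by rewrite mulmx1.
by move=> g; rewrite /= /chr_one scale1r mul1mx mulmx1.
Qed.

Lemma twist_chi M : wmod M -> hx M \in unitmx -> hiso (twist M chi) M.
Proof.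
move=> [_ [_ [Hx _]]] uM; exists (hx M), (invmx (hx M)).
split; first exact: mulVmx.
split; first exact: mulmxV.
split=> // g /=.
by rewrite -scalemxAr Hx scalerA mulfV ?chi_neq0 // scale1r.
Qed.

Lemma twist_Vt n la mu : hiso (twist (Vt chi n mu) la) (Vt chi n (chr_mul la mu)).
Proof.
exists 1%:M, 1%:M; rewrite !mul1mx; do !split=> //; last by rewrite ?mul1mx mulmx1.
move=> g; rewrite mul1mx mulmx1; apply/matrixP=> i j; rewrite !mxE /chr_mul.
by rewrite mulrCA [la g * _]mulrCA.
Qed.

(** Rescaling [m_i] by the power [- i] of [la a] undoes the rescaling of [x] caused by a character
    on the right. *)
Lemma Vt_skew n la : is_character la ->
  hiso (Vt chi n eps ** Vt chi 1 la) (Vt chi 1 la ** Vt chi n eps).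
Proof.
move=> [la0 _]; apply: hiso_trans (tens_twistx _ _) _.
apply: hiso_trans _ (hiso_sym (tens_twist _ _)).
pose F := diag_mx (\row_(i < n) (la a)^-1 ^+ i); pose F' := diag_mx (\row_(i < n) la a ^+ i).
exists F, F'; split; [|split; [|split=> [g|]]].
- apply: dc_ext => c cn; have cE : c = Ordinal cn by [].
  rewrite cE mul1mx -mulmxA mul_diag_dc -scalemxAr mul_diag_dc scalerA !mxE.
  by rewrite -exprMn mulVf // expr1n scale1r.
- apply: dc_ext => c cn; have cE : c = Ordinal cn by [].
  rewrite cE mul1mx -mulmxA mul_diag_dc -scalemxAr mul_diag_dc scalerA !mxE.
  by rewrite -exprMn mulfV // expr1n scale1r.
- have gE := @Vt_diag _ _ chi n eps g.
  rewrite -[hg (twistx _ _) g]/(la g *: hg (Vt chi n eps) g).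
  rewrite -[hg (twist _ _) g]/(la g *: hg (Vt chi n eps) g) gE.
  by rewrite -scalemxAr -scalemxAl /diagw !mulmx_diag; congr (_ *: diag_mx _);
    apply/matrixP=> i j; rewrite !mxE mulrC.
apply: dc_ext => c cn; have cE : c = Ordinal cn by [].
rewrite /= -/(Jm k n) -mulmxA -scalemxAl Jm_dc -mulmxA {2}cE mul_diag_dc -!scalemxAr Jm_dc.
have [cn1|cn1] := ltnP c.+1 n; last by rewrite dc0 // mulmx0 !scaler0.
have cE1 : c.+1 = Ordinal cn1 by []; rewrite cE1 mul_diag_dc scalerA !mxE /=.
by rewrite exprS mulrA mulfV // mul1r.
Qed.

(** The same rescaling does not close up around the cycle: it accumulates the factor [la a ^+ sb],
    which moves the parameter. *)
Lemma Cyc_skew be la : is_character la ->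
  hiso (Cyc eps be ** Vt chi 1 la) (Vt chi 1 la ** Cyc eps (la a ^+ sb * be)).
Proof.
move=> [la0 _]; apply: hiso_trans (tens_twistx _ _) _.
apply: hiso_trans _ (hiso_sym (tens_twist _ _)).
pose F := diag_mx (\row_(i < sb) (la a)^-1 ^+ i); pose F' := diag_mx (\row_(i < sb) la a ^+ i).
exists F, F'; split; [|split; [|split=> [g|]]].
- apply: dc_ext => c cn; have cE : c = Ordinal cn by [].
  rewrite cE mul1mx -mulmxA mul_diag_dc -scalemxAr mul_diag_dc scalerA !mxE.
  by rewrite -exprMn mulVf // expr1n scale1r.
- apply: dc_ext => c cn; have cE : c = Ordinal cn by [].
  rewrite cE mul1mx -mulmxA mul_diag_dc -scalemxAr mul_diag_dc scalerA !mxE.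
  by rewrite -exprMn mulfV // expr1n scale1r.
- rewrite /= -scalemxAr -scalemxAl /diagw !mulmx_diag; congr (_ *: diag_mx _).
  by apply/matrixP=> i j; rewrite !mxE mulrC.
have sb0 := sb_pos; apply: dc_ext => c cn; have cE : c = Ordinal cn by [].
rewrite -mulmxA -scalemxAl (Cyc_dc eps be c) -mulmxA [in RHS]cE mul_diag_dc -!scalemxAr.
rewrite (Cyc_dc eps _ c) !mxE /= mulmxDr -scalemxAr.
have F0 : F *m dc k sb 0 = dc k sb 0.
  by rewrite -[0%N]/(val (Ordinal sb0)) mul_diag_dc mxE /= expr0 scale1r.
rewrite F0; have [cn1|cn1] := ltnP c.+1 sb.
  rewrite (ltn_eqF cn1) !mul0r !scale0r !addr0.
  have cE1 : c.+1 = Ordinal cn1 by []; rewrite cE1 mul_diag_dc scalerA !mxE /=.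
  by rewrite exprS mulrA mulfV // mul1r.
have E : c.+1 = sb by apply/eqP; rewrite eqn_leq cn.
rewrite dc0 // mulmx0 !add0r E eqxx !mul1r !scalerA; congr (_ *: _).
by rewrite mulrA -[in RHS]E exprSr mulrA -exprMn mulVf // expr1n mul1r.
Qed.

(** ** Modules built from two strings *)

Section TwoStrings.
Variables (M : hmod k G) (mu : G -> k) (t : nat) (l r : k) (E F : nat -> 'cV[k]_(hdim M)).
Hypotheses (wM : wmod M) (dM : hdim M = (t + t)%N) (t0 : (0 < t)%N) (l0 : l != 0).
Hypothesis gE : forall g j, hg M g *m E j = (chi g ^+ j * mu g) *: E j.
Hypothesis gF : forall g j, hg M g *m F j = (chi g ^+ j.+1 * mu g) *: F j.
Hypothesis xE : forall j, hx M *m E j = E j.+1 + (l * r ^+ j) *: F j.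
Hypothesis xF : forall j, hx M *m F j = F j.+1.
Hypotheses (Et : forall j, (t <= j)%N -> E j = 0) (Ft : forall j, (t <= j)%N -> F j = 0).
Hypothesis span : forall d (A : 'M[k]_(hdim M, d)),
  (forall j, (j < t)%N -> exists z : 'cV_d, A *m z = E j) ->
  (forall j, (j < t)%N -> exists z : 'cV_d, A *m z = F j) -> \rank A = hdim M.

Let xXF j e : hx M ^+ e *m F j = F (j + e).
Proof.
elim: e => [|e IH]; first by rewrite expr0 mul1mx addn0.
by rewrite exprS -mulmxE -mulmxA IH xF addnS.
Qed.

(** Each step along [E] leaks [l * r ^+ j] into the string [F]; the leaks add up to a quantum
    integer. *)
Let xXE e : hx M ^+ e.+1 *m E 0 = E e.+1 + (l * qn r e.+1) *: F e.
Proof.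
elim: e => [|e IH]; first by rewrite expr1 xE qnSr qn0 expr0 add0r.
rewrite exprS -mulmxE -mulmxA IH mulmxDr xE -scalemxAr xF -addrA -scalerDl.
by rewrite [in RHS]qnSr -mulrDr [r ^+ _ + _]addrC.
Qed.

Let xXE1 e : hx M ^+ e *m E 1 = E e.+1 + (l * (qn r e.+1 - 1)) *: F e.
Proof.
elim: e => [|e IH]; first by rewrite expr0 mul1mx qnSr qn0 expr0 add0r subrr mulr0 scale0r addr0.
rewrite exprS -mulmxE -mulmxA IH mulmxDr xE -scalemxAr xF -addrA -scalerDl.
by rewrite -mulrDr [in RHS]qnSr addrA [r ^+ _ + _]addrC.
Qed.

Lemma hom_Vt n la v : hx M ^+ n *m v = 0 -> (forall g, hg M g *m v = la g *: v) ->
  let I := krylov sb 0 n v in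
  [/\ forall g, I *m hg (Vt chi n la) g = hg M g *m I,
      I *m hx (Vt chi n la) = hx M *m I &
      forall c, (c < n)%N -> I *m dc k n c = hx M ^+ c *m v].
Proof.
move=> xv gv I; have TE : Tg 0 (hx M) = hx M by rewrite /Tgm eqxx.
have IE c : (c < n)%N -> I *m dc k n c = hx M ^+ c *m v.
  by move=> cn; rewrite (kv_dc sb 0 v cn) TE.
split=> //.
  move=> g; rewrite Vt_diag; apply: dc_ext => c cn.
  have cE : c = Ordinal cn by []; rewrite -mulmxA {1}cE diagw_dc -scalemxAr -mulmxA IE //.
  by rewrite mulmxA (hg_hxX chi_char) // -scalemxAl -mulmxA gv -scalemxAr scalerA.
rewrite -TE; apply: kv_J; by rewrite TE.
Qed.

(** The span is expressed by an arbitrary property [S] stable under linear combinations, later taken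
    to be membership in the image of [I]. As the dimensions add up, surjectivity suffices. *)
Lemma two_hom n1 n2 la1 la2 v1 v2 :
  hx M ^+ n1 *m v1 = 0 -> (forall g, hg M g *m v1 = la1 g *: v1) ->
  hx M ^+ n2 *m v2 = 0 -> (forall g, hg M g *m v2 = la2 g *: v2) ->
  (n1 + n2 = t + t)%N ->
  (forall S : 'cV[k]_(hdim M) -> Prop, (forall c, (c < n1)%N -> S (hx M ^+ c *m v1)) ->
     (forall c, (c < n2)%N -> S (hx M ^+ c *m v2)) -> (forall x y, S x -> S y -> S (x + y)) ->
     (forall c x, S x -> S (c *: x)) ->
     (forall j, (j < t)%N -> S (E j)) /\ (forall j, (j < t)%N -> S (F j))) ->
  hiso M (hdsum (Vt chi n1 la1) (Vt chi n2 la2)).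
Proof.
move=> x1 g1 x2 g2 n12 HS; apply: hiso_sym.
have [Ig1 Ix1 IE1] := hom_Vt x1 g1; have [Ig2 Ix2 IE2] := hom_Vt x2 g2.
set I1 := krylov _ _ _ _ in Ig1 Ix1 IE1; set I2 := krylov _ _ _ _ in Ig2 Ix2 IE2.
pose I : 'M[k]_(hdim M, n1 + n2) := row_mx I1 I2.
have rI : \rank I = hdim M.
  have [] := HS (fun x => exists z, I *m z = x); last by move=> ? ?; apply: span.
  - move=> c cn; exists (col_mx (dc k n1 c) 0); by rewrite mul_row_col IE1 // mulmx0 addr0.
  - move=> c cn; exists (col_mx 0 (dc k n2 c)); by rewrite mul_row_col IE2 // mulmx0 add0r.
  - by move=> x y [zx <-] [zy <-]; exists (zx + zy); rewrite mulmxDr.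
  - by move=> c x [z <-]; exists (c *: z); rewrite scalemxAr.
apply: (@hiso_full _ _ (hdsum (Vt chi n1 la1) (Vt chi n2 la2)) M I) => //.
- by rewrite rI dM.
- move=> g; rewrite /= -!/(hg (Vt _ _ _) _) mul_row_block !mulmx0 addr0 add0r mul_mx_row.
  by congr row_mx; [apply: Ig1 | apply: Ig2].
rewrite /= mul_row_block !mulmx0 addr0 add0r mul_mx_row.
by congr row_mx; [apply: Ix1 | apply: Ix2].
Qed.

(** When the total leak is nonzero, [E 0] generates a string of length [t.+1]. The correction in [w]
    is chosen so that the coefficient of [F] at step [t.-1] is [qn r t - qn r t], which ends the
    second string one step early. *)
Lemma two_strings_generic : qn r t != 0 ->
  hiso M (hdsum (Vt chi t.+1 mu) (Vt chi t.-1 (chr_mul chi mu))).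
Proof.
move=> qt; pose w := E 1 - (l * (qn r t - 1)) *: F 0.
have xw e : hx M ^+ e *m w = E e.+1 + (l * (qn r e.+1 - qn r t)) *: F e.
  rewrite mulmxBr xXE1 -scalemxAr xXF add0n -addrA -scalerBl; congr (_ + _ *: _).
  by rewrite -mulrBr; congr (l * _); rewrite opprB addrA subrK.
apply: (@two_hom _ _ _ _ (E 0) w).
- by rewrite xXE Et // Ft // scaler0 addr0.
- by move=> g; rewrite gE expr0 mul1r.
- by rewrite xw (prednK t0) Et // subrr mulr0 scale0r addr0.
- move=> g; rewrite mulmxBr gE -scalemxAr gF scalerBr !scalerA /chr_mul expr1.
  by congr (_ - _ *: _); rewrite mulrC.
- by rewrite addSnnS prednK.
move=> S S1 S2 SD SZ.
have SF j : (j < t)%N -> S (F j).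
  move=> jt; have lq : l * qn r t != 0 by rewrite mulf_neq0.
  have -> : F j = (l * qn r t)^-1 *: (hx M ^+ j.+1 *m E 0 + -1 *: (hx M ^+ j *m w)).
    rewrite xXE xw scaleN1r opprD addrACA subrr add0r -scalerBl -mulrBr.
    by rewrite opprB addrCA subrr addr0 scalerA mulVf // scale1r.
  apply/SZ; apply/SD; first exact/S1.
  apply/SZ; have [jt1|jt1] := ltnP j t.-1; first exact/S2.
  have -> : j = t.-1 by apply/eqP; rewrite eqn_leq jt1 -ltnS prednK // jt.
  (* This vector is zero. [S] is not assumed at zero, so zero is written as a multiple of a vector
     already known to satisfy [S]. *)
  rewrite xw prednK // Et // subrr mulr0 scale0r addr0 -(scale0r (F 0)).
  have [t1|t1] := ltnP 1 t; last first.
    have -> : F 0 = l^-1 *: (hx M ^+ 1 *m E 0).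
      rewrite xXE Et; last by [].
      by rewrite add0r scalerA qnSr qn0 expr0 add0r mulr1 mulVf // scale1r.
    by do 2!apply/SZ; apply/S1; rewrite ltnS.
  have -> : (0 : k) *: F 0 = 0 *: (hx M ^+ 0 *m E 0) by rewrite !scale0r.
  by apply/SZ; apply/S1.
split=> // -[|j] jt.
  by have := S1 0%N; rewrite expr0 mul1mx; apply.
have -> : E j.+1 = hx M ^+ j.+1 *m E 0 + (- (l * qn r j.+1)) *: F j.
  by rewrite xXE scaleNr addrK.
by apply/SD; [apply/S1; apply: ltnW | apply/SZ; apply/SF; apply: ltnW].
Qed.

Lemma two_strings_special : qn r t = 0 ->
  hiso M (hdsum (Vt chi t mu) (Vt chi t (chr_mul chi mu))).
Proof.
move=> qt; apply: (@two_hom _ _ _ _ (E 0) (F 0)) => //.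
- by case: (t) t0 Et qt => // t' _ Et' qt; rewrite xXE Et' // qt mulr0 scale0r addr0.
- by move=> g; rewrite gE expr0 mul1r.
- by rewrite xXF add0n Ft.
move=> S S1 S2 SD SZ.
have SF j : (j < t)%N -> S (F j) by move=> jt; rewrite -[j]add0n -xXF; apply/S2.
split=> // -[|j] jt; first by have := S1 0%N; rewrite expr0 mul1mx; apply.
have -> : E j.+1 = hx M ^+ j.+1 *m E 0 + (- (l * qn r j.+1)) *: F j.
  by rewrite xXE scaleNr addrK.
by apply/SD; [apply/S1 | apply/SZ; apply/SF; apply: ltnW].
Qed.

End TwoStrings.

Lemma rank_span_tens m n d (A : 'M[k]_(m * n, d)) :
  (forall c e, (c < m)%N -> (e < n)%N -> exists z : 'cV_d, A *m z = dc k m c *t dc k n e) ->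
  \rank A = (m * n)%N.
Proof.
move=> H; have [f fE] : exists f : 'I_m -> 'I_n -> 'cV[k]_d,
    forall c e, A *m f c e = dc k m c *t dc k n e.
  have f0 (c : 'I_m) (e : 'I_n) : exists z : 'cV_d, A *m z = dc k m c *t dc k n e by apply: H.
  exists (fun c e => projT1 (cid (f0 c e))) => c e; exact: (projT2 (cid (f0 c e))).
pose B : 'M[k]_(d, m * n) := \matrix_(i, j) f (mxtens_unindex j).1 (mxtens_unindex j).2 i 0.
have AB : A *m B = 1%:M.
  apply/matrixP=> i j; case: (mxtens_indexP j) => c e.
  transitivity ((A *m f c e) i 0).
    by rewrite [LHS]mxE [RHS]mxE; apply: eq_bigr => l _; rewrite [B _ _]mxE mxtens_indexK.
  rewrite fE; case: (mxtens_indexP i) => i1 i2; rewrite !mxE !mxtens_indexK /=.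
  by rewrite (can_eq (@mxtens_indexK m n)) xpair_eqE -natrM mulnb.
apply/eqP; rewrite eqn_leq rank_leq_row -{1}(mxrank1 k (m * n)) -AB.
exact: mxrankM_maxl.
Qed.

Lemma qn_neq0 (r : k) t : s.-primitive_root r -> r != 1 -> ~~ (s %| t)%N -> qn r t != 0.
Proof.
move=> rp r1; apply: contra => /eqP E; rewrite (prim_order_dvd rp) -subr_eq0 subrX1.
by rewrite -/(qn r t) E mulr0.
Qed.

Lemma qn_eq0 (r : k) t : s.-primitive_root r -> r != 1 -> (s %| t)%N -> qn r t = 0.
Proof.
move=> rp r1; rewrite (prim_order_dvd rp) => /eqP E.
have : (r - 1) * qn r t = 0 by rewrite -subrX1 E subrr.
by move/eqP; rewrite mulf_eq0 subr_eq0 (negPf r1) => /eqP.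
Qed.

Lemma pV_neq1 : p^-1 != 1.
Proof. by rewrite -(inj_eq (@invr_inj _)) invrK invr1. Qed.

Lemma hg_Vt_dc n la g c : hg (Vt chi n la) g *m dc k n c = (chi g ^+ c * la g) *: dc k n c.
Proof.
have [cn|cn] := ltnP c n; last by rewrite dc0 // mulmx0 scaler0.
by have -> : c = Ordinal cn by []; rewrite Vt_diag diagw_dc.
Qed.

(** The vectors [m_0 (x) m_j] and [m_1 (x) m_j] form two strings with ratio [chi a]; the two cases
    are the nonvanishing and the vanishing of the quantum integer of [t]. *)
Lemma Vt2_tens t la : is_character la -> (0 < t)%N ->
  (~~ (s %| t)%N -> hiso (Vt chi 2 eps ** Vt chi t la)
                       (hdsum (Vt chi t.+1 la) (Vt chi t.-1 (chr_mul chi la)))) /\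
  ((s %| t)%N -> hiso (Vt chi 2 eps ** Vt chi t la)
                    (hdsum (Vt chi t la) (Vt chi t (chr_mul chi la)))).
Proof.
move=> cl t0; set M := Vt chi 2 eps ** Vt chi t la.
have wM : wmod M by apply: wmod_tens => //; apply: Vt_wmod => //; apply: char_one.
pose E j : 'cV[k]_(hdim M) := dc k 2 0 *t dc k t j.
pose F j : 'cV[k]_(hdim M) := dc k 2 1 *t dc k t j.
have la0 : la a != 0 by case: cl.
have gM g c j : hg M g *m (dc k 2 c *t dc k t j) = (chi g ^+ c * (chi g ^+ j * la g)) *: (dc k 2 c *t dc k t j).
  have -> : hg M g = hg (Vt chi 2 eps) g *t hg (Vt chi t la) g by [].
  by rewrite (@tensmx_mul k 2 2 t t 1 1) !hg_Vt_dc tensZl tensZr scalerA /chr_one mulr1.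
have xM c j : hx M *m (dc k 2 c *t dc k t j) =
    (p ^+ j * la a) *: (dc k 2 c.+1 *t dc k t j) + dc k 2 c *t dc k t j.+1.
  have -> : hx M = hx (Vt chi 2 eps) *t hg (Vt chi t la) a + 1%:M *t hx (Vt chi t la) by [].
  rewrite mulmxDl !(@tensmx_mul k 2 2 t t 1 1) !hg_Vt_dc mul1mx !Vt_hx !Jm_dc.
  by rewrite tensZr.
have gE g j : hg M g *m E j = (chi g ^+ j * la g) *: E j by rewrite gM expr0 mul1r.
have gF g j : hg M g *m F j = (chi g ^+ j.+1 * la g) *: F j.
  by rewrite gM expr1 mulrA -exprS.
have xE j : hx M *m E j = E j.+1 + (la a * p ^+ j) *: F j by rewrite xM addrC mulrC.
have xF j : hx M *m F j = F j.+1 by rewrite xM (dc0 k (leqnn 2)) tens0mx scaler0 add0r.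
have Et j : (t <= j)%N -> E j = 0 by move=> tj; rewrite /E (dc0 k tj) tensmx0.
have Ft j : (t <= j)%N -> F j = 0 by move=> tj; rewrite /F (dc0 k tj) tensmx0.
have dM : hdim M = (t + t)%N by rewrite /= mul2n addnn.
have span d (A : 'M[k]_(hdim M, d)) : (forall j, (j < t)%N -> exists z : 'cV_d, A *m z = E j) ->
    (forall j, (j < t)%N -> exists z : 'cV_d, A *m z = F j) -> \rank A = hdim M.
  move=> HE HF; apply: (@rank_span_tens 2 t) => -[|[|//]] e _ et; [exact: HE | exact: HF].
split=> st.
  by apply: (two_strings_generic wM dM t0 la0 gE gF xE xF Et Ft span); apply: qn_neq0 => //; apply: p_prim.
by apply: (two_strings_special wM dM t0 gE gF xE xF Et Ft span); apply: qn_eq0 => //; apply: p_prim.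
Qed.

(** The opposite order of factors, used to commute [y] with [z]. Since [a] acts on the second factor
    by [chi a] at [m_1], the string [F] is rescaled by [p ^+ j], and the ratio becomes [p^-1]. *)
Lemma tens_Vt2 t : (0 < t)%N -> ~~ (s %| t)%N ->
  hiso (Vt chi t eps ** Vt chi 2 eps) (hdsum (Vt chi t.+1 eps) (Vt chi t.-1 (chr_mul chi eps))).
Proof.
move=> t0 st; set M := Vt chi t eps ** Vt chi 2 eps.
have wM : wmod M by apply: wmod_tens => //; apply: Vt_wmod => //; apply: char_one.
pose E j : 'cV[k]_(hdim M) := dc k t j *t dc k 2 0.
pose F j : 'cV[k]_(hdim M) := p ^+ j *: (dc k t j *t dc k 2 1).
have gM g c j : hg M g *m (dc k t j *t dc k 2 c) = (chi g ^+ j * chi g ^+ c) *: (dc k t j *t dc k 2 c).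
  have -> : hg M g = hg (Vt chi t eps) g *t hg (Vt chi 2 eps) g by [].
  by rewrite (@tensmx_mul k t t 2 2 1 1) !hg_Vt_dc tensZl tensZr scalerA /chr_one !mulr1.
have xM c j : hx M *m (dc k t j *t dc k 2 c) =
    p ^+ c *: (dc k t j.+1 *t dc k 2 c) + dc k t j *t dc k 2 c.+1.
  have -> : hx M = hx (Vt chi t eps) *t hg (Vt chi 2 eps) a + 1%:M *t hx (Vt chi 2 eps) by [].
  rewrite mulmxDl !(@tensmx_mul k t t 2 2 1 1) !hg_Vt_dc mul1mx !Vt_hx !Jm_dc.
  by rewrite tensZr /chr_one mulr1.
have gE g j : hg M g *m E j = (chi g ^+ j * eps g) *: E j by rewrite gM expr0.
have gF g j : hg M g *m F j = (chi g ^+ j.+1 * eps g) *: F j.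
  by rewrite -scalemxAr gM !scalerA mulrC expr1 -exprSr /chr_one mulr1.
have xE j : hx M *m E j = E j.+1 + (1 * p^-1 ^+ j) *: F j.
  rewrite xM expr0 scale1r /F scalerA mul1r -exprMn mulVf ?chi_neq0 // expr1n scale1r.
  by [].
have xF j : hx M *m F j = F j.+1.
  by rewrite -scalemxAr xM (dc0 k (leqnn 2)) tensmx0 addr0 scalerA expr1 -exprSr.
have Et j : (t <= j)%N -> E j = 0 by move=> tj; rewrite /E (dc0 k tj) tens0mx.
have Ft j : (t <= j)%N -> F j = 0 by move=> tj; rewrite /F (dc0 k tj) tens0mx scaler0.
have dM : hdim M = (t + t)%N by rewrite /= muln2 addnn.
have span d (A : 'M[k]_(hdim M, d)) : (forall j, (j < t)%N -> exists z : 'cV_d, A *m z = E j) ->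
    (forall j, (j < t)%N -> exists z : 'cV_d, A *m z = F j) -> \rank A = hdim M.
  move=> HE HF; apply: (@rank_span_tens t 2) => e [|[|//]] et _; first exact: HE.
  have [z zE] := HF e et; exists ((p ^+ e)^-1 *: z).
  by rewrite -scalemxAr zE scalerA mulVf ?scale1r // expf_neq0 // chi_neq0.
apply: (two_strings_generic wM dM t0 (oner_neq0 k) gE gF xE xF Et Ft span).
by apply: qn_neq0 => //; apply: pV_neq1.
Qed.

(** ** Modules with a shift automorphism *)

(* An invertible operator commuting with [x] and shifting weights by [chi]
   makes all ranks constant along the orbit of [chi]. *)
Definition HG M := exists w, [/\ @is_diag k G M w,
  forall i, exists c, w i = chr_pow chi c &
  exists T : 'M[k]_(hdim M), [/\ T \in unitmx, T *m hx M = hx M *m T &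
     forall g, T *m hg M g = (chi g)^-1 *: (hg M g *m T)]].

Definition tot ga n M : nat := \rank (Tg ga (hx M) ^+ n).

Lemma mulmx_comm_exp d (A B : 'M[k]_d) e : A *m B = B *m A -> A *m B ^+ e = B ^+ e *m A.
Proof. by move=> AB; apply: intertw_exp. Qed.

Lemma rank_mul_unitl d m (A : 'M[k]_d) (B : 'M[k]_(d, m)) : A \in unitmx -> \rank (A *m B) = \rank B.
Proof. by move=> uA; rewrite (eqmxMfull B) // row_full_unit. Qed.

Lemma rank_mul_unitr d m (A : 'M[k]_(d, m)) (B : 'M[k]_m) : B \in unitmx -> \rank (A *m B) = \rank A.
Proof. by move=> uB; rewrite mxrankMfree // row_free_unit. Qed.

Lemma hx_pw M w mu e : wmod M -> @is_diag k G M w ->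
  hx M ^+ e *m pw w mu = pw w (chr_mul (chr_pow chi e) mu) *m hx M ^+ e.
Proof.
move=> wM dM; pose c := fun g => (chi g ^+ e)^-1.
have H g : hx M ^+ e *m diagw w g = c g *: (diagw w g *m hx M ^+ e).
  by rewrite -dM (hx_hgX chi_char).
rewrite -(intertw_pw _ H); last by move=> g; rewrite invr_eq0 expf_neq0 // chi_neq0.
congr (_ *m pw w _); apply/funext => g.
by rewrite /chr_mul /chr_pow /c mulKf // expf_neq0 // chi_neq0.
Qed.

Lemma Tg_pw M w mu ga e : wmod M -> @is_diag k G M w ->
  exists c, forall m, Tg ga (hx M) ^+ e *m pw w (chr_pow chi m) =
            pw w (chr_pow chi (c + m)) *m Tg ga (hx M) ^+ e.
Proof.
move=> wM dM; rewrite /Tgm; case: eqP => _.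
  by exists e => m; rewrite hx_pw // chr_powD.
exists 0%N => m; rewrite add0n; apply/esym/mulmx_comm_exp.
rewrite mulmxBl mulmxBr scalar_mxC; congr (_ - _).
by rewrite (hx_pw _ _ wM dM) (chr_pow_mod chi_ord sb) modnn chr_pow0 chr_mul1.
Qed.

(** The row spaces of the [R *m D i] are independent because the [D i] are orthogonal idempotents.
    They lie in that of [R] because [R *m D i] equals another weight projection times [R], and they
    exhaust it because the [D i] sum to 1. *)
Lemma rank_sum_pw M w ga e : wmod M -> @is_diag k G M w ->
  (forall i, exists c, w i = chr_pow chi c) ->
  (\sum_(i < sb) \rank (Tg ga (hx M) ^+ e *m pw w (chr_pow chi i)))%N = tot ga e M.
Proof.
move=> wM dM wc; have [c Rc] := Tg_pw (@chr_one k G) ga e wM dM.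
rewrite /tot; set R := Tg ga (hx M) ^+ e in Rc *.
pose D (i : 'I_sb) := pw w (chr_pow chi i).
have sD : \sum_i D i = 1%:M.
  apply: sum_pw => j; have [m wj] := wc j.
  have ms : (m %% sb < sb)%N by rewrite ltn_mod sb_pos.
  rewrite (bigD1 (Ordinal ms)) //= big1 => [|i ne]; rewrite wj.
    by rewrite -chr_pow_mod // asboolT // addr0.
  rewrite asboolF // (chr_pow_mod chi_ord) => E; case/eqP: ne; apply: val_inj.
  by apply/esym; apply: (chi_pow_inj chi_ord _ _ E) => //; apply: chi_neq0.
have DD i j : D i *m D j = if i == j then D i else 0.
  rewrite /D pwM; case: eqP => [->|ne]; first by rewrite asboolT.
  rewrite asboolF // => E; apply: ne; apply: val_inj.
  by apply: (chi_pow_inj chi_ord _ _ E) => //; apply: chi_neq0.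
have dir : mxdirect (\sum_i (R *m D i)%MS).
  apply/mxdirect_sumsP => i _; apply/eqP; rewrite -submx0.
  set W := (_ :&: _)%MS.
  have W1 : W = W *m D i.
    have /submxP [u ->] : (W <= R *m D i)%MS by apply: capmxSl.
    by rewrite -!mulmxA DD eqxx.
  rewrite W1; have /sub_sumsmxP [u ->] : (W <= \sum_(j | true && (j != i)) R *m D j)%MS by apply: capmxSr.
  rewrite mulmx_suml big1 ?sub0mx // => j /= ji.
  by rewrite -!mulmxA DD (negPf ji) !mulmx0.
have dE : \rank (\sum_i (R *m D i))%MS = (\sum_i \rank (R *m D i))%N := mxdirectP dir.
rewrite -[LHS]dE; apply: eqmx_rank; apply/andP; split.
  apply/sumsmx_subP => i _; rewrite /D Rc; exact: submxMl.
have {1}-> : R = \sum_i R *m D i by rewrite -mulmx_sumr sD mulmx1.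
by apply: summx_sub_sums => i _; apply: submx_refl.
Qed.

(** The ranks at the [sb] weights of the orbit are equal and add up to the total rank. *)
Lemma HG_rho M ga n mu : wmod M -> HG M ->
  (rho sb ga n mu M * sb)%N = if `[< exists c, mu = chr_pow chi c >] then tot ga n M else 0%N.
Proof.
move=> wM [w [dM wc [T [uT TX Tg']]]]; rewrite (rhoE sb ga n mu dM) /rk.
case: asboolP => [[c ->]|nc]; last first.
  have -> : pw w mu = 0; last by rewrite mulmx0 mxrank0 mul0n.
  apply/matrixP=> i j; rewrite !mxE asboolF ?mul0rn // => E; apply: nc; rewrite -E.
  exact: wc.
have shift m : \rank (Tg ga (hx M) ^+ n *m pw w (chr_pow chi m.+1)) =
               \rank (Tg ga (hx M) ^+ n *m pw w (chr_pow chi m)).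
  pose c' := fun g => (chi g)^-1.
  have H g : T *m diagw w g = c' g *: (diagw w g *m T) by rewrite -dM.
  have TD : T *m pw w (chr_pow chi m) = pw w (chr_pow chi m.+1) *m T.
    rewrite -(intertw_pw _ H) => [|g]; last by rewrite invr_eq0 chi_neq0.
    congr (_ *m pw w _); apply/funext => g.
    by rewrite chr_powS /chr_mul /c' mulKf ?chi_neq0.
  rewrite -(rank_mul_unitr _ uT) -mulmxA -TD mulmxA.
  by rewrite -(mulmx_comm_exp n (intertw_Tg sb ga TX)) -mulmxA rank_mul_unitl.
have shift0 m : \rank (Tg ga (hx M) ^+ n *m pw w (chr_pow chi m)) =
                \rank (Tg ga (hx M) ^+ n *m pw w (chr_pow chi 0)).
  by elim: m => // m <-.
rewrite -(rank_sum_pw ga n wM dM wc) shift0.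
by rewrite (eq_bigr _ (fun (i : 'I_sb) _ => shift0 i)) sum_nat_const card_ord mulnC.
Qed.

Definition in_orbit mu : int := indic (exists c, mu = chr_pow chi c).

Lemma HG_topinv M b : wmod M -> HG M -> (0 < b.2)%N ->
  sb%:Z * topinv sb b M = in_orbit b.1.1 * ((tot b.1.2 b.2.-1 M)%:Z - (tot b.1.2 b.2 M)%:Z).
Proof.
move=> wM hM b0; rewrite /topinv /iotam mulrBr prednK // mulrC [_ * Posz (rho _ _ _ _ _)]mulrC.
rewrite -!PoszM !HG_rho // /in_orbit /indic; case: asboolP => _; first by rewrite mul1r.
by rewrite subrr mul0r.
Qed.

(** Multiplication by [sb], harmless over the integers, turns every [topinv] into a difference of
    total ranks. *)
Lemma HG_green (f g : fsum k G) : valid_fsum chi f -> valid_fsum chi g ->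
  (forall t, List.In t f -> HG t.2) -> (forall t, List.In t g -> HG t.2) ->
  (forall ga n, lin (fun M => (tot ga n M)%:Z) f = lin (fun M => (tot ga n M)%:Z) g) ->
  greenEq chi f g.
Proof.
move=> vf vg hf hg H.
have main (h : fsum k G) b : valid_fsum chi h -> (forall t, List.In t h -> HG t.2) -> (0 < b.2)%N ->
    sb%:Z * lin (topinv sb b) h = in_orbit b.1.1 *
      (lin (fun M => (tot b.1.2 b.2.-1 M)%:Z) h - lin (fun M => (tot b.1.2 b.2 M)%:Z) h).
  move=> vh hh b0; rewrite mulrBr /lin !mulr_sumr -sumrB.
  apply/eqP; rewrite -subr_eq0 -sumrB; apply/eqP; apply: sum_In => t Ht.
  rewrite mulrCA HG_topinv //; [ring | exact: vh | exact: hh].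
apply: (green_of_topinv sb_pos chi_ord chi_char) => // b [_ b0 _].
have sb0 : sb%:Z != 0 by rewrite eqz_nat -lt0n sb_pos.
by apply: (mulfI sb0); rewrite !main // !H.
Qed.

Lemma wmod_eps : is_character eps. Proof. exact: char_one. Qed.

Lemma Vw_eps n (i : 'I_n) : Vw chi eps i = chr_pow chi i.
Proof. exact: chr_mulr1. Qed.

Lemma hx_hg M g : wmod M -> hx M *m hg M g = (chi g)^-1 *: (hg M g *m hx M).
Proof. by move=> [_ [_ [H _]]]. Qed.

Lemma HG_Cyc be : be != 0 -> HG (Cyc eps be).
Proof.
move=> b0; exists (@Vw k G chi sb eps); split=> // [i|]; first by exists i; apply: Vw_eps.
exists (hx (Cyc eps be)); split=> // [|g]; first exact: Cyc_hx_unit.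
by apply: hx_hg; apply: Cyc_wmod wmod_eps.
Qed.

Definition orbital M := exists2 w, @is_diag k G M w & forall i, exists c, w i = chr_pow chi c.

Lemma orbital_Vt n : orbital (Vt chi n eps).
Proof.
exists (@Vw k G chi n eps); first exact: Vt_diag.
by move=> i; exists i; apply: Vw_eps.
Qed.

Lemma orbital_Cyc be : orbital (Cyc eps be).
Proof. by exists (@Vw k G chi sb eps) => // i; exists i; apply: Vw_eps. Qed.

Lemma tens_unit m n (A : 'M[k]_m) (B : 'M[k]_n) : A \in unitmx -> B \in unitmx -> A *t B \in unitmx.
Proof.
move=> uA uB; have /mulmx1_unit [] // : (A *t B) *m (invmx A *t invmx B) = 1%:M.
by rewrite tensmx_mul !mulmxV // tens1.
Qed.

Lemma tensw_orbit m n (w : 'I_m -> G -> k) (v : 'I_n -> G -> k) :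
  (forall i, exists c, w i = chr_pow chi c) -> (forall i, exists c, v i = chr_pow chi c) ->
  forall i, exists c, tensw w v i = chr_pow chi c.
Proof.
move=> Hw Hv i; have [c wi] := Hw (mxtens_unindex i).1; have [d vi] := Hv (mxtens_unindex i).2.
by exists (c + d)%N; rewrite /tensw wi vi chr_powD.
Qed.

(** The shift operator is [x *t 1], which commutes with both terms of the coproduct of [x]. *)
Lemma HG_Cyc_tens be K : be != 0 -> wmod K -> orbital K -> HG (Cyc eps be ** K).
Proof.
move=> b0 wK [w dK wc]; have wC := Cyc_wmod be wmod_eps.
exists (tensw (@Vw k G chi sb eps) w); split.
- exact: (diag_tens a (Cyc_diag eps be) dK).
- by apply: tensw_orbit => // i; exists i; apply: Vw_eps.
exists (hx (Cyc eps be) *t 1%:M); split.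
- by apply: tens_unit; [apply: Cyc_hx_unit | apply: unitmx1].
- rewrite mulmxDr mulmxDl !tensmx_mul !mul1mx !mulmx1 //.
by move=> g; rewrite !tensmx_mul mul1mx mulmx1 (hx_hg _ wC) tensZl.
Qed.

(** With the cyclic factor on the right the shift operator is [a *t x]: the two scalars picked up
    when it crosses [x *t a] cancel. *)
Lemma HG_tens_Cyc be K : be != 0 -> wmod K -> orbital K -> HG (K ** Cyc eps be).
Proof.
move=> b0 wK [w dK wc]; have wC := Cyc_wmod be wmod_eps.
exists (tensw w (@Vw k G chi sb eps)); split.
- exact: (diag_tens a dK (Cyc_diag eps be)).
- by apply: tensw_orbit => // i; exists i; apply: Vw_eps.
exists (hg K a *t hx (Cyc eps be)); split.
- by apply: tens_unit; [apply: hg_unit | apply: Cyc_hx_unit].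
- rewrite mulmxDr mulmxDl !tensmx_mul mul1mx mulmx1; congr (_ + _).
  rewrite (hg_hx chi_char) // (hx_hg _ wC) tensZl tensZr scalerA mulfV ?scale1r //.
  exact: chi_neq0.
move=> g; rewrite !tensmx_mul (hx_hg _ wC) tensZr; congr (_ *: (_ *t _)).
by have [_ [gK _]] := wK; rewrite -!gK a_central.
Qed.

Lemma Tg_exp_unit M ga n : Tg ga (hx M) \in unitmx -> tot ga n M = hdim M.
Proof. by move=> u; rewrite /tot mxrank_unit // unitmx_exp. Qed.

Lemma tot_scalar M be ga n : be != 0 -> hx M ^+ sb = be%:M ->
  tot ga n M = if (ga == be) && (0 < n)%N then 0%N else hdim M.
Proof.
move=> b0 xM; have uX : hx M \in unitmx.
  by apply: (unitmx_expV sb_pos); rewrite xM unitmxE det_scalar unitfE expf_neq0.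
have [->|g0] := eqVneq ga 0.
  by rewrite eq_sym (negPf b0) Tg_exp_unit // /Tgm eqxx.
rewrite /tot /Tgm (negPf g0) xM -raddfB /=.
have [->|gb] := eqVneq ga be; last first.
  rewrite mxrank_unit // unitmx_exp // unitmxE det_scalar unitfE expf_neq0 //.
  by rewrite subr_eq0 eq_sym.
rewrite subrr raddf0; case: n => [|n]; first by rewrite expr0 mxrank1.
by rewrite exprS mul0r mxrank0.
Qed.

(** * The flip of tensor factors, and products of cyclic modules with the [V_t] *)

Definition swapmx m n : 'M[k]_(m * n, n * m) :=
  \matrix_(i, j) (mxtens_unindex i == ((mxtens_unindex j).2, (mxtens_unindex j).1))%:R.

Lemma swapmxE m n m' n' (A : 'M[k]_(m', m)) (B : 'M[k]_(n', n)) :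
  (A *t B) *m swapmx m n = swapmx m' n' *m (B *t A).
Proof.
apply/matrixP=> i j; case: (mxtens_indexP i) => i1 i2; case: (mxtens_indexP j) => j2 j1.
rewrite !mxE (bigD1 (mxtens_index (j1, j2))) //= big1 => [|l ne].
  rewrite addr0 [in RHS](bigD1 (mxtens_index (i2, i1))) //= [X in _ + X]big1 => [|l ne].
    by rewrite !mxE !mxtens_indexK !eqxx !addr0 mulr1 mul1r mulrC.
  rewrite !mxE mxtens_indexK (_ : (_ == _) = false) ?mul0r //.
  apply: contraNF ne => /eqP [-> ->].
  by apply/eqP; rewrite -[LHS]mxtens_unindexK; congr mxtens_index; case: (mxtens_unindex l).
rewrite !mxE mxtens_indexK (_ : (_ == _) = false) ?mulr0 //.
apply: contraNF ne => /eqP E; apply/eqP; rewrite -[LHS]mxtens_unindexK; congr mxtens_index.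
by rewrite E mxtens_indexK.
Qed.

Lemma swapmxK m n : swapmx m n *m swapmx n m = 1%:M.
Proof.
apply/matrixP=> i j; case: (mxtens_indexP i) => i1 i2; case: (mxtens_indexP j) => j1 j2.
rewrite mxE (bigD1 (mxtens_index (i2, i1))) //= big1 => [|l ne].
  rewrite !mxE !mxtens_indexK /= eqxx mul1r addr0 (can_eq (@mxtens_indexK _ _)) !xpair_eqE.
  by rewrite andbC.
rewrite !mxE !mxtens_indexK /= (_ : (_ == _) = false) ?mul0r //.
apply: contraNF ne => /eqP [-> ->].
by apply/eqP; rewrite -[LHS]mxtens_unindexK; congr mxtens_index; case: (mxtens_unindex l).
Qed.

Lemma hx_s_swap M N : wmod M -> wmod N -> as1 M -> as1 N ->
  hx (M ** N) ^+ s *m swapmx (hdim M) (hdim N) = swapmx (hdim M) (hdim N) *m hx (N ** M) ^+ s.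
Proof.
move=> wM wN aM aN; rewrite !hx_tens_s // (aM : hg M a ^+ s = 1) (aN : hg N a ^+ s = 1).
by rewrite mulmxDl !swapmxE -mulmxDr addrC.
Qed.

(** For nonzero [ga] the operator [T] is a polynomial in [x ^+ s], with which the flip commutes. At
    [ga = 0] it is [x], and the flip gives no such information. *)
Lemma tot_swap M N ga n : wmod M -> wmod N -> as1 M -> as1 N -> ga != 0 ->
  tot ga n (M ** N) = tot ga n (N ** M).
Proof.
move=> wM wN aM aN g0; have H := intertw_exp s' (esym (hx_s_swap wM wN aM aN)).
rewrite -!expr_sb in H.
have HT : swapmx (hdim M) (hdim N) *m Tg ga (hx (N ** M)) = Tg ga (hx (M ** N)) *m swapmx (hdim M) (hdim N).
  by rewrite /Tgm (negPf g0) mulmxBr mulmxBl H mul_mx_scalar mul_scalar_mx.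
have Hn := intertw_exp n HT.
have rf m d : row_free (swapmx m d) by apply/row_freeP; exists (swapmx d m); apply: swapmxK.
have rF m d : row_full (swapmx m d) by apply/row_fullP; exists (swapmx d m); apply: swapmxK.
rewrite /tot -(mxrankMfree _ (rf (hdim M) (hdim N))) -Hn.
by rewrite (eqmxMfull _ (rF _ _)).
Qed.

Lemma hx_swap_unit M N : wmod M -> wmod N -> as1 M -> as1 N ->
  hx (M ** N) \in unitmx -> hx (N ** M) \in unitmx.
Proof.
move=> wM wN aM aN uX; apply: (unitmx_expV s_pos).
have H := hx_s_swap wM wN aM aN; have uXs := unitmx_exp s uX.
set A := hx (M ** N) ^+ s in H uXs; set B := hx (N ** M) ^+ s in H *.
have /mulmx1_unit [] // : B *m (swapmx (hdim N) (hdim M) *m invmx A *m swapmx (hdim M) (hdim N)) = 1%:M.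
have -> : B = swapmx (hdim N) (hdim M) *m A *m swapmx (hdim M) (hdim N).
  by rewrite -mulmxA H mulmxA swapmxK mul1mx.
by rewrite !mulmxA -(mulmxA _ (swapmx (hdim M) _)) swapmxK mulmx1 -(mulmxA _ A) mulmxV // mulmx1 swapmxK.
Qed.

Lemma valid1 c M : wmod M -> valid_fsum chi [:: (c, M)].
Proof. by move=> wM t [<-|[]]. Qed.

(** As [1 < s], [x ^+ s] vanishes on [V_2]; so [x ^+ sb] is the scalar [be] on the product, and only
    dimensions remain to be compared. *)
Lemma green_Vt2_Cyc be : be != 0 -> greenEq chi [:: (1, Vt chi 2 eps ** Cyc eps be)] [:: (2, Cyc eps be)].
Proof.
move=> b0; have wC := Cyc_wmod be wmod_eps; have wV := Vt_wmod chi_char 2 wmod_eps.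
have xs : hx (Vt chi 2 eps) ^+ s = 0 by rewrite Vt_hx JmX0 ?s_gt1.
apply: HG_green; first by apply/valid1/wmod_tens.
- exact: valid1.
- by move=> t [<-|[]]; apply: HG_tens_Cyc => //; apply: orbital_Vt.
- by move=> t [<-|[]]; apply: HG_Cyc.
move=> ga n; rewrite !lin_cons !lin_nil /= !addr0 mul1r.
rewrite (@tot_scalar _ be) //; last first.
  rewrite expr_sb hx_tens_s // xs tens0mx add0r tensX expr1n -expr_sb Cyc_hx_sb.
  by rewrite -[be%:M in LHS]scalemx1 tensZr tens1 scalemx1.
rewrite (tot_scalar (M := Cyc eps be) _ _ b0) ?Cyc_hx_sb //; case: ifP => _; rewrite /= ?mulr0 // PoszM.
Qed.

Lemma green_Cyc_Vt2 be : be != 0 -> greenEq chi [:: (1, Cyc eps be ** Vt chi 2 eps)] [:: (2, Cyc eps be)].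
Proof.
move=> b0; have wC := Cyc_wmod be wmod_eps; have wV := Vt_wmod chi_char 2 wmod_eps.
have xs : hx (Vt chi 2 eps) ^+ s = 0 by rewrite Vt_hx JmX0 ?s_gt1.
apply: HG_green; first by apply/valid1/wmod_tens.
- exact: valid1.
- by move=> t [<-|[]]; apply: HG_Cyc_tens => //; apply: orbital_Vt.
- by move=> t [<-|[]]; apply: HG_Cyc.
move=> ga n; rewrite !lin_cons !lin_nil /= !addr0 mul1r.
rewrite (@tot_scalar _ be) //; last first.
  rewrite expr_sb hx_tens_s // xs tensmx0 addr0 (as1_Vt 2 : hg (Vt chi 2 eps) a ^+ s = 1).
  rewrite tensX expr1n -expr_sb Cyc_hx_sb.
  by rewrite -[be%:M in LHS]scalemx1 tensZl tens1 scalemx1.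
rewrite (tot_scalar (M := Cyc eps be) _ _ b0) ?Cyc_hx_sb //; case: ifP => _; rewrite /= ?mulr0 // PoszM mulrC //.
Qed.

Lemma top_Tg_unit M c n be (w : 'I_c -> G -> k) ga : TopM sb M be n w -> be != 0 -> ga != be ->
  Tg ga (hx M) \in unitmx.
Proof.
move=> [n0 [P [P' [Q [Q' [_ _ _ _ T0]]]]]] b0 ne.
move: T0 ne; rewrite {1}/Tgm (negPf b0); set X := hx M => T0 ne.
have XE : X ^+ sb = (X ^+ sb - be%:M) + be%:M by rewrite subrK.
rewrite /Tgm; case: eqP => [_|_].
  apply: (unitmx_expV sb_pos); rewrite XE; exact: (unitmx_shift_nilp T0).
have -> : X ^+ sb - ga%:M = (X ^+ sb - be%:M) + (be - ga)%:M.
  by rewrite raddfB /= addrA subrK.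
by apply: (unitmx_shift_nilp T0); rewrite subr_eq0 eq_sym.
Qed.

Lemma one_top : TopM sb (Vt chi 1 eps) 0 (s * 0).+1 (fun _ : 'I_1 => eps).
Proof. by rewrite muln0; apply: Vt_top. Qed.

(** Nonzero eigenvalues are compared by the flip. At zero, [be] is the only eigenvalue of [x ^+ sb]
    on one side, so [x] is invertible there, and the flip carries invertibility of [x ^+ s] to the
    other side. *)
Lemma green_Cyc_Vz be : be != 0 ->
  greenEq chi [:: (1, Cyc eps be ** Vt chi s.+1 eps)] [:: (1, Vt chi s.+1 eps ** Cyc eps be)].
Proof.
move=> b0; have wC := Cyc_wmod be wmod_eps; have wV := Vt_wmod chi_char s.+1 wmod_eps.
have aV := as1_Vt s.+1; have aC := as1_Cyc be.
apply: HG_green; [by apply/valid1/wmod_tens|by apply/valid1/wmod_tens| | |].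
- by move=> t [<-|[]]; apply: HG_Cyc_tens => //; apply: orbital_Vt.
- by move=> t [<-|[]]; apply: HG_tens_Cyc => //; apply: orbital_Vt.
move=> ga n; rewrite !lin_cons !lin_nil /= !addr0 !mul1r.
have [g0|g0] := eqVneq ga 0; last by rewrite tot_swap.
have topz : TopM sb (Vt chi s.+1 eps) 0 (s * 1).+1 (fun _ : 'I_1 => eps).
  by rewrite muln1; apply: Vt_top.
have [c [w [T _ _]]] := Cyc_tens_top wV aV b0 topz.
have u1 : Tg 0 (hx (Cyc eps be ** Vt chi s.+1 eps)) \in unitmx.
  have ne : 0 != be by rewrite eq_sym.
  exact: (top_Tg_unit T b0 ne).
have uX : hx (Cyc eps be ** Vt chi s.+1 eps) \in unitmx by move: u1; rewrite /Tgm eqxx.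
rewrite g0 !Tg_exp_unit //; first by rewrite /= mulnC.
by rewrite /Tgm eqxx; apply: hx_swap_unit uX.
Qed.

(** ** Products of cyclic modules *)

Lemma sum_periodic_shift (R : Type) (idx : R) (op : Monoid.com_law idx) (g : nat -> R) n c :
  (forall j, g (j + n)%N = g j) ->
  \big[op/idx]_(j < n) g (j + c)%N = \big[op/idx]_(j < n) g j.
Proof.
move=> gn; elim: c => [|c IH]; first by apply: eq_bigr => j _; rewrite addn0.
rewrite -[RHS]IH; case: n gn {IH} => [|n] gn; first by rewrite !big_ord0.
rewrite [LHS]big_ord_recr [RHS]big_ord_recl /= Monoid.mulmC; congr (op _ _).
  by rewrite addnS -addSn addnC gn.
by apply: eq_bigr => j _; rewrite /bump /= add1n addnS.
Qed.

Lemma sum_periodic_mul (g : nat -> nat) n m : (forall j, g (j + n)%N = g j) ->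
  (\sum_(j < m * n) g j = m * \sum_(j < n) g j)%N.
Proof.
move=> gn; elim: m => [|m IH]; first by rewrite big_ord0.
rewrite [(m.+1 * n)%N]mulSn big_split_ord /= mulSn; congr (_ + _)%N.
rewrite -IH; apply: eq_bigr => j _.
by rewrite /= addnC gn.
Qed.

Lemma rank_diag n (d : 'rV[k]_n) : \rank (diag_mx d) = (\sum_i nat_of_bool (d 0%R i != 0%R))%N.
Proof.
elim: n d => [|n IH] d; first by rewrite big_ord0; apply/eqP; rewrite -leqn0 rank_leq_row.
have E : diag_mx d = block_mx (diag_mx (lsubmx (d : 'rV_(1 + n)))) 0 0
    (diag_mx (rsubmx (d : 'rV_(1 + n)))) :> 'M_(1 + n) by rewrite -diag_mx_row hsubmxK.
have := congr1 (fun A : 'M[k]_(1 + n) => \rank A) E.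
rewrite rank_diag_block_mx IH big_ord_recl => R; apply: etrans R _.
congr (_ + _)%N; last first.
  by apply: eq_bigr => i _; rewrite mxE; congr (nat_of_bool (d _ _ != _)); apply: val_inj.
rewrite rank_rV; congr nat_of_bool; congr negb.
have -> : d 0 ord0 = diag_mx (lsubmx (d : 'rV_(1 + n))) 0 0.
  by rewrite !mxE eqxx mulr1n; congr (d _ _); apply: val_inj.
apply/eqP/eqP => [->|H]; first by rewrite mxE.
by apply/matrixP=> i j; rewrite !ord1 H mxE.
Qed.

(** The rows of a Vandermonde matrix on the [sb] distinct roots of [r ^+ sb = al ^+ s'] are left
    eigenvectors of the cyclic shift. *)
Lemma Cyc_diagonalize al : al != 0 -> exists V : 'M[k]_sb, V \in unitmx /\
  V *m hx (Cyc eps (al ^+ s')) ^+ s = diag_mx (\row_i (al * xi ^+ i)) *m V.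
Proof.
move=> al0; have xi0 : xi != 0.
  by apply/eqP => x0; have := prim_expr_order xi_prim; rewrite x0 expr0n gtn_eqF ?s'_pos // => /eqP; rewrite eq_sym oner_eq0.
have root_ex c : exists r : k, r ^+ s = c.
  have [|r] := @closed_rootP k ('X^s - c%:P) _; first by rewrite size_XnsubC ?s_pos // eqSS -lt0n s_pos.
  by rewrite /root !hornerE subr_eq0 => /eqP; exists r.
pose rt c := projT1 (cid (root_ex c)).
have rtE c : rt c ^+ s = c by apply: (projT2 (cid (root_ex c))).
(* The residue of [i] modulo [s'] fixes the value [al * xi ^+ i] of [r i ^+ s]; the quotient by [s']
   selects one of its [s] roots. *)
pose r i := rt (al * xi ^+ (i %% s')) * p ^+ (i %/ s').
have rs i : r i ^+ s = al * xi ^+ i.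
  rewrite exprMn rtE -exprM mulnC exprM (prim_expr_order p_prim) expr1n mulr1.
  by rewrite (prim_expr_mod xi_prim).
have rsb i : r i ^+ sb = al ^+ s'.
  by rewrite sbE exprM rs exprMn -exprM mulnC exprM (prim_expr_order xi_prim) expr1n mulr1.
have r_inj (i j : 'I_sb) : r i = r j -> i = j.
  move=> E; have : al * xi ^+ i = al * xi ^+ j by rewrite -!rs E.
  move=> /(mulfI al0) /eqP; rewrite (eq_prim_root_expr xi_prim) => /eqP mij.
  have : rt (al * xi ^+ (i %% s')) != 0.
    apply/eqP => z; have := rtE (al * xi ^+ (i %% s')); rewrite z expr0n gtn_eqF ?s_pos //.
    by move/esym/eqP; rewrite mulf_eq0 (negPf al0) expf_eq0 (negPf xi0) andbF.
  move: E; rewrite /r mij => E /mulfI H; have {H} := H _ _ E.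
  move=> /eqP; rewrite (eq_prim_root_expr p_prim) => /eqP dij.
  have lt (l : 'I_sb) : (l %/ s' < s)%N by rewrite ltn_divLR ?s'_pos // -sbE.
  rewrite !modn_small // in dij.
  by apply: val_inj; rewrite /= (divn_eq i s') (divn_eq j s') mij dij.
pose V : 'M[k]_sb := \matrix_(i, j) r i ^+ j.
have VX : V *m hx (Cyc eps (al ^+ s')) = diag_mx (\row_i r i) *m V.
  apply: dc_ext => c cs; rewrite -mulmxA Cyc_dc mulmxDr -scalemxAr.
  apply/matrixP=> i j; rewrite -mulmxA.
  have Vdc e (es : (e < sb)%N) : (V *m dc k sb e) i j = r i ^+ e.
    by have -> : e = Ordinal es by []; rewrite mulmx_dcE mxE.
  rewrite mxE diag_mulmxE [in RHS](Vdc c cs) [(\row_(_ < _) _) _ _]mxE -exprS.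
  have [cs1|cs1] := ltnP c.+1 sb.
    by rewrite (ltn_eqF cs1) mul0r scale0r [X in _ + X]mxE addr0 Vdc.
  have cE : c.+1 = sb by apply/eqP; rewrite eqn_leq cs.
  rewrite cE eqxx mul1r dc0 // mulmx0 mxE add0r mxE Vdc ?sb_pos // expr0 mulr1.
  by rewrite rsb.
exists V; split.
  have VV : V^T = Vandermonde sb (\row_i r i) by apply/matrixP=> i j; rewrite !mxE.
  rewrite -unitmx_tr VV unitmxE det_Vandermonde unitfE.
  apply/prodf_neq0 => i _; apply/prodf_neq0 => j ij; rewrite !mxE subr_eq0.
  by apply/eqP => /r_inj E; move: ij; rewrite E ltnn.
have := intertw_exp s VX; rewrite (_ : diag_mx _ ^+ s = diag_mx (\row_i (al * xi ^+ i))) //.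
have dX (d : 'rV[k]_sb) e : diag_mx d ^+ e = diag_mx (\row_i d 0 i ^+ e).
  elim: e => [|e IH]; first by apply/matrixP=> i j; rewrite !mxE expr0.
  rewrite exprS IH -mulmxE mulmx_diag; congr diag_mx; apply/matrixP=> i j.
  by rewrite !mxE exprS.
by rewrite dX; congr diag_mx; apply/matrixP=> i j; rewrite !mxE rs.
Qed.

Lemma xi_neq0 : xi != 0.
Proof.
apply/eqP => x0; have := prim_expr_order xi_prim.
by rewrite x0 expr0n gtn_eqF ?s'_pos // => /eqP; rewrite eq_sym oner_eq0.
Qed.

Lemma CC_diagonalize al be : al != 0 -> be != 0 ->
  exists W : 'M[k]_(sb * sb), W \in unitmx /\
    W *m hx (Cyc eps (al ^+ s') ** Cyc eps (be ^+ s')) ^+ s =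
    diag_mx (\row_i (al * xi ^+ (mxtens_unindex i).1 + be * xi ^+ (mxtens_unindex i).2)) *m W.
Proof.
move=> al0 be0; have [V [uV VX]] := Cyc_diagonalize al0; have [V' [uV' VX']] := Cyc_diagonalize be0.
have wa : wmod (Cyc eps (al ^+ s')) := Cyc_wmod _ wmod_eps.
have wb : wmod (Cyc eps (be ^+ s')) := Cyc_wmod _ wmod_eps.
exists (V *t V'); split; first exact: tens_unit.
rewrite hx_tens_s // (as1_Cyc (be ^+ s') : hg _ a ^+ s = 1) mulmxDr !tensmx_mul !mulmx1 VX VX'.
have -> : diag_mx (\row_i (al * xi ^+ (mxtens_unindex i).1 + be * xi ^+ (mxtens_unindex i).2)) =
   diag_mx (\row_i (al * xi ^+ i)) *t 1%:M + 1%:M *t diag_mx (\row_i (be * xi ^+ i)) :> 'M[k]_(sb * sb).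
  rewrite -diag_const_mx !tens_diag -raddfD; congr diag_mx; apply/matrixP=> i j.
  by rewrite !mxE mul1r mulr1.
by rewrite mulmxDl !tensmx_mul !mul1mx.
Qed.

(** Invariance under [xi] allows [xi ^+ i] to be factored out, so the term depends only on [j - i]
    modulo [s']; for each [i] every residue occurs [s] times. The exponent [i * (s' - 1)] stands for
    [- i]. *)
Lemma sum_pairs (g : k -> nat) al be : (forall z, g (xi * z) = g z) ->
  (\sum_(i < sb * sb) g (al * xi ^+ (mxtens_unindex i).1 + be * xi ^+ (mxtens_unindex i).2)%R =
   sb * (s * \sum_(l < s') g (al + be * xi ^+ l)%R))%N.
Proof.
move=> gx; have gX e z : g (xi ^+ e * z) = g z.
  by elim: e => [|e IH]; rewrite ?expr0 ?mul1r // exprS -mulrA gx.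
pose h l := g (al + be * xi ^+ l).
have hp l : h (l + s')%N = h l by rewrite /h exprD (prim_expr_order xi_prim) mulr1.
have hc i j : g (al * xi ^+ i + be * xi ^+ j) = h (j + i * (s' - 1))%N.
  rewrite /h -[RHS](gX i); congr g; rewrite mulrDr mulrC; congr (_ + _).
  rewrite mulrCA -exprD; congr (_ * _).
  have -> : (i + (j + i * (s' - 1)) = i * s' + j)%N.
    by rewrite addnCA -mulnS subn1 prednK ?s'_pos // addnC.
  by rewrite exprD mulnC exprM (prim_expr_order xi_prim) expr1n mul1r.
rewrite (reindex (fun u : 'I_sb * 'I_sb => mxtens_index u)); last first.
  by exists (@mxtens_unindex _ _) => u _; [apply: mxtens_indexK | apply: mxtens_unindexK].
rewrite (eq_bigr (fun u : 'I_sb * 'I_sb => h (u.2 + u.1 * (s' - 1)))%N); last first.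
  by move=> u _; rewrite (mxtens_indexK u) hc.
rewrite -(pair_bigA _ (fun i j : 'I_sb => h (j + i * (s' - 1))%N)) /=.
have hsb l : h (l + sb)%N = h l.
  by rewrite sbE; elim: (s) => [|e IH]; rewrite ?mul0n ?addn0 // mulSn addnCA addnC hp.
rewrite (eq_bigr (fun _ => (s * \sum_(l < s') h l)%N)); last first.
  by move=> i _; rewrite (sum_periodic_shift _ _ hsb) sbE (sum_periodic_mul _ hp).
by rewrite sum_nat_const card_ord.
Qed.

Lemma rank_intertw d (W X D : 'M[k]_d) : W \in unitmx -> W *m X = D *m W -> \rank X = \rank D.
Proof. by move=> uW H; rewrite -(rank_mul_unitl _ uW) H rank_mul_unitr. Qed.

Lemma diag_exp d (u : 'rV[k]_d) e : diag_mx u ^+ e = diag_mx (\row_i u 0 i ^+ e).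
Proof.
elim: e => [|e IH]; first by apply/matrixP=> i j; rewrite !mxE expr0.
rewrite exprS IH -mulmxE mulmx_diag; congr diag_mx; apply/matrixP=> i j.
by rewrite !mxE exprS.
Qed.

Lemma CC_tot al be ga n : al != 0 -> be != 0 -> ga != 0 ->
  tot ga n (Cyc eps (al ^+ s') ** Cyc eps (be ^+ s')) =
  (sb * (s * \sum_(l < s') (((al + be * xi ^+ l) ^+ s' - ga) ^+ n != 0)%R))%N.
Proof.
move=> al0 be0 g0; have [W [uW WX]] := CC_diagonalize al0 be0.
have H := intertw_exp s' WX; rewrite -expr_sb diag_exp in H.
rewrite -(@sum_pairs (fun z => nat_of_bool ((z ^+ s' - ga) ^+ n != 0))); last first.
  by move=> z; rewrite exprMn (prim_expr_order xi_prim) mul1r.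
rewrite /tot /Tgm (negPf g0); set X := hx _ in H *.
have HT : W *m (X ^+ sb - ga%:M) = diag_mx (\row_i ((al * xi ^+ (mxtens_unindex i).1 +
    be * xi ^+ (mxtens_unindex i).2) ^+ s' - ga)) *m W.
  rewrite mulmxBr H mul_mx_scalar -mul_scalar_mx -mulmxBl; congr (_ *m _).
  by apply/matrixP=> i j; rewrite !mxE -mulrnBl.
have HTn := intertw_exp n HT; rewrite diag_exp in HTn.
rewrite (rank_intertw uW HTn) rank_diag; apply: eq_bigr => i _.
by rewrite !mxE.
Qed.

Lemma CC_rank_s al be e : al != 0 -> be != 0 -> (0 < e)%N ->
  \rank (hx (Cyc eps (al ^+ s') ** Cyc eps (be ^+ s')) ^+ (s * e)) =
  (sb * (s * \sum_(l < s') (al + be * xi ^+ l != 0)%R))%N.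
Proof.
move=> al0 be0 e0; have [W [uW WX]] := CC_diagonalize al0 be0.
rewrite exprM (rank_intertw uW (intertw_exp e WX)) diag_exp rank_diag.
rewrite -(@sum_pairs (fun z => nat_of_bool (z != 0))); last first.
  by move=> z; rewrite mulf_eq0 (negPf xi_neq0).
by apply: eq_bigr => i _; rewrite !mxE expf_eq0 e0.
Qed.

Lemma add_xi_neq0 al be l : xclass xi be <> xclass xi (- al) -> al + be * xi ^+ l != 0.
Proof.
move=> ne; apply/eqP => E; apply: ne; have {E} E : - al = xi ^+ l * be.
  by apply/esym/eqP; rewrite -subr_eq0 opprK addrC mulrC; apply/eqP.
rewrite E; apply/seteqP; split=> z [i ->].
  exists (i + l * (s' - 1))%N; rewrite mulrA -exprD; congr (_ * _).
  have -> : (i + l * (s' - 1) + l = i + s' * l)%N.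
    by rewrite -addnA addnC -mulnSr subn1 prednK ?s'_pos // mulnC addnC.
  by rewrite exprD exprM (prim_expr_order xi_prim) expr1n mulr1.
by exists (i + l)%N; rewrite mulrA -exprD.
Qed.

Lemma CC_unit al be : al != 0 -> be != 0 -> xclass xi be <> xclass xi (- al) ->
  hx (Cyc eps (al ^+ s') ** Cyc eps (be ^+ s')) \in unitmx.
Proof.
move=> al0 be0 ne; apply: (unitmx_expV s_pos).
rewrite -row_full_unit /row_full -[s in X in \rank X]muln1 CC_rank_s // (eq_bigr (fun _ => 1%N)); last first.
  by move=> l _; rewrite add_xi_neq0.
by rewrite sum_nat_const card_ord muln1 -sbE.
Qed.

Lemma Posz_sum n (F : 'I_n -> nat) : ((\sum_(i < n) F i)%N)%:Z = \sum_(i < n) (F i)%:Z.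
Proof. by rewrite -natz natr_sum; apply: eq_bigr => i _; rewrite natz. Qed.

Lemma tot_Cyc be ga n : be != 0 -> tot ga n (Cyc eps be) = (sb * ((be - ga) ^+ n != 0)%R)%N.
Proof.
move=> b0; rewrite (tot_scalar _ _ b0 (Cyc_hx_sb _ _)) expf_eq0 subr_eq0 andbC eq_sym.
by case: (_ && _); rewrite ?muln0 ?muln1.
Qed.

(** Both sides are compared through total ranks. Nonopposite classes make all eigenvalues of
    [x ^+ s] nonzero, so at [ga = 0] everything is invertible and dimensions decide. *)
Lemma green_J4 al be : al != 0 -> be != 0 -> xclass xi be <> xclass xi (- al) ->
  greenEq chi [:: (1, Cyc eps (al ^+ s') ** Cyc eps (be ^+ s'))]
    [seq (s%:Z, Cyc eps ((al + be * xi ^+ i) ^+ s')) | i <- iota 0 s'].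
Proof.
move=> al0 be0 ne.
have wa : wmod (Cyc eps (al ^+ s')) := Cyc_wmod _ wmod_eps.
have wb : wmod (Cyc eps (be ^+ s')) := Cyc_wmod _ wmod_eps.
apply: HG_green; first by apply/valid1/wmod_tens.
- by move=> t Ht; have [i _ ->] := List_In_map Ht; apply: Cyc_wmod wmod_eps.
- by move=> t [<-|[]]; apply: HG_Cyc_tens => //; [rewrite expf_neq0 | apply: orbital_Cyc].
- by move=> t Ht; have [i _ ->] := List_In_map Ht; apply: HG_Cyc; rewrite expf_neq0 // add_xi_neq0.
move=> ga n; rewrite lin_cons lin_nil addr0 mul1r /lin big_map -[in iota 0 s'](subn0 s') big_mkord.
have tC i : tot ga n (Cyc eps ((al + be * xi ^+ i) ^+ s')) =
   (sb * (((al + be * xi ^+ i) ^+ s' - ga) ^+ n != 0)%R)%N.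
  by apply: tot_Cyc; rewrite expf_neq0 ?add_xi_neq0.
have [g0|g0] := eqVneq ga 0.
  have u : Tg 0 (hx (Cyc eps (al ^+ s') ** Cyc eps (be ^+ s'))) \in unitmx by rewrite /Tgm eqxx CC_unit.
  rewrite g0 in tC *; rewrite (Tg_exp_unit _ u) (eq_bigr (fun _ => (s * sb)%:Z)) => [|i _]; last first.
    by rewrite /= tC subr0 !expf_neq0 ?add_xi_neq0 // muln1 PoszM.
  by rewrite sumr_const card_ord -mulr_natl natz -PoszM; congr Posz; rewrite /= {1}sbE; ring.
rewrite CC_tot //= !PoszM Posz_sum !mulr_sumr; apply: eq_bigr => i _.
by rewrite tC PoszM mulrCA.
Qed.

Lemma lin_one (T : Type) (phi : T -> int) x : lin phi [:: (1, x)] = phi x.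
Proof. by rewrite lin_cons lin_nil addr0 mul1r. Qed.

(** Every further factor [X] lowers the rank by at most [c]. If the rank has dropped by [m * c]
    after [m] steps, each step must have dropped it by exactly [c]. *)
Lemma rank_pow_line d (X : 'M[k]_d) c m : (d <= \rank X + c)%N -> (\rank (X ^+ m) + m * c <= d)%N ->
  forall n, (n <= m)%N -> (\rank (X ^+ n) + n * c = d)%N.
Proof.
move=> rX rm; have step n : (\rank (X ^+ n) <= \rank (X ^+ n.+1) + c)%N.
  have := mxrank_mul_min (X ^+ n) X; rewrite mulmxE -exprSr.
  rewrite leq_subLR => H; rewrite -(leq_add2r (\rank X)); apply: (leq_trans H).
  by rewrite addnC -addnA leq_add2l addnC.
have steps n e : (\rank (X ^+ n) <= \rank (X ^+ (n + e)) + e * c)%N.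
  elim: e => [|e IH]; first by rewrite addn0 mul0n addn0.
  by apply: (leq_trans IH); rewrite addnS mulSn addnA leq_add2r.
move=> n nm; apply/eqP; rewrite eqn_leq; apply/andP; split.
  apply: leq_trans rm; have := steps n (m - n)%N; rewrite subnKC //.
  move=> H; have -> : (m * c = (m - n) * c + n * c)%N by rewrite -mulnDl subnK.
  by rewrite addnA leq_add2r.
by have := steps 0%N n; rewrite expr0 mxrank1 add0n.
Qed.

(** The projection killing the last basis vector, equal to the product of the transposed shift with
    the shift. *)
Definition Pim n : 'M[k]_n := diag_mx (\row_(j < n) (j.+1 < n)%N%:R).

Lemma Pim_dc n c : (c < n)%N -> Pim n *m dc k n c = (c.+1 < n)%N%:R *: dc k n c.
Proof.
move=> cn; apply/matrixP=> i j; rewrite mul_diag_mx !mxE.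
by have [->|] := eqVneq (i : nat) c; rewrite // !mulr0.
Qed.

Lemma trJm_Jm n : (Jm k n)^T *m Jm k n = Pim n.
Proof.
apply/matrixP=> i j; rewrite !mxE; have [lt|ge] := ltnP i.+1 n.
  rewrite (bigD1 (Ordinal lt)) //= big1 => [|l ne]; last first.
    by rewrite !mxE (_ : (l == i.+1 :> nat) = false) ?mul0r //; apply: contraNF ne => /eqP E; apply/eqP/val_inj.
  by rewrite !mxE eqxx mul1r addr0 /= eqSS.
rewrite big1 => [|l _]; first by rewrite mul0rn.
by rewrite !mxE (ltn_eqF (leq_trans (ltn_ord l) ge)) mul0r.
Qed.

Lemma sum_Pim n : (\sum_(j < n) (j.+1 < n)%N = n.-1)%N.
Proof.
case: n => [|n]; first by rewrite big_ord0.
rewrite big_ord_recr /= ltnn addn0 (eq_bigr (fun _ => 1%N)) => [|i _]; last by rewrite ltnS ltn_ord.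
by rewrite sum_nat_const card_ord muln1.
Qed.

Lemma rank_Pim n : \rank (Pim n) = n.-1.
Proof.
rewrite rank_diag -sum_Pim; apply: eq_bigr => j _; rewrite mxE.
by case: (j.+1 < n)%N; rewrite ?oner_eq0 ?eqxx.
Qed.

Lemma rank_Pim_tens m n : \rank (1%:M *t Pim n : 'M[k]_(m * n)) = (m * n.-1)%N.
Proof.
rewrite -diag_const_mx tens_diag rank_diag.
rewrite (reindex (fun u : 'I_m * 'I_n => mxtens_index u)); last first.
  by exists (@mxtens_unindex _ _) => u _; [apply: mxtens_indexK | apply: mxtens_unindexK].
rewrite (eq_bigr (fun u : 'I_m * 'I_n => (u.2.+1 < n)%N : nat)); last first.
  move=> u _; rewrite !mxE (mxtens_indexK u) mul1r.
  by case: (u.2.+1 < n)%N; rewrite ?oner_eq0 ?eqxx.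
rewrite -(pair_bigA _ (fun (i : 'I_m) (j : 'I_n) => (j.+1 < n)%N : nat)) /= sum_nat_const card_ord.
by rewrite sum_Pim.
Qed.

Lemma qcomm_nilp d (A J : 'M[k]_d) c n : J *m A = c *: (A *m J) -> J ^+ n = 0 ->
  (A *m J) ^+ n = 0.
Proof.
move=> H Jn; have JX e : J ^+ e *m A = c ^+ e *: (A *m J ^+ e).
  elim: e => [|e IH]; first by rewrite !expr0 scale1r mulmx1 mul1mx.
  rewrite exprS -!mulmxE -mulmxA IH -scalemxAr !mulmxA H -!scalemxAl scalerA.
  by rewrite exprSr.
have main e : exists B : 'M[k]_d, (A *m J) ^+ e = B *m J ^+ e.
  elim: e => [|e [B IH]]; first by exists 1%:M; rewrite !expr0 mulmx1.
  exists (c ^+ e *: (B *m A)); rewrite exprSr IH -mulmxE -scalemxAl mulmxA -(mulmxA B) JX.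
  by rewrite -scalemxAr -scalemxAl -!mulmxA mulmxE -exprSr.
by have [B ->] := main n; rewrite Jn mulmx0.
Qed.

(* [(1 *t J^T) x (1 *t Pim)] is [(1 + x *t (J^T A)) (1 *t Pim)], whose first factor
   is unipotent. *)
Lemma CC_rank_ge b1 b2 : b1 != 0 -> b2 != 0 ->
  (sb * sb <= \rank (hx (Cyc eps b1 ** Cyc eps b2)) + sb)%N.
Proof.
move=> b10 b20; pose A := hg (Cyc eps b2) a; pose J := Jm k sb.
have JA : (J^T *m A) ^+ sb = 0.
  have AT : A^T = A by rewrite /A /= tr_diag_mx.
  have wV := Vt_wmod chi_char sb wmod_eps.
  have H : J *m A = p^-1 *: (A *m J).
    have hA : hg (Vt chi sb eps) a = A := @Vt_diag _ _ chi sb eps a.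
    by have := hx_hg a wV; rewrite hA Vt_hx.
  have N := qcomm_nilp H (JmX0 k (leqnn sb)).
  have trX e (B : 'M[k]_sb) : (B ^+ e)^T = B^T ^+ e.
    by elim: e => [|e IH]; rewrite ?expr0 ?trmx1 // exprS trmx_mul IH mulmxE -exprSr.
  by rewrite -[A in J^T *m A]AT -trmx_mul -trX N trmx0.
have JXP : J^T *m hx (Cyc eps b2) *m Pim sb = Pim sb.
  rewrite -mulmxA -[RHS]trJm_Jm; congr (_ *m _).
  apply: dc_ext => c cs; rewrite -!mulmxA Pim_dc // -!scalemxAr; have [c1|c1] := ltnP c.+1 sb.
    by rewrite Cyc_dc (ltn_eqF c1) mul0r scale0r addr0 scale1r Jm_dc.
  by rewrite scale0r Jm_dc dc0.
pose L : 'M[k]_(sb * sb) := 1%:M *t J^T; pose R : 'M[k]_(sb * sb) := 1%:M *t Pim sb.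
have LXR : L *m hx (Cyc eps b1 ** Cyc eps b2) *m R = (hx (Cyc eps b1) *t (J^T *m A) + 1%:M) *m R.
  rewrite [hx (_ ** _)]/(hx (Cyc eps b1) *t A + 1%:M *t hx (Cyc eps b2)).
  rewrite mulmxDr !mulmxDl !tensmx_mul !mul1mx !mulmx1 JXP; reflexivity.
have u : hx (Cyc eps b1) *t (J^T *m A) + 1%:M \in unitmx.
  by apply: (@unitmx_shift_nilp _ _ _ sb); rewrite ?oner_neq0 // tensX JA tensmx0.
have : (\rank R <= \rank (hx (Cyc eps b1 ** Cyc eps b2)))%N.
  rewrite -(rank_mul_unitl R u) -LXR; apply: leq_trans (mxrankM_maxl _ _) _.
  exact: mxrankM_maxr.
rewrite rank_Pim_tens => H; rewrite -(leq_add2r sb) in H; apply: leq_trans H.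
by rewrite addnC -mulnS prednK ?sb_pos.
Qed.

Lemma sum_xi_neq1 al : al != 0 -> (\sum_(l < s') (al + - al * xi ^+ l != 0)%R = s' - 1)%N.
Proof.
move=> al0; have := s'_pos; case E : s' => [//|n] _.
rewrite big_ord_recl /= expr0 mulr1 subrr eqxx add0n subn1 /=.
rewrite (eq_bigr (fun _ => 1%N)) => [|i _]; first by rewrite sum_nat_const card_ord muln1.
rewrite mulNr subr_eq0 -{1}[al]mulr1 (inj_eq (mulfI al0)) /bump /= add1n.
suff -> : (1 == xi ^+ i.+1) = false by [].
rewrite eq_sym -(prim_order_dvd xi_prim) E.
by apply/negP => /(dvdn_leq (ltn0Sn i)); rewrite leqNgt ltnS ltn_ord.
Qed.

(** Diagonalization gives the rank of [x ^+ (s * e)] for every positive [e], but not of the powers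
    in between. Since [x] itself lowers the rank by at most [sb], the first [s] powers each lower it
    by exactly [sb]; afterwards the rank is constant. The nilpotent part thus has [sb] Jordan
    blocks, all of size [s]. *)
Lemma J5_tot0 al n : al != 0 ->
  (tot 0 n (Cyc eps (al ^+ s') ** Cyc eps ((- al) ^+ s')) + minn n s * sb = sb * sb)%N.
Proof.
move=> al0; have nal0 : - al != 0 by rewrite oppr_eq0.
set X := hx (Cyc eps (al ^+ s') ** Cyc eps ((- al) ^+ s')).
have rE e : (0 < e)%N -> (\rank (X ^+ (s * e)) + s * sb = sb * sb)%N.
  move=> e0; rewrite CC_rank_s // sum_xi_neq1 // [(s * sb)%N]mulnC -mulnDr; congr (_ * _)%N.
  by rewrite -mulnSr subn1 prednK ?s'_pos // -sbE.
have rX : (sb * sb <= \rank X + sb)%N by apply: CC_rank_ge; rewrite expf_neq0.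
have rs : (\rank (X ^+ s) + s * sb <= sb * sb)%N by rewrite -(rE 1%N) // muln1.
rewrite /tot /Tgm eqxx -/X; have [ns|sn] := leqP n s.
  exact: (rank_pow_line rX rs).
apply/eqP; rewrite eqn_leq; apply/andP; split.
  rewrite -[X in (_ <= X)%N](rE 1%N) // muln1 leq_add2r.
  by rewrite -(subnK (ltnW sn)) exprD; apply: mxrankM_maxr.
rewrite -[X in (X <= _)%N](rE n) ?(leq_trans s_pos (ltnW sn)) // leq_add2r.
have ge : (n <= s * n)%N by rewrite leq_pmull ?s_pos.
by rewrite -(subnK ge) exprD; apply: mxrankM_maxr.
Qed.

(** At the eigenvalue zero either the classes are not opposite and [x] is invertible on both
    products, or both orders have the ranks of [J5_tot0], with [al] and [- al] exchanged. *)
Lemma green_Cyc_comm b1 b2 : b1 != 0 -> b2 != 0 ->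
  greenEq chi [:: (1, Cyc eps b1 ** Cyc eps b2)] [:: (1, Cyc eps b2 ** Cyc eps b1)].
Proof.
have root c : exists r : k, r ^+ s' = c.
  have [|r] := @closed_rootP k ('X^s' - c%:P) _; first by rewrite size_XnsubC ?s'_pos // eqSS -lt0n s'_pos.
  by rewrite /root !hornerE subr_eq0 => /eqP; exists r.
have [al <-] := root b1; have [be <-] := root b2.
rewrite !expf_eq0 s'_pos /= => al0 be0.
have wa : wmod (Cyc eps (al ^+ s')) := Cyc_wmod _ wmod_eps.
have wb : wmod (Cyc eps (be ^+ s')) := Cyc_wmod _ wmod_eps.
have aa := as1_Cyc (al ^+ s'); have ab := as1_Cyc (be ^+ s').
apply: HG_green; [by apply/valid1/wmod_tens|by apply/valid1/wmod_tens| | |].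
- by move=> t [<-|[]]; apply: HG_Cyc_tens => //; [rewrite expf_neq0 | apply: orbital_Cyc].
- by move=> t [<-|[]]; apply: HG_Cyc_tens => //; [rewrite expf_neq0 | apply: orbital_Cyc].
move=> ga n; rewrite !lin_one; apply: (congr1 Posz).
have [g0|g0] := eqVneq ga 0; last by rewrite tot_swap.
have [E|ne] := pselect (xclass xi be = xclass xi (- al)); last first.
  have u := CC_unit al0 be0 ne.
  have u' := hx_swap_unit wa wb aa ab u.
  by rewrite g0 !Tg_exp_unit ?/Tgm ?eqxx.
have -> : be ^+ s' = (- al) ^+ s'.
  have [i ->] : xclass xi (- al) be by rewrite -E; exists 0%N; rewrite expr0 mul1r.
  by rewrite exprMn -exprM mulnC exprM (prim_expr_order xi_prim) expr1n mul1r.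
have nal0 : - al != 0 by rewrite oppr_eq0.
have H1 := J5_tot0 n al0; have := J5_tot0 n nal0; rewrite opprK g0 => H2.
exact: (@addIn (minn n s * sb)) (etrans H1 (esym H2)).
Qed.

(** A twist moves the weights, so a full period of twists runs once through all weights of the
    orbit. This handles a sum over [V_s(chi^i)] whose single terms admit no shift operator. *)
Lemma sum_twists M ga n mu : wmod M -> orbital M ->
  (\sum_(i < sb) rho sb ga n mu (twist M (chr_pow chi i)))%N =
  if `[< exists c, mu = chr_pow chi c >] then tot ga n M else 0%N.
Proof.
move=> wM [w dM wc]; pose wt i := fun j => chr_mul (chr_pow chi i) (w j).
have dT i : @is_diag k G (twist M (chr_pow chi i)) (wt i).
  by move=> g; rewrite /= dM; apply/matrixP=> r c; rewrite !mxE mulrnAr.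
rewrite (eq_bigr (fun i : 'I_sb => \rank (Tg ga (hx M) ^+ n *m pw (wt i) mu))); last first.
  by move=> i _; rewrite (rhoE sb ga n mu (dT i)).
case: asboolP => [[c ->]|nc]; last first.
  rewrite big1 // => i _; have -> : pw (wt i) mu = 0; last by rewrite mulmx0 mxrank0.
  apply/matrixP=> u v; rewrite !mxE asboolF ?mul0rn // => E; apply: nc.
  by have [d wd] := wc u; exists (i + d)%N; rewrite -E /wt wd chr_powD.
rewrite -(rank_sum_pw ga n wM dM wc).
pose F l := \rank (Tg ga (hx M) ^+ n *m pw w (chr_pow chi l)).
have Fp l : F (l + sb)%N = F l by rewrite /F (chr_pow_mod chi_ord) modnDr -(chr_pow_mod chi_ord).
(* The twist of exponent [sb - i.+1] is matched with the weight of exponent [i + c.+1]; reversing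
   the order of summation avoids negative exponents. *)
rewrite -(sum_periodic_shift _ c.+1 Fp) (reindex_inj rev_ord_inj) /=; apply: eq_bigr => i _.
congr (\rank (_ *m _)); rewrite /pw; congr diag_mx; apply/matrixP=> u j; rewrite !mxE.
have K : chr_mul (chr_pow chi (sb - i.+1)) (chr_pow chi (i + c.+1)) = chr_pow chi c.
  rewrite -chr_powD (chr_pow_mod chi_ord) [RHS](chr_pow_mod chi_ord); congr (chr_pow chi _).
  have -> : (sb - i.+1 + (i + c.+1) = c + sb)%N by have := ltn_ord i; clear; lia.
  by rewrite modnDr.
congr (nat_of_bool _)%:R; apply: asbool_equiv_eq; rewrite /wt; split=> [E|->].
  apply: (chr_mulI (la := chr_pow chi (sb - i.+1)%N)); first exact: char_pow.
  by rewrite E K.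
exact: K.
Qed.

Lemma sum_topinv_Vt n b : (0 < b.2)%N ->
  \sum_(i < sb) topinv sb b (Vt chi n (chr_pow chi i)) =
  in_orbit b.1.1 * ((tot b.1.2 b.2.-1 (Vt chi n eps))%:Z - (tot b.1.2 b.2 (Vt chi n eps))%:Z).
Proof.
move=> b0; have wV := Vt_wmod chi_char n wmod_eps.
have E i ga m mu : rho sb ga m mu (Vt chi n (chr_pow chi i)) =
                   rho sb ga m mu (twist (Vt chi n eps) (chr_pow chi i)).
  have H : hiso (twist (Vt chi n eps) (chr_pow chi i)) (Vt chi n (chr_pow chi i)).
    by have := twist_Vt n (chr_pow chi i) eps; rewrite chr_mulr1.
  have wVi := Vt_wmod chi_char n (char_pow i chi_char).
  have wT := wmod_iso wVi (hiso_sym H); apply/esym; exact: (rho_iso _ _ _ _ wT H).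
rewrite /topinv /iotam sumrB -!Posz_sum prednK //.
rewrite !(eq_bigr _ (fun (i : 'I_sb) _ => E i _ _ _)) !sum_twists //; try exact: orbital_Vt.
by rewrite /in_orbit /indic; case: asboolP => _; rewrite ?mul1r // mul0r subrr.
Qed.

Lemma tot_Vt n e : (n <= s)%N -> (tot 0 e (Vt chi n eps) + minn e n = n)%N.
Proof.
move=> ns; rewrite /tot /Tgm eqxx Vt_hx.
have J0 : \rank (Jm k n ^+ n) = 0%N by rewrite JmX0 // mxrank0.
have [le|gt] := leqP e n; last by rewrite JmX0 ?mxrank0 // ltnW.
have rJ : (n <= \rank (Jm k n) + 1)%N.
  have : (\rank (Pim n) <= \rank (Jm k n))%N by rewrite -trJm_Jm mxrankM_maxr.
  rewrite rank_Pim -(leq_add2r 1); apply: leq_trans; rewrite addn1; exact: leqSpred.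
have rn : (\rank (Jm k n ^+ n) + n * 1 <= n)%N by rewrite J0 muln1.
by rewrite -[in RHS](rank_pow_line rJ rn le) muln1.
Qed.

Lemma tot_Vt_neq0 n ga e : (n <= sb)%N -> ga != 0 -> tot ga e (Vt chi n eps) = n.
Proof.
move=> ns g0; rewrite Tg_exp_unit // /Tgm (negPf g0) Vt_hx JmX0 // sub0r -raddfN /=.
by rewrite unitmxE det_scalar unitfE expf_neq0 // oppr_eq0.
Qed.

(** The nilpotent summands rule out a comparison of total ranks term by term, so [topinv] is
    evaluated directly, after multiplication by [sb]. At [ga = 0] the cyclic summands contribute
    nothing and the nilpotent ones account for [J5_tot0]; at nonzero [ga] the roles are
    exchanged. *)
Lemma green_J5 al : al != 0 ->
  greenEq chi [:: (1, Cyc eps (al ^+ s') ** Cyc eps ((- al) ^+ s'))]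
    ([seq (s%:Z, Cyc eps (((1 - xi ^+ i) * al) ^+ s')) | i <- iota 1 (s' - 1)] ++
     [seq (1, Vt chi s (chr_pow chi i)) | i <- iota 0 sb]).
Proof.
move=> al0; have nal0 : - al != 0 by rewrite oppr_eq0.
have wa : wmod (Cyc eps (al ^+ s')) := Cyc_wmod _ wmod_eps.
have wb : wmod (Cyc eps ((- al) ^+ s')) := Cyc_wmod _ wmod_eps.
have wM := wmod_tens a_central wa wb.
have hM : HG (Cyc eps (al ^+ s') ** Cyc eps ((- al) ^+ s')).
  by apply: HG_Cyc_tens => //; [rewrite expf_neq0 | apply: orbital_Cyc].
have n0 i : (0 < i < s')%N -> (1 - xi ^+ i) * al != 0.
  move=> /andP[i0 is']; rewrite mulf_neq0 // subr_eq0 eq_sym -(prim_order_dvd xi_prim).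
  by apply/negP => /(dvdn_leq i0); rewrite leqNgt is'.
apply: (green_of_topinv sb_pos chi_ord chi_char); first exact: valid1.
  move=> t /List_In_cat [] Ht; have [i _ ->] := List_In_map Ht; first exact: Cyc_wmod wmod_eps.
  exact: Vt_wmod (char_pow _ _).
move=> b [_ b0 _]; have sb0 : sb%:Z != 0 by rewrite eqz_nat -lt0n sb_pos.
apply: (mulfI sb0); rewrite lin_one lin_cat (HG_topinv wM hM b0) [RHS]mulrDr.
set o := in_orbit b.1.1; set ga := b.1.2; pose h e (i : nat) := (((((1 - xi ^+ i) * al) ^+ s' - ga) ^+ e != 0)%R : nat)%:Z.
have -> : lin (topinv sb b) [seq (1, Vt chi s (chr_pow chi i)) | i <- iota 0 sb] =
    o * ((tot ga b.2.-1 (Vt chi s eps))%:Z - (tot ga b.2 (Vt chi s eps))%:Z).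
  rewrite -sum_topinv_Vt // /lin big_map -[in iota 0 sb](subn0 sb) big_mkord.
  by apply: eq_bigr => i _; rewrite mul1r.
have -> : sb%:Z * lin (topinv sb b) [seq (s%:Z, Cyc eps (((1 - xi ^+ i) * al) ^+ s')) | i <- iota 1 (s' - 1)] =
   o * (sb%:Z * (s%:Z * (\sum_(1 <= i < s') h b.2.-1 i - \sum_(1 <= i < s') h b.2 i))).
  rewrite /lin big_map -/(index_iota 1 s') -sumrB !mulr_sumr; apply: eq_big_nat => i i0.
  have C0 : ((1 - xi ^+ i) * al) ^+ s' != 0 by rewrite expf_neq0 // n0.
  have wC := Cyc_wmod (((1 - xi ^+ i) * al) ^+ s') wmod_eps.
  have H := HG_topinv wC (HG_Cyc C0) b0.
  rewrite [LHS]mulrCA H !(tot_Cyc _ _ C0) !PoszM -/o -/ga -/(h _ i).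
  by rewrite /h; ring.
have [g0|g0] := eqVneq ga 0.
  rewrite g0; have h1 e i : (0 < i < s')%N -> h e i = 1.
    by move=> i0; rewrite /h g0 subr0 !expf_neq0 ?n0.
  rewrite !(eq_big_nat _ _ (h1 _)) subrr !mulr0 add0r mulrCA; congr (o * _).
  have := J5_tot0 b.2.-1 al0; have := J5_tot0 b.2 al0.
  have := tot_Vt b.2.-1 (leqnn s); have := tot_Vt b.2 (leqnn s).
  set t1 := tot _ _ _; set t2 := tot _ _ _; set t3 := tot _ _ _; set t4 := tot _ _ _.
  set m1 := minn _ _; set m2 := minn _ _; move: t1 t2 t3 t4 m1 m2 => t1 t2 t3 t4 m1 m2.
  move=> E1 E2 E3 E4.
  have /= F1 : (t1%:Z = s%:Z - m1%:Z) by lia.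
  have F2 : (t2%:Z = s%:Z - m2%:Z) by lia.
  have F3 : (t3%:Z = sb%:Z * sb%:Z - m1%:Z * sb%:Z) by rewrite -!PoszM -E3; lia.
  have F4 : (t4%:Z = sb%:Z * sb%:Z - m2%:Z * sb%:Z) by rewrite -!PoszM -E4; lia.
  by rewrite F1 F2 F3 F4; ring.
have ssb : (s <= sb)%N by rewrite sbE leq_pmulr ?s'_pos.
rewrite !tot_Vt_neq0 // subrr !mulr0 addr0; congr (o * _).
have T e : (tot ga e (Cyc eps (al ^+ s') ** Cyc eps ((- al) ^+ s')))%:Z =
   sb%:Z * (s%:Z * (1 + \sum_(1 <= i < s') h e i)).
  rewrite CC_tot // !PoszM Posz_sum; do 2 congr (_ * _).
  rewrite -(big_mkord xpredT (fun i => ((((al + - al * xi ^+ i) ^+ s' - ga) ^+ e != 0)%R : nat)%:Z)).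
  (* The term [i = 0] corresponds to the eigenvalue 0 of [x ^+ s]; it contributes the constant 1,
     which disappears in the difference of consecutive ranks. *)
  rewrite big_ltn ?s'_pos //; congr (_ + _); last first.
    by apply: eq_bigr => i _; rewrite /h; congr (nat_of_bool ((_ ^+ _ - _) ^+ _ != _))%:Z; ring.
  by rewrite expr0 mulr1 subrr expr0n gtn_eqF ?s'_pos //= sub0r expf_neq0 // oppr_eq0.
by rewrite !T; ring.
Qed.

(** ** Words in the generators *)

Lemma functional_tensl M phi : wmod M -> functional chi phi -> functional chi (fun N => phi (M ** N)).
Proof.
move=> wM [Hi Hd]; split=> [U V wU wV UV|U V wU wV].
  by apply: Hi; [exact: wmod_tens|exact: wmod_tens|apply: hiso_tens => //; apply: hiso_refl].
rewrite -Hd; [|exact: wmod_tens|exact: wmod_tens].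
apply: Hi; [|apply: wmod_dsum; exact: wmod_tens|exact: hiso_tens_dsumr].
by apply: wmod_tens => //; apply: wmod_dsum.
Qed.

Lemma functional_tensr M phi : wmod M -> functional chi phi -> functional chi (fun N => phi (N ** M)).
Proof.
move=> wM [Hi Hd]; split=> [U V wU wV UV|U V wU wV].
  by apply: Hi; [exact: wmod_tens|exact: wmod_tens|apply: hiso_tens => //; apply: hiso_refl].
rewrite -Hd; [|exact: wmod_tens|exact: wmod_tens].
apply: Hi; [|apply: wmod_dsum; exact: wmod_tens|exact: hiso_tens_dsuml].
by apply: wmod_tens => //; apply: wmod_dsum.
Qed.

(* [bt C] is [al ^+ s'] if [C] is the class of [al]; the value [1] is junk. *)
Definition bt (C : set k) : k := let r := xget 1 C in if r == 0 then 1 else r ^+ s'.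

Lemma bt_neq0 C : bt C != 0.
Proof.
rewrite /bt; move: (xget 1 C) => r /=; have [_|r0] := eqVneq r 0; first exact: oner_neq0.
exact: expf_neq0.
Qed.

Lemma bt_xclass al : al != 0 -> bt (xclass xi al) = al ^+ s'.
Proof.
move=> al0; rewrite /bt; have H : xclass xi al al by exists 0%N; rewrite expr0 mul1r.
have [i ->] := xgetPex 1 (ex_intro _ al H).
rewrite mulf_eq0 (negPf al0) expf_eq0 (negPf xi_neq0) andbF /= exprMn -exprM mulnC exprM.
by rewrite (prim_expr_order xi_prim) expr1n mul1r.
Qed.

Lemma act_xclass c al : ((fun b => c * b) @` (xclass xi al))%classic = xclass xi (c * al).
Proof.
apply/seteqP; split=> z; first by move=> [_ [i ->] <-]; exists i; rewrite mulrCA.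
by move=> [i ->]; exists (xi ^+ i * al); [exists i | rewrite mulrCA].
Qed.

Definition Vv (v : var k) : hmod k G :=
  match v with VY => Vt chi 2 eps | VZ => Vt chi s.+1 eps | VX C => Cyc eps (bt C) end.

Lemma Vv_wmod v : wmod (Vv v).
Proof. by case: v => [||C] /=; [apply: Vt_wmod|apply: Vt_wmod|apply: Cyc_wmod] => //; apply: wmod_eps. Qed.

Lemma as1_Vv v : as1 (Vv v).
Proof. by case: v => [||C]; [apply: as1_Vt|apply: as1_Vt|apply: as1_Cyc]. Qed.

Definition Wv (w : seq (var k)) : hmod k G := foldr (fun v M => Vv v ** M) (Vt chi 1 eps) w.

Lemma Wv_wmod w : wmod (Wv w).
Proof.
elim: w => [|v w IH]; first by apply: Vt_wmod => //; apply: wmod_eps.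
by apply: wmod_tens => //; apply: Vv_wmod.
Qed.

Lemma as1_Wv w : as1 (Wv w).
Proof. by elim: w => [|v w IH]; [apply: as1_Vt | apply: as1_tens => //; apply: as1_Vv]. Qed.

Lemma V1_wmod la : is_character la -> wmod (Vt chi 1 la).
Proof. exact: Vt_wmod. Qed.

Definition mon (x : (G -> k) * seq (var k)) : hmod k G := Vt chi 1 x.1 ** Wv x.2.

Lemma mon_wmod x : is_character x.1 -> wmod (mon x).
Proof. by move=> cx; apply: wmod_tens => //; [exact: V1_wmod | exact: Wv_wmod]. Qed.

(** Since [(la a ^+ s * al) ^+ s'] equals [la a ^+ sb * al ^+ s'], acting on classes by [la a ^+ s]
    reproduces the change of parameter in [Cyc_skew]; this is the origin of the exponent [s] in the
    skew action. *)
Lemma Vv_skew v la : is_character la -> valid_var xi v ->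
  hiso (Vv v ** Vt chi 1 la) (Vt chi 1 la ** Vv (var_act (la a ^+ s) v)).
Proof.
move=> cl; case: v => [||C] /=; [by move=> _; apply: Vt_skew|by move=> _; apply: Vt_skew|].
move=> [al [al0 ->]]; rewrite act_xclass !bt_xclass // ?mulf_neq0 ?expf_neq0 //; last by case: cl.
by rewrite exprMn -exprM -sbE; apply: Cyc_skew.
Qed.

Lemma hiso_swapl M N K : hiso (M ** N) (N ** M) -> hiso (M ** (N ** K)) (N ** (M ** K)).
Proof.
move=> H; apply: hiso_trans (hiso_sym (hiso_tensA a M N K)) _.
by apply: hiso_trans (hiso_tensA a N M K); apply: hiso_tens => //; apply: hiso_refl.
Qed.

Lemma one_tens M : hiso (Vt chi 1 eps ** M) M.
Proof. by apply: hiso_trans (tens_twist _ _) (twist_eps _). Qed.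

Lemma V1_mul la mu : hiso (Vt chi 1 la ** Vt chi 1 mu) (Vt chi 1 (chr_mul la mu)).
Proof. by apply: hiso_trans (tens_twist _ _) (twist_Vt _ _ _). Qed.

Lemma Wv_cat w w' : hiso (Wv w ** Wv w') (Wv (w ++ w')).
Proof.
elim: w => [|v w IH]; first exact: one_tens.
by apply: hiso_trans (hiso_tensA a _ _ _) _; apply: hiso_tens => //; apply: hiso_refl.
Qed.

Lemma Wv_skew w la : is_character la -> (forall v, List.In v w -> valid_var xi v) ->
  hiso (Wv w ** Vt chi 1 la) (Vt chi 1 la ** Wv (map (var_act (la a ^+ s)) w)).
Proof.
move=> cl; elim: w => [|v w IH] vw /=; first exact: Vt_skew.
apply: hiso_trans (hiso_tensA a _ _ _) _.
apply: (hiso_trans (N := Vv v ** (Vt chi 1 la ** Wv (map (var_act (la a ^+ s)) w)))).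
  by apply: hiso_tens; [apply: hiso_refl | apply: IH => u Hu; apply: vw; right].
apply: hiso_trans (hiso_sym (hiso_tensA a _ _ _)) _.
apply: hiso_trans (hiso_tensA a _ _ _); apply: hiso_tens; last exact: hiso_refl.
by apply: Vv_skew => //; apply: vw; left.
Qed.

Definition monmul (x y : (G -> k) * seq (var k)) :=
  (chr_mul x.1 y.1, map (var_act (y.1 a ^+ s)) x.2 ++ y.2).

Definition valid_mon (x : (G -> k) * seq (var k)) :=
  is_character x.1 /\ forall v, List.In v x.2 -> valid_var xi v.

Lemma mon_mul x y : valid_mon x -> valid_mon y -> hiso (mon x ** mon y) (mon (monmul x y)).
Proof.
case: x y => [la w] [mu w'] [cl vw] [cm vw'].
apply: hiso_trans (hiso_tensA a _ _ _) _.
apply: (hiso_trans (N := Vt chi 1 la ** (Vt chi 1 mu ** (Wv (map (var_act (mu a ^+ s)) w) ** Wv w')))).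
  apply: hiso_tens; first exact: hiso_refl.
  apply: hiso_trans (hiso_sym (hiso_tensA a _ _ _)) _.
  apply: hiso_trans (hiso_tensA a _ _ _); apply: hiso_tens; last exact: hiso_refl.
  exact: Wv_skew.
apply: hiso_trans (hiso_sym (hiso_tensA a _ _ _)) _.
by apply: hiso_tens; [exact: V1_mul | exact: Wv_cat].
Qed.

Lemma green_Vv_comm u v : greenEq chi [:: (1, Vv u ** Vv v)] [:: (1, Vv v ** Vv u)].
Proof.
have w2 : wmod (Vt chi 2 eps) := Vt_wmod chi_char 2 wmod_eps.
have wz : wmod (Vt chi s.+1 eps) := Vt_wmod chi_char s.+1 wmod_eps.
have yz : greenEq chi [:: (1, Vt chi 2 eps ** Vt chi s.+1 eps)] [:: (1, Vt chi s.+1 eps ** Vt chi 2 eps)].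
  have ns : ~~ (s %| s.+1)%N by rewrite -addn1 dvdn_addr // dvdn1; have := s_gt1; case: eqP => // ->.
  apply: green_iso; [exact: wmod_tens|exact: wmod_tens|].
  have [H _] := Vt2_tens wmod_eps (ltn0Sn s).
  exact: hiso_trans (H ns) (hiso_sym (tens_Vt2 (ltn0Sn s) ns)).
have yx C : greenEq chi [:: (1, Vt chi 2 eps ** Cyc eps (bt C))] [:: (1, Cyc eps (bt C) ** Vt chi 2 eps)].
  apply: green_trans (green_Vt2_Cyc (bt_neq0 C)) _.
  exact/green_sym/green_Cyc_Vt2/bt_neq0.
case: u v => [||C] [||D] /=; try exact: green_refl.
- exact: yz.
- exact: yx.
- exact: green_sym.
- apply/green_sym/green_Cyc_Vz; exact: bt_neq0.
- exact/green_sym/yx.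
- exact/green_Cyc_Vz/bt_neq0.
- by apply: green_Cyc_comm; apply: bt_neq0.
Qed.

Definition same_cnt (w w' : seq (var k)) := forall v, cnt w v = cnt w' v.

Lemma cnt_cat (w w' : seq (var k)) v : cnt (w ++ w') v = (cnt w v + cnt w' v)%N.
Proof. exact: count_cat. Qed.

Lemma cnt_cons u (w : seq (var k)) v : cnt (u :: w) v = (`[< u = v >] + cnt w v)%N.
Proof. by []. Qed.

Lemma same_cnt_nil w : same_cnt [::] w -> w = [::].
Proof. by case: w => // u w /(_ u); rewrite cnt_cons asboolT. Qed.

Lemma same_cnt_cons v w w' : same_cnt (v :: w) w' ->
  exists l r, w' = l ++ v :: r /\ same_cnt w (l ++ r).
Proof.
move=> H; have : (0 < cnt w' v)%N by rewrite -H cnt_cons asboolT.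
have splt : (0 < cnt w' v)%N -> exists l r, w' = l ++ v :: r.
  elim: w' {H} => [|u w' IH] //; rewrite cnt_cons; case: asboolP => [->|_] H.
    by exists [::], w'.
  by have [l [r ->]] := IH H; exists (u :: l), r.
move=> /splt [l [r E]]; exists l, r; split=> // u; have := H u.
by rewrite E !cnt_cat !cnt_cons addnCA => /eqP; rewrite eqn_add2l => /eqP ->.
Qed.

Lemma same_cnt_map (f : var k -> var k) w w' : same_cnt w w' -> same_cnt (map f w) (map f w').
Proof.
elim: w w' => [|v w IH] w' H; first by rewrite (same_cnt_nil H).
have [l [r [-> /IH H']]] := same_cnt_cons H.
by move=> u; rewrite map_cat /= cnt_cat !cnt_cons H' map_cat cnt_cat addnCA.
Qed.

(** Commutation of variables is available in the Green group, not always as an isomorphism of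
    modules. It is therefore applied inside a word through the functionals obtained by tensoring on
    either side. *)
Lemma functional_front phi l v r : functional chi phi ->
  phi (Wv (l ++ v :: r)) = phi (Wv (v :: l ++ r)).
Proof.
elim: l phi => // u l IH phi fphi.
have wW := Wv_wmod (l ++ r); have wu := Vv_wmod u; have wv := Vv_wmod v.
rewrite /= (IH _ (functional_tensl wu fphi)) /=.
have [fi _] := fphi; rewrite -(fi _ _ _ _ (hiso_tensA a (Vv u) (Vv v) _)); last first.
- by do 2 apply: wmod_tens => //.
- by do 2 apply: wmod_tens => //.
have := green_functional (green_Vv_comm u v) (functional_tensr wW fphi).
rewrite !lin_one => ->; apply: fi; [| |exact: hiso_tensA]; by do 2 apply: wmod_tens => //.
Qed.

Lemma functional_Wv phi w w' : functional chi phi -> same_cnt w w' -> phi (Wv w) = phi (Wv w').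
Proof.
elim: w w' phi => [|v w IH] w' phi fphi H; first by rewrite (same_cnt_nil H).
have [l [r [-> H']]] := same_cnt_cons H.
by rewrite functional_front //=; apply: (IH _ _ (functional_tensl (Vv_wmod v) fphi)).
Qed.

Lemma functional_mon phi la w w' : functional chi phi -> is_character la -> same_cnt w w' ->
  phi (mon (la, w)) = phi (mon (la, w')).
Proof.
move=> fphi cl; exact: functional_Wv (functional_tensl (V1_wmod cl) fphi).
Qed.

Definition invariant_mon (psi : (G -> k) * seq (var k) -> int) :=
  forall la w w', same_cnt w w' -> psi (la, w) = psi (la, w').

Lemma eqAP (f g : fskew k G) : eqA f g <-> forall psi, invariant_mon psi -> lin psi f = lin psi g.
Proof.
split=> [H psi ipsi|H l w].
  apply: (@lin_eq_group _ (fun x y => x.1 = y.1 /\ same_cnt x.2 y.2)).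
  - by [].
  - by move=> x y z [-> H1] [-> H2]; split=> // v; rewrite H1.
  - by move=> x y [-> H1]; split=> // v; rewrite H1.
  - move=> [l w]; have := H l w; rewrite /coefA => E.
    have bE (h : fskew k G) : \sum_(t <- h | `[< t.2.1 = (l, w).1 /\ same_cnt t.2.2 (l, w).2 >]) t.1 =
        \sum_(t <- h | `[< t.2.1 = l >] && `[< forall v, cnt t.2.2 v = cnt w v >]) t.1.
      apply: eq_bigl => t; apply/asboolP/andP => [[/= H1 H2]|[/asboolP H1 /asboolP H2]] //.
      by split; apply/asboolP.
    by rewrite !bE.
  by move=> [l1 w1] [l2 w2] /= [-> /ipsi].
have bE (h : fskew k G) : coefA h l w =
    lin (fun x => if `[< x.1 = l >] && `[< forall v, cnt x.2 v = cnt w v >] then 1 else 0) h.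
  by rewrite /coefA /lin big_mkcond; apply: eq_bigr => t _; case: ifP; rewrite ?mulr1 ?mulr0.
rewrite !bE; apply: H => la u u' uu /=; congr (if _ && _ then _ else _).
by apply: asbool_equiv_eq; split=> H v; rewrite -H uu.
Qed.

Definition Phi (f : fskew k G) : fsum k G := [seq (t.1, mon t.2) | t <- f].

Lemma Phi_valid f : valid_fskew xi f -> valid_fsum chi (Phi f).
Proof. by move=> vf t Ht; have [u /vf [cu _] ->] := List_In_map Ht; apply: mon_wmod. Qed.

Lemma lin_Phi phi f : lin phi (Phi f) = lin (phi \o mon) f.
Proof. exact: lin_map. Qed.

(** Extended by zero outside the characters: equality in the skew ring is tested on arbitrary
    functions on [G], whereas a functional is controlled on weight modules only. *)
Lemma invariant_phi_mon phi : functional chi phi ->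
  invariant_mon (fun x => if `[< is_character x.1 >] then phi (mon x) else 0).
Proof.
by move=> fphi la w w' ww /=; case: asboolP => // cl; apply: functional_mon.
Qed.

Lemma lin_Phi_inv phi f : valid_fskew xi f ->
  lin phi (Phi f) = lin (fun x => if `[< is_character x.1 >] then phi (mon x) else 0) f.
Proof.
move=> vf; rewrite lin_Phi; apply: eq_lin_In => t /vf [ct _]; by rewrite asboolT.
Qed.

Lemma green_Phi f g : valid_fskew xi f -> valid_fskew xi g ->
  (forall phi, functional chi phi -> lin phi (Phi f) = lin phi (Phi g)) ->
  greenEq chi (Phi f) (Phi g).
Proof.
move=> vf vg H; apply: (green_of_functionals sb_pos chi_ord chi_char) => //; exact: Phi_valid.
Qed.

Lemma Phi_eqA f g : valid_fskew xi f -> valid_fskew xi g -> eqA f g ->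
  greenEq chi (Phi f) (Phi g).
Proof.
move=> vf vg /eqAP E; apply: green_Phi => // phi fphi; rewrite !lin_Phi_inv //.
exact/E/invariant_phi_mon.
Qed.

Lemma act_valid c v : c != 0 -> valid_var xi v -> valid_var xi (var_act c v).
Proof.
case: v => [||C] //= c0 [al [al0 ->]]; exists (c * al); rewrite mulf_neq0 //.
by split=> //; apply: act_xclass.
Qed.

Lemma monmul_valid x y : valid_mon x -> valid_mon y -> valid_mon (monmul x y).
Proof.
move=> [cx vx] [cy vy]; split=> [|v]; first exact: char_mul.
move=> /List_In_cat [Hv|]; last exact: vy.
have [u /vx vu ->] := List_In_map Hv; apply: act_valid => //; rewrite expf_neq0 //.
by case: cy.
Qed.

Lemma skmul_valid f g : valid_fskew xi f -> valid_fskew xi g -> valid_fskew xi (skmul a s f g).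
Proof.
move=> vf vg t Ht; have [x [y [/vf vx /vg vy ->]]] := List_In_allpairs Ht.
exact: (monmul_valid vx vy).
Qed.

Lemma lin_skmul psi f g : lin psi (skmul a s f g) = lin (fun x => lin (fun y => psi (monmul x y)) g) f.
Proof. exact: (lin_allpairs monmul). Qed.

Lemma Phi_mul f g : valid_fskew xi f -> valid_fskew xi g ->
  greenEq chi (Phi (skmul a s f g)) (grmul a (Phi f) (Phi g)).
Proof.
move=> vf vg; apply: (green_of_functionals sb_pos chi_ord chi_char).
- exact/Phi_valid/skmul_valid.
- move=> t Ht; have [x [y [/(Phi_valid vf) wx /(Phi_valid vg) wy ->]]] := List_In_allpairs Ht.
  exact: wmod_tens.
move=> phi [fi _]; rewrite lin_Phi lin_skmul (lin_allpairs (htens a)) lin_Phi.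
apply: eq_lin_In => t /vf vt; rewrite [RHS]lin_Phi; apply: eq_lin_In => u /vg vu /=.
have [ct _] := vt; have [cu _] := vu.
apply/esym/fi; [apply: wmod_tens => //; exact: mon_wmod| |exact: mon_mul].
by apply: mon_wmod; apply: char_mul.
Qed.

(** ** The powers of [y] *)

(** Multiplication by [y] transposed to functionals, so that inductions on powers of [y] vary the
    functional and keep the module. *)
Definition yphi (phi : hmod k G -> int) := fun N => phi (Vt chi 2 eps ** N).
Definition Vn (phi : hmod k G -> int) n i := phi (Vt chi n (chr_pow chi i)).
Definition en (phi : hmod k G -> int) n i := phi (mon (chr_pow chi i, nseq n (@VY k))).

Lemma functional_yphi phi : functional chi phi -> functional chi (yphi phi).
Proof. by apply: functional_tensl; apply: Vt_wmod => //; apply: wmod_eps. Qed.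

Lemma chi_pow_char i : is_character (chr_pow chi i).
Proof. exact: char_pow. Qed.

Lemma en_yphi phi n i : functional chi phi -> en (yphi phi) n i = en phi n.+1 i.
Proof.
move=> [fi _]; have c := chi_pow_char i; have w2 : wmod (Vt chi 2 eps) := Vt_wmod chi_char 2 wmod_eps.
apply: fi; [|exact: mon_wmod|apply: hiso_swapl; exact: Vt_skew].
by apply: wmod_tens => //; exact: mon_wmod.
Qed.

Lemma en0 phi i : functional chi phi -> en phi 0 i = Vn phi 1 i.
Proof.
move=> [fi _]; have c := chi_pow_char i; apply: fi; [exact: mon_wmod|exact: V1_wmod|].
by have := V1_mul (chr_pow chi i) eps; rewrite chr_mulr1.
Qed.

Lemma Vn0 phi i : functional chi phi -> Vn phi 0 i = 0.
Proof.
move=> fphi; have := green_dim0 (Vt_wmod chi_char 0 (chi_pow_char i)) (erefl _).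
by move=> H; have := green_functional H fphi; rewrite lin_one lin_nil.
Qed.

Lemma Vn_yphi phi t i : functional chi phi -> (0 < t < s)%N ->
  Vn (yphi phi) t i = Vn phi t.+1 i + Vn phi t.-1 i.+1.
Proof.
move=> [fi fd] /andP[t0 ts]; have c := chi_pow_char i.
have w2 : wmod (Vt chi 2 eps) := Vt_wmod chi_char 2 wmod_eps.
have wt := Vt_wmod chi_char t c.
have [H _] := Vt2_tens c t0.
have w1 := Vt_wmod chi_char t.+1 c; have w3 := Vt_wmod chi_char t.-1 (char_mul chi_char c).
rewrite /Vn chr_powS -fd //; apply: fi; [exact: wmod_tens|exact: wmod_dsum|].
by apply: H; apply/negP => /(dvdn_leq t0); rewrite leqNgt ts.
Qed.

Lemma Vn_yphi_s phi i : functional chi phi -> Vn (yphi phi) s i = Vn phi s i + Vn phi s i.+1.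
Proof.
move=> [fi fd]; have c := chi_pow_char i.
have w2 : wmod (Vt chi 2 eps) := Vt_wmod chi_char 2 wmod_eps.
have wt := Vt_wmod chi_char s c.
have [_ H] := Vt2_tens c s_pos.
have w3 := Vt_wmod chi_char s (char_mul chi_char c).
by rewrite /Vn chr_powS -fd //; apply: fi; [exact: wmod_tens|exact: wmod_dsum|apply: H].
Qed.

(* [V_2 (x) V_t = V_(t+1) + V_(t-1)(chi)] for [t < s] makes the classes of the [V_t]
   the Chebyshev polynomials in [y], and conversely [en_Vn] has ballot numbers as
   coefficients. *)
Lemma Vn_en (n : nat) phi (i r : nat) : functional chi phi -> (n < s)%N -> (n./2 < r)%N ->
  Vn phi n.+1 i = \sum_(j < r) (-1) ^+ j * ('C(n - j, j))%:Z * en phi (n - 2 * j) (i + j).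
Proof.
have step m psi l : functional chi psi -> (m.+1 < s)%N ->
    Vn psi m.+2 l = Vn (yphi psi) m.+1 l - Vn psi m l.+1.
  by move=> fpsi ms; rewrite Vn_yphi // addrK.
(* The bound [r] is left free above [n./2]: the further binomials vanish, and the two recursive
   expansions can be aligned index by index. *)
have [m nm] := ubnP n; elim: m n phi i r nm => // m IH n phi i r nm; move=> fphi ns nr.
case: r nr => // r nr; case: n nm ns nr => [|n] nm ns nr.
  rewrite big_ord_recl big1 => [|j _]; last by rewrite lift0 sub0n bin0n mulr0 mul0r.
  by rewrite addr0 expr0 mul1r muln0 subn0 bin0 mul1r addn0 en0.
have fy := functional_yphi fphi; rewrite step // (IH n _ _ r.+1) //; try by clear -nm ns nr; lia.
rewrite !big_ord_recl /= !expr0 !mul1r !muln0 !subn0 !bin0 !mul1r addn0 en_yphi //.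
rewrite -addrA; congr (_ + _).
case: n nm ns nr => [|n] nm ns nr.
  rewrite Vn0 // subr0 !big1 // => j _; rewrite /bump add1n; case: (j : nat) => [|j'] //=; rewrite ?mulr0 ?mul0r //.
rewrite (IH n _ _ r) //; try by clear -nm ns nr; lia.
rewrite -sumrB; apply: eq_bigr => j _; rewrite /bump !add1n addSnnS.
have -> : (n.+2 - 2 * j.+1 = n - 2 * j)%N by clear; lia.
rewrite [(n.+2 - j.+1)%N]subSS [(n.+1 - j.+1)%N]subSS exprS mulN1r !mulNr.
have -> : 'C(n.+1 - j, j.+1)%:Z = 'C(n - j, j.+1)%:Z + 'C(n - j, j)%:Z.
  have [jn|nj] := leqP j n; first by rewrite subSn // binS PoszD.
  by rewrite !bin_small //; clear -nj; lia.
(* For [n <= 2 * j] truncated subtraction spoils the shift of the degree, but then the binomial in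
   front is zero. *)
have [jn|nj] := ltnP (2 * j) n.
  have -> : (n.+1 - 2 * j.+1 = n - 2 * j - 1)%N by clear; lia.
  rewrite en_yphi // (_ : (n - 2 * j - 1).+1 = (n - 2 * j)%N); first by ring.
  by clear -jn; lia.
have -> : 'C(n - j, j.+1) = 0%N by rewrite bin_small //; clear -nj; lia.
by ring.
Qed.

(** For [n < s], the multiplicity of [V_(n+1-2j)(chi^j)] in the [n]-th power of [y]. It is set to
    zero past the middle, where the difference of binomials would be negative. *)
Definition ballot n j : int := if (j.*2 <= n)%N then ('C(n, j))%:Z - (if j is j'.+1 then 'C(n, j') else 0%N)%:Z else 0.

Lemma ballot0 n : ballot n 0 = 1.
Proof. by rewrite /ballot /= bin0 subr0. Qed.

(** The Pascal rule. At the middle, [n = 2j + 1], the cut-off value zero agrees with the difference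
    of binomials by symmetry. *)
Lemma ballotS n j : (j.+1.*2 <= n.+1)%N -> ballot n.+1 j.+1 = ballot n j.+1 + ballot n j.
Proof.
move=> le; have E : ballot n j.+1 = 'C(n, j.+1)%:Z - 'C(n, j)%:Z.
  rewrite /ballot; have [//|lt] := leqP j.+1.*2 n; have nE : n = (j + j.+1)%N by clear -le lt; lia.
  by rewrite -(@bin_sub n j) ?nE ?leq_addr // addKn subrr.
have le' : (j.*2 <= n)%N by clear -le; lia.
rewrite E /ballot le le' !binS; by case: j {E le le'} => [|j] /=; rewrite ?bin0 ?binS !PoszD; ring.
Qed.

Lemma en_Vn (n : nat) phi (i r : nat) : functional chi phi -> (n < s)%N -> (n./2 < r)%N ->
  en phi n i = \sum_(j < r) ballot n j * Vn phi (n.+1 - j.*2) (i + j).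
Proof.
elim: n phi i r => [|n IH] phi i r fphi ns nr.
  case: r nr => // r _; rewrite big_ord_recl big1 => [|j _]; last by rewrite lift0 mul0r.
  by rewrite addr0 ballot0 mul1r addn0 en0.
have fy := functional_yphi fphi; rewrite -en_yphi // (IH _ _ r) //; try by clear -ns nr; lia.
have V0 m : Vn phi 0 m = 0 := Vn0 m fphi.
transitivity (\sum_(j < r) (ballot n j * Vn phi (n.+2 - j.*2) (i + j)) +
              \sum_(j < r) (ballot n j * Vn phi (n - j.*2) (i + j).+1)).
  rewrite -big_split; apply: eq_bigr => j _ /=; rewrite -mulrDr.
  have [le|lt] := leqP j.*2 n; last by rewrite /ballot leqNgt lt !mul0r.
  by rewrite Vn_yphi //= ?subSn ?(leq_trans le) //; clear -le ns; lia.
case: r nr => // r nr; rewrite big_ord_recl [X in _ + X]big_ord_recr [RHS]big_ord_recl /=.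
rewrite !ballot0 -!addrA; congr (_ + _).
have -> : ballot n r * Vn phi (n - r.*2) (i + r).+1 = 0.
  rewrite /ballot; case: leqP => [le|_]; last by rewrite mul0r.
  have -> : (n - r.*2 = 0)%N by clear -le nr; lia.
  by rewrite V0 mulr0.
rewrite addr0 -big_split; apply: eq_bigr => j _ /=; rewrite /bump add1n addnS.
have -> : (n.+2 - j.+1.*2 = n - j.*2)%N by rewrite doubleS !subSS.
rewrite -mulrDl; have [le|lt] := leqP j.+1.*2 n.+1; first by rewrite ballotS.
have -> : (n - j.*2 = 0)%N by clear -lt; lia.
by rewrite V0 !mulr0.
Qed.

(** Identifies the coefficients of the first relation as ballot numbers, and shows that the integer
    division in them is exact. *)
Lemma ballot_divE i : (0 < i)%N -> (i.*2 < s)%N ->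
  ((((s - 2 * i) * 'C(s - 1, i)) %/ (s - i))%N)%:Z = ballot (s - 1) i.
Proof.
case: i => // i _ is'; rewrite /ballot; have -> : (i.+1.*2 <= s - 1)%N by clear -is'; lia.
have H := mul_bin_left (s - 1) i.
have le : ('C(s - 1, i) <= 'C(s - 1, i.+1))%N.
  have le2 : ((i.+1) * 'C(s - 1, i) <= i.+1 * 'C(s - 1, i.+1))%N.
    by rewrite H leq_mul2r; apply/orP; right; clear -is'; lia.
  by rewrite leq_mul2l /= in le2.
have -> : ((s - 2 * i.+1) * 'C(s - 1, i.+1) = ('C(s - 1, i.+1) - 'C(s - 1, i)) * (s - i.+1))%N.
  have E1 : (s - 2 * i.+1 = (s - i.+1) - i.+1)%N by clear; lia.
  have E2 : (s - i.+1 = s - 1 - i)%N by clear; lia.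
  by rewrite E1 mulnBl H -E2 [RHS]mulnBl [X in _ = (X - _)%N]mulnC [X in _ = (_ - X)%N]mulnC.
rewrite mulnK ?subn_gt0; last by clear -is'; lia.
by rewrite -subzn.
Qed.

Lemma lin_iota (T : Type) (psi : T -> int) (c : nat -> int) (x : nat -> T) m n :
  lin psi [seq (c i, x i) | i <- iota m (n - m)] = \sum_(m <= i < n) c i * psi (x i).
Proof. by rewrite /lin big_map. Qed.

Lemma lin_iota0 (T : Type) (psi : T -> int) (c : nat -> int) (x : nat -> T) n :
  lin psi [seq (c i, x i) | i <- iota 0 n] = \sum_(i < n) c i * psi (x i).
Proof. by rewrite -[in iota _ n](subn0 n) lin_iota big_mkord. Qed.

(** Write [y ^ s] as [y] times [y ^ (s-1)] and expand the latter by [en_Vn]. The leading term is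
    [y V_s = (1 + chi) V_s], the degenerate product with [V_2]. In the other terms [V_(s-2i)] is
    expanded back into powers of [y] by [Vn_en], which produces the double sum. *)
Lemma functional_J1 phi : functional chi phi -> lin (phi \o mon) (genJ1 a chi s) = 0.
Proof.
move=> fphi; have fy := functional_yphi fphi; rewrite /genJ1 !lin_cat !lin_scale !mulN1r.
have s1 : (s - 1 < s)%N by rewrite subn1 prednK ?s_pos.
have sE : (s - 1).+1 = s by rewrite subn1 prednK ?s_pos.
set l := ((s - 1)./2); have hl : ((s - 1)./2 < l.+1)%N by [].
rewrite lin_one lin_skmul lin_cons lin_one mul1r !lin_iota0.
rewrite [X in _ + (- (X + _) - _)](_ : _ = Vn phi s 0); last first.
  rewrite -[in RHS]sE (Vn_en _ fphi s1 hl); apply: eq_bigr => j _; congr (_ * phi (mon _)).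
  by rewrite /monmul /= chr_mul1.
rewrite [X in _ + (- (_ + X) - _)](_ : _ = Vn phi s 1); last first.
  rewrite -[in RHS]sE (Vn_en _ fphi s1 hl); apply: eq_bigr => j _; congr (_ * phi (mon _)).
  by rewrite /monmul /= chr_powS.
rewrite [X in _ + (_ - X)](_ : _ = \sum_(1 <= i < l.+1) ballot (s - 1) i * Vn (yphi phi) (s - i.*2) i); last first.
  have lE : l = (l.+1 - 1)%N by rewrite subn1.
  rewrite lin_flatten big_map [X in iota 1 X]lE -/(index_iota 1 l.+1).
  apply: eq_big_nat => i /andP[i0 il]; rewrite lin_iota0.
  have i2 : (i.*2 < s)%N by move: il sE; clear; rewrite /l; lia.
  have n1 : (s - 2 * i - 1 < s)%N by clear -i0 i2; lia.
  have nE : (s - i.*2 = (s - 2 * i - 1).+1)%N by clear -i2; lia.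
  rewrite nE (Vn_en (r := ((s - 2 * i - 1)./2).+1) _ fy n1) // mulr_sumr -ballot_divE //.
  apply: eq_bigr => j _; rewrite en_yphi //=.
  have -> : (s - 2 * i - 2 * j)%N = (s - 2 * i - 1 - 2 * j).+1.
    by have := ltn_ord j; clear -i2; lia.
  by rewrite [in RHS]mulrA [in RHS]mulrCA -!mulrA.
have E := en_Vn 0 fy s1 hl.
move: E; rewrite en_yphi // big_ord_recl ballot0 mul1r sE subn0 Vn_yphi_s // => E.
have -> : (phi \o mon) (eps, nseq s VY) = en phi s 0 by rewrite /en chr_pow0.
rewrite E big_add1 big_mkord /= [X in _ + X + _](_ : _ =
    \sum_(i < l) ballot (s - 1) i.+1 * Vn (yphi phi) (s - i.+1.*2) i.+1); last first.
  by apply: eq_bigr => i _; rewrite /bump add1n.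
by rewrite add0n; ring.
Qed.

(** ** The relations *)

Lemma tens_one M : wmod M -> hiso (M ** Vt chi 1 eps) M.
Proof.
move=> wM; apply: hiso_trans (tens_twistx M eps) _.
exists 1%:M, 1%:M; rewrite /twistx /= !mul1mx /chr_one; do !split=> //; last by rewrite ?scale1r ?mul1mx mulmx1.
by move=> g; rewrite ?scale1r ?mul1mx mulmx1.
Qed.

Lemma mon1 v : hiso (mon (eps, [:: v])) (Vv v).
Proof. by apply: hiso_trans (one_tens _) _; apply: tens_one; apply: Vv_wmod. Qed.

Lemma mon2 u v : hiso (mon (eps, [:: u; v])) (Vv u ** Vv v).
Proof.
apply: hiso_trans (one_tens _) _; apply: hiso_tens; first exact: hiso_refl.
by apply: tens_one; apply: Vv_wmod.
Qed.

Lemma phi_mon1 phi v : functional chi phi -> phi (mon (eps, [:: v])) = phi (Vv v).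
Proof. by move=> [fi _]; apply: fi; [by apply: mon_wmod; exact: wmod_eps|exact: Vv_wmod|exact: mon1]. Qed.

Lemma phi_mon2 phi u v : functional chi phi -> phi (mon (eps, [:: u; v])) = phi (Vv u ** Vv v).
Proof.
move=> [fi _]; apply: fi; [by apply: mon_wmod; exact: wmod_eps| |exact: mon2].
by apply: wmod_tens => //; apply: Vv_wmod.
Qed.

(** Multiplication by [chi] twists the cyclic module, and the invertible [x] is an isomorphism
    back. *)
Lemma functional_J2 phi al : functional chi phi -> al != 0 -> lin (phi \o mon) (genJ2 chi xi al) = 0.
Proof.
move=> fphi al0; have [fi _] := fphi; rewrite lin_cons lin_cons lin_nil /= mul1r mulN1r addr0.
apply/eqP; rewrite subr_eq0 phi_mon1 //; apply/eqP.
have wC := Cyc_wmod (bt (xclass xi al)) wmod_eps.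
apply: fi => //; first exact: mon_wmod.
apply: (hiso_trans (N := Vt chi 1 chi ** Cyc eps (bt (xclass xi al)))).
  by apply: hiso_tens; [exact: hiso_refl | exact: tens_one].
apply: hiso_trans (tens_twist _ _) _; apply: twist_chi => //.
exact/Cyc_hx_unit/bt_neq0.
Qed.

Lemma functional_J3 phi al : functional chi phi -> al != 0 -> lin (phi \o mon) (genJ3 G xi al) = 0.
Proof.
move=> fphi al0; rewrite lin_cons lin_cons lin_nil /= mul1r addr0 phi_mon2 // phi_mon1 //=.
have := green_functional (green_Vt2_Cyc (bt_neq0 (xclass xi al))) fphi.
by rewrite lin_one lin_cons lin_nil addr0 /= => ->; ring.
Qed.

Lemma functional_J4 phi al be : functional chi phi -> al != 0 -> be != 0 ->
  xclass xi be <> xclass xi (- al) -> lin (phi \o mon) (genJ4 G s s' xi al be) = 0.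
Proof.
move=> fphi al0 be0 ne; rewrite lin_cat lin_one /= phi_mon2 //= !bt_xclass //.
have := green_functional (green_J4 al0 be0 ne) fphi; rewrite lin_one !lin_iota0 => ->.
rewrite -big_split big1 // => i _ /=.
by rewrite phi_mon1 //= bt_xclass ?add_xi_neq0 // mulNr subrr.
Qed.

Lemma one_xi_neq0 i : (0 < i < s')%N -> 1 - xi ^+ i != 0.
Proof.
move=> /andP[i0 is']; rewrite subr_eq0 eq_sym -(prim_order_dvd xi_prim).
by apply/negP => /(dvdn_leq i0); rewrite leqNgt is'.
Qed.

(** Expanding [V_s(chi^i)] in powers of [y] produces the characters [chi^(i+j)]; as [i] runs over a
    full period, the shift by [j] is absorbed. *)
Lemma functional_J5 phi al : functional chi phi -> al != 0 ->
  lin (phi \o mon) (genJ5 chi sb s s' xi al) = 0.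
Proof.
move=> fphi al0; have nal0 : - al != 0 by rewrite oppr_eq0.
have E : (phi \o mon) (eps, [:: VX (xclass xi al); VX (xclass xi (- al))]) =
    phi (Cyc eps (al ^+ s') ** Cyc eps ((- al) ^+ s')) by rewrite /= phi_mon2 //= !bt_xclass.
rewrite !lin_cat lin_scale lin_one E.
have := green_functional (green_J5 al0) fphi; rewrite lin_one lin_cat !lin_iota => ->.
rewrite addrACA -big_split big_nat_cond big1 ?add0r => [|i /andP[/one_xi_neq0 x0 _]]; last first.
  by rewrite /= phi_mon1 //= bt_xclass ?mulf_neq0 // mulNr subrr.
rewrite lin_iota0 lin_flatten big_map -[in iota 0 sb](subn0 sb) big_mkord mulN1r.
apply/eqP; rewrite subr_eq0; apply/eqP.
have s1 : (s - 1 < s)%N by rewrite subn1 prednK ?s_pos.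
have sE : (s - 1).+1 = s by rewrite subn1 prednK ?s_pos.
pose l := ((s - 1)./2); have hl : ((s - 1)./2 < l.+1)%N by [].
pose c j : int := (-1) ^+ j * ('C(s - 1 - j, j))%:Z.
transitivity (\sum_(j < l.+1) c j * \sum_(i < sb) en phi (s - 1 - 2 * j) (i + j)).
  under [RHS]eq_bigr do rewrite mulr_sumr.
  rewrite [RHS]exchange_big; apply: eq_bigr => i _; rewrite mul1r.
  by have := Vn_en i fphi s1 hl; rewrite sE.
transitivity (\sum_(j < l.+1) c j * \sum_(i < sb) en phi (s - 1 - 2 * j) i).
  apply: eq_bigr => j _; congr (_ * _).
  apply: (@sum_periodic_shift _ _ _ (en phi (s - 1 - 2 * j))) => i.
  by rewrite /en (chr_pow_mod chi_ord) modnDr -(chr_pow_mod chi_ord).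
under eq_bigr do rewrite mulr_sumr.
by rewrite exchange_big; apply: eq_bigr => i _; rewrite lin_iota0.
Qed.

Lemma functional_J phi g : functional chi phi -> isGenJ a chi sb s s' xi g -> lin (phi \o mon) g = 0.
Proof.
move=> fphi [->|[[al [al0 [->|->|->]]]|[al [be [al0 be0 ne ->]]]]].
- exact: functional_J1.
- exact: functional_J2.
- exact: functional_J3.
- exact: functional_J5.
exact: functional_J4.
Qed.

(** ** The ideal [J] *)

Lemma lin_In0 (T : Type) (psi : T -> int) (f : seq (int * T)) :
  (forall t, List.In t f -> psi t.2 = 0) -> lin psi f = 0.
Proof.
by move=> H; apply: sum_In => t /H ->; rewrite mulr0.
Qed.

Lemma valid_VY n v : List.In v (nseq n (@VY k)) -> valid_var xi v.
Proof. by elim: n => //= n IH [<-|/IH]. Qed.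

Lemma valid_VX al v : al != 0 -> List.In v [:: VX (xclass xi al)] -> valid_var xi v.
Proof. by move=> al0 [<-|[]]; exists al. Qed.

Lemma valid_VX2 al be v : al != 0 -> be != 0 ->
  List.In v [:: VX (xclass xi al); VX (xclass xi be)] -> valid_var xi v.
Proof. by move=> al0 be0 [<-|[<-|[]]]; [exists al|exists be]. Qed.

Lemma valid_cat (f g : fskew k G) : valid_fskew xi f -> valid_fskew xi g -> valid_fskew xi (f ++ g).
Proof. by move=> vf vg t /List_In_cat [/vf|/vg]. Qed.

Lemma valid_skscale c (f : fskew k G) : valid_fskew xi f -> valid_fskew xi (skscale c f).
Proof. by move=> vf t Ht; have [u /vf vu ->] := List_In_map Ht. Qed.

Lemma List_In_flatten (T U : Type) (h : T -> seq U) L u :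
  List.In u (flatten [seq h t | t <- L]) -> exists2 t, List.In t L & List.In u (h t).
Proof.
elim: L => //= t L IH /List_In_cat [H|/IH [t' tL H]]; first by exists t; [left|].
by exists t'; [right|].
Qed.

Lemma List_In_iota m n i : List.In i (iota m n) -> (m <= i < m + n)%N.
Proof.
by elim: n m => //= n IH m [<-|/IH]; [rewrite leqnn addnS ltnS leq_addr|rewrite addSnnS => /andP[/ltnW -> ->]].
Qed.

Lemma isGenJ_valid g : isGenJ a chi sb s s' xi g -> valid_fskew xi g.
Proof.
have ce := wmod_eps; have cc := chi_pow_char.
move=> [->|[[al [al0 [->|->|->]]]|[al [be [al0 be0 ne ->]]]]].
- apply: valid_cat => [t [<-|[]]|]; first by split; [exact: ce|move=> v; exact: valid_VY].
  apply: valid_cat; apply: valid_skscale; last first.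
    move=> t Ht0; have [i _ Ht] := List_In_flatten Ht0; have [j _ ->] := List_In_map Ht.
    by split; [exact: cc|move=> v; exact: valid_VY].
  apply: skmul_valid => [t [<-|[<-|[]]]|t Ht]; [by split|by split|].
  by have [j _ ->] := List_In_map Ht; split; [exact: cc|move=> v; exact: valid_VY].
- by move=> t [<-|[<-|[]]]; split; [exact: chi_char|move=> v; exact: valid_VX|exact: ce|move=> v; exact: valid_VX].
- move=> t [<-|[<-|[]]]; split; try exact: ce; last by move=> v; exact: valid_VX.
  by move=> v [<-|]; [|exact: valid_VX].
- apply: valid_cat => [t [<-|[]]|]; first by split; [exact: ce|move=> v; apply: valid_VX2; rewrite ?oppr_eq0].
  apply: valid_cat => [t Ht|].
    have [i Hi ->] := List_In_map Ht; have ii := List_In_iota Hi; split; [exact: ce|move=> v; apply: valid_VX].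
    by rewrite mulf_neq0 // one_xi_neq0 //; move: ii; have := s'_pos; clear; lia.
  apply: valid_skscale => t Ht0; have [i _ Ht] := List_In_flatten Ht0; have [j _ ->] := List_In_map Ht.
  by split; [exact: cc|move=> v; exact: valid_VY].
apply: valid_cat => [t [<-|[]]|t Ht]; first by split; [exact: ce|move=> v; exact: valid_VX2].
by have [i _ ->] := List_In_map Ht; split; [exact: ce|move=> v; apply: valid_VX; exact: add_xi_neq0].
Qed.

(** A two-sided multiple of a generator is tested by a functional precomposed with tensoring on both
    sides, which is again a functional and kills the generator. *)
Lemma inJ_Phi f : valid_fskew xi f -> inJ a chi sb s s' xi f -> greenEq chi (Phi f) [::].
Proof.
move=> vf [L [vL E]].
have vt t : List.In t L -> valid_fskew xi (skmul a s (skmul a s t.1.1 t.1.2) t.2).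
  by move=> /vL [vl gg vr]; do 2 apply: skmul_valid => //; apply: isGenJ_valid.
have vF : valid_fskew xi (flatten [seq skmul a s (skmul a s t.1.1 t.1.2) t.2 | t <- L]).
  by move=> u Hu; have [t tL] := List_In_flatten Hu; apply: vt.
apply: green_trans (Phi_eqA vf vF E) _.
apply: (green_of_functionals sb_pos chi_ord chi_char); first exact: Phi_valid.
  by [].
move=> phi fphi; rewrite lin_nil lin_Phi lin_flatten big_map.
apply: sum_In => t tL; have [vl gg vr] := vL t tL; have vg := isGenJ_valid gg.
have vlg := skmul_valid vl vg; rewrite -lin_Phi (green_functional (Phi_mul vlg vr) fphi).
rewrite (lin_allpairs (htens a)) lin_exchange; apply: lin_In0 => u /(Phi_valid vr) wu.
have fu := functional_tensr wu fphi; rewrite (green_functional (Phi_mul vl vg) fu).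
rewrite (lin_allpairs (htens a)); apply: lin_In0 => v /(Phi_valid vl) wv.
by rewrite lin_Phi; exact: (functional_J (functional_tensl wv fu) gg).
Qed.

Lemma act_act c d (v : var k) : var_act c (var_act d v) = var_act (c * d) v.
Proof.
case: v => [||C] //=; congr VX; apply/seteqP; split=> z.
  by move=> [_ [b bC <-] <-]; exists b => //; rewrite mulrA.
by move=> [b bC <-]; exists (d * b); [exists b | rewrite mulrA].
Qed.

Lemma act1 (v : var k) : var_act 1 v = v.
Proof.
case: v => [||C] //=; congr VX; apply/seteqP; split=> z.
  by move=> [b bC <-]; rewrite mul1r.
by move=> zC; exists z; rewrite ?mul1r.
Qed.

Lemma monmulA x y z : monmul (monmul x y) z = monmul x (monmul y z).
Proof.
rewrite /monmul /= chr_mulA map_cat -catA -map_comp; congr (_, _ ++ _).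
by apply: eq_map => v /=; rewrite act_act /chr_mul exprMn mulrC.
Qed.

Definition mon_one : (G -> k) * seq (var k) := (eps, [::]).

Lemma mon1mul x : monmul mon_one x = x.
Proof. by case: x => la w; rewrite /monmul /= chr_mul1. Qed.

Lemma monmul_eps la w w' : monmul (la, w) (eps, w') = (la, w ++ w').
Proof.
rewrite /monmul /= chr_mulr1; congr (_, _ ++ _).
by rewrite -[RHS]map_id; apply: eq_map => v; rewrite /chr_one expr1n act1.
Qed.

Lemma monmul_nil la x : monmul (la, [::]) x = (chr_mul la x.1, x.2).
Proof. by []. Qed.

Lemma skmulA psi (f g h : fskew k G) :
  lin psi (skmul a s (skmul a s f g) h) = lin psi (skmul a s f (skmul a s g h)).
Proof.
rewrite !lin_skmul; apply: eq_lin_In => x _; rewrite lin_skmul.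
by apply: eq_lin_In => y _; apply: eq_lin_In => z _; rewrite monmulA.
Qed.

Notation inJ := (inJ a chi sb s s' xi).

Lemma inJ_eqA f g : eqA f g -> inJ g -> inJ f.
Proof. by move=> fg [L [vL gL]]; exists L; split=> // l w; rewrite fg. Qed.

Lemma inJ_lin (f g : fskew k G) : (forall psi, lin psi f = lin psi g) -> inJ g -> inJ f.
Proof. by move=> H; apply: inJ_eqA; apply/eqAP. Qed.

Lemma inJ_cat f g : inJ f -> inJ g -> inJ (f ++ g).
Proof.
move=> [L [vL /eqAP fL]] [M [vM /eqAP gM]]; exists (L ++ M); split.
  by move=> t /List_In_cat [/vL|/vM].
by apply/eqAP => psi ipsi; rewrite map_cat flatten_cat !lin_cat fL // gM.
Qed.

Lemma invariant_monmull x psi : invariant_mon psi -> invariant_mon (fun y => psi (monmul x y)).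
Proof. by move=> ipsi la w w' ww; apply: ipsi => v; rewrite !cnt_cat ww. Qed.

Lemma invariant_monmulr x psi : invariant_mon psi -> invariant_mon (fun y => psi (monmul y x)).
Proof.
by move=> ipsi la w w' ww; apply: ipsi => v; rewrite !cnt_cat (same_cnt_map _ ww).
Qed.

Lemma lin_add (T : Type) (h h' : T -> int) f : lin (fun x => h x + h' x) f = lin h f + lin h' f.
Proof. by rewrite /lin -big_split; apply: eq_bigr => t _; rewrite mulrDr. Qed.

Lemma inJ_mull m f : valid_fskew xi m -> inJ f -> inJ (skmul a s m f).
Proof.
move=> vm [L [vL /eqAP fL]]; exists [seq (skmul a s m t.1.1, t.1.2, t.2) | t <- L]; split.
  by move=> t Ht; have [u /vL [vl gg vr] ->] := List_In_map Ht; split=> //; apply: skmul_valid.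
apply/eqAP => psi ipsi; rewrite lin_skmul.
rewrite (eq_lin_In (phi' := fun x => lin (fun y => psi (monmul x y))
    (flatten [seq skmul a s (skmul a s t.1.1 t.1.2) t.2 | t <- L]))); last first.
  by move=> t _; apply: fL; apply: invariant_monmull.
rewrite -lin_skmul -map_comp.
elim: L {vL fL} => [|t L IH]; first by rewrite lin_skmul lin_nil; apply: lin_In0 => x _; rewrite lin_nil.
rewrite [RHS]lin_cat -IH !skmulA !lin_skmul -lin_add; apply: eq_lin_In => x _.
by rewrite lin_cat skmulA.
Qed.

Lemma inJ_mulr m f : valid_fskew xi m -> inJ f -> inJ (skmul a s f m).
Proof.
move=> vm [L [vL /eqAP fL]]; exists [seq (t.1.1, t.1.2, skmul a s t.2 m) | t <- L]; split.
  by move=> t Ht; have [u /vL [vl gg vr] ->] := List_In_map Ht; split=> //; apply: skmul_valid.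
apply/eqAP => psi ipsi; rewrite lin_skmul lin_exchange.
rewrite (eq_lin_In (phi' := fun y => lin (fun x => psi (monmul x y))
    (flatten [seq skmul a s (skmul a s t.1.1 t.1.2) t.2 | t <- L]))); last first.
  by move=> t _; apply: fL; apply: invariant_monmulr.
rewrite -lin_exchange -lin_skmul -map_comp.
elim: L {vL fL} => [|t L IH]; first by rewrite lin_skmul lin_nil.
rewrite [RHS]lin_cat -IH -skmulA [LHS]lin_skmul [LHS]lin_cat.
by congr (_ + _); rewrite [RHS]lin_skmul.
Qed.

Lemma inJ_gen g : isGenJ a chi sb s s' xi g -> inJ g.
Proof.
have v1 : valid_fskew xi [:: (1 : int, mon_one)].
  by move=> t [<-|[]]; split=> //; apply: wmod_eps.
move=> gg; exists [:: ([:: (1, mon_one)], g, [:: (1, mon_one)])]; split.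
  by move=> t [<-|[]].
apply/eqAP => psi _; rewrite /= cats0 skmulA lin_skmul lin_one lin_skmul.
by apply: eq_lin_In => -[c [la w]] _; rewrite lin_one mon1mul monmul_eps cats0.
Qed.

Lemma inJ_nil : inJ [::].
Proof. by exists [::]. Qed.

Lemma inJ_scale c f : inJ f -> inJ (skscale c f).
Proof.
have vc : valid_fskew xi [:: (c, mon_one)].
  by move=> t [<-|[]]; split=> //; apply: wmod_eps.
move=> /(inJ_mull vc); apply: inJ_lin => psi; rewrite lin_scale lin_skmul lin_cons lin_nil addr0.
by congr (_ * _); apply: eq_lin_In => t _; rewrite mon1mul.
Qed.

(** ** Normal forms modulo [J] *)

Definition rt (ga : k) : k := xget 1 [set r | r ^+ s' = ga].

Lemma rtE ga : rt ga ^+ s' = ga.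
Proof.
have [|r] := @closed_rootP k ('X^s' - ga%:P) _; first by rewrite size_XnsubC ?s'_pos // eqSS -lt0n s'_pos.
rewrite /root !hornerE subr_eq0 => /eqP rE.
exact: (xgetPex 1 (ex_intro (fun r => r ^+ s' = ga) r rE)).
Qed.

Lemma rt_neq0 ga : ga != 0 -> rt ga != 0.
Proof. by rewrite -{1}(rtE ga); apply: contraNneq => ->; rewrite expr0n gtn_eqF ?s'_pos. Qed.

(** Two [s']-th roots of the same element differ by a power of [xi], so the class of the chosen root
    is independent of the choice. *)
Lemma xclass_rt al : al != 0 -> xclass xi (rt (al ^+ s')) = xclass xi al.
Proof.
move=> al0; have : (rt (al ^+ s') / al) ^+ s' = 1.
  by rewrite exprMn exprVn rtE mulfV ?expf_neq0.
move=> /(prim_rootP xi_prim) [i E].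
have -> : rt (al ^+ s') = xi ^+ i * al by rewrite -E divfK.
apply/seteqP; split=> z [j ->]; first by exists (j + i)%N; rewrite exprD mulrA.
exists (j + (s' - i))%N; rewrite mulrA -exprD -addnA subnK ?(ltnW (ltn_ord i)) //.
by rewrite exprD (prim_expr_order xi_prim) mulr1.
Qed.

Definition wy i j : seq (var k) := nseq i VY ++ nseq j VZ.
Definition wx al j : seq (var k) := VX (xclass xi al) :: nseq j VZ.

Definition nm (b : bidx k G) : (G -> k) * seq (var k) :=
  (b.1.1, if b.1.2 == 0 then wy (b.2.-1 %% s) (b.2.-1 %/ s) else wx (rt b.1.2) b.2.-1).

Definition nmf (L : seq (int * bidx k G)) : fskew k G := [seq (t.1, nm t.2) | t <- L].

Definition validL (L : seq (int * bidx k G)) := forall t, List.In t L -> validb chi t.2.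

(** Congruence modulo [J] to an integral combination of normal monomials. *)
Definition NF (f : fskew k G) := exists2 L, validL L & inJ (f ++ skscale (-1) (nmf L)).

Lemma NF_J f g : inJ (f ++ skscale (-1) g) -> NF g -> NF f.
Proof.
move=> fg [L vL gL]; exists L => //; apply: inJ_lin (inJ_cat fg gL) => psi.
rewrite !lin_cat !lin_scale; ring.
Qed.

Lemma NF_eqA f g : eqA f g -> NF g -> NF f.
Proof.
move=> /eqAP fg; apply: NF_J; apply: inJ_eqA inJ_nil; apply/eqAP => psi ipsi.
by rewrite lin_cat lin_scale fg // lin_nil mulN1r subrr.
Qed.

Lemma NF_lin0 f g : (forall psi, lin psi f = lin psi g) -> NF g -> NF f.
Proof. by move=> H; apply: NF_eqA; apply/eqAP. Qed.

Lemma NF_nil : NF [::].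
Proof. by exists [::] => //; apply: inJ_nil. Qed.

Lemma NF_cat f g : NF f -> NF g -> NF (f ++ g).
Proof.
move=> [L vL fL] [M vM gM]; exists (L ++ M); first by move=> t /List_In_cat [/vL|/vM].
apply: inJ_lin (inJ_cat fL gM) => psi; rewrite /nmf map_cat !lin_cat !lin_scale lin_cat; ring.
Qed.

Lemma NF_scale c f : NF f -> NF (skscale c f).
Proof.
move=> [L vL fL]; exists [seq (c * t.1, t.2) | t <- L].
  by move=> t Ht; have [u /vL vu ->] := List_In_map Ht.
apply: inJ_lin (inJ_scale c fL) => psi; rewrite !lin_cat !lin_scale lin_cat lin_scale !lin_map.
by rewrite lin_scale; ring.
Qed.

Lemma NF_terms f : (forall t, List.In t f -> NF [:: (1, t.2)]) -> NF f.
Proof.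
elim: f => [|t f IH] H; first exact: NF_nil.
have /NF_cat H1 : NF (skscale t.1 [:: (1, t.2)]) by apply/NF_scale/H; left.
have /H1 : NF f by apply: IH => u Hu; apply: H; right.
by apply: NF_lin0 => psi; rewrite lin_cat lin_scale lin_one lin_cons.
Qed.

Lemma NF_same la w w' : same_cnt w w' -> NF [:: (1, (la, w'))] -> NF [:: (1, (la, w))].
Proof. by move=> ww; apply: NF_eqA; apply/eqAP => psi ipsi; rewrite !lin_one; apply: ipsi. Qed.

Lemma valid_mon1 x : valid_mon x -> valid_fskew xi [:: (1 : int, x)].
Proof. by move=> vx t [<-|[]]. Qed.

Lemma NF_mull x f : valid_mon x ->
  (forall b, validb chi b -> NF [:: (1, monmul x (nm b))]) -> NF f -> NF (skmul a s [:: (1, x)] f).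
Proof.
move=> vx H [L vL fL].
have H1 := inJ_mull (valid_mon1 vx) fL.
apply: (@NF_J _ [seq (t.1, monmul x (nm t.2)) | t <- L]).
  apply: inJ_lin H1 => psi; rewrite lin_cat lin_scale !lin_skmul !lin_one lin_cat lin_scale lin_map.
  by rewrite (lin_map (fun b => monmul x (nm b))).
by apply: NF_terms => t Ht; have [u /vL vu ->] := List_In_map Ht; apply: H.
Qed.

Lemma lin_ctx psi x y (f : fskew k G) :
  lin psi (skmul a s (skmul a s [:: (1, x)] f) [:: (1, y)]) = lin (fun u => psi (monmul (monmul x u) y)) f.
Proof. by rewrite !lin_skmul lin_one; apply: eq_lin_In => t _; rewrite lin_one. Qed.

(* Rewriting with a generator of [J] whose leading monomial is [u]. *)
Lemma NF_gen la u w (g : fskew k G) : isGenJ a chi sb s s' xi ((1, u) :: g) ->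
  is_character la -> (forall v, List.In v w -> valid_var xi v) ->
  (forall t, List.In t g -> NF [:: (1, (chr_mul la t.2.1, t.2.2 ++ w))]) ->
  NF [:: (1, (chr_mul la u.1, u.2 ++ w))].
Proof.
move=> gg cl vw H.
have ctx t : monmul (monmul (la, [::]) t) (eps, w) = (chr_mul la t.1, t.2 ++ w).
  by rewrite monmul_nil monmul_eps.
have vl : valid_fskew xi [:: (1 : int, (la, [::] : seq (var k)))] by apply: valid_mon1.
have ve : valid_fskew xi [:: (1 : int, (eps, w))].
  by apply: valid_mon1; split=> //; apply: wmod_eps.
have J1 := inJ_mulr ve (inJ_mull vl (inJ_gen gg)).
apply: (@NF_J _ (skscale (-1) [seq (t.1, (chr_mul la t.2.1, t.2.2 ++ w)) | t <- g])); last first.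
  by apply/NF_scale/NF_terms => t Ht; have [v vg ->] := List_In_map Ht; apply: H.
apply: inJ_lin J1 => psi.
rewrite lin_cat !lin_scale lin_one lin_ctx lin_cons ctx.
rewrite (lin_map (fun x => (chr_mul la x.1, x.2 ++ w))).
rewrite mul1r !mulN1r opprK; congr (_ + _); apply: eq_lin_In => t _.
by rewrite /= ctx.
Qed.

Lemma NF_wy la i j : is_character la -> (i < s)%N -> NF [:: (1, (la, wy i j))].
Proof.
move=> cl is_; pose b : bidx k G := (la, 0, (j * s + i).+1).
exists [:: (1, b)]; first by move=> t [<-|[]]; split=> //; rewrite eqxx.
apply: inJ_lin inJ_nil => psi; rewrite lin_cat lin_scale !lin_one lin_nil /nm /= eqxx.
by rewrite modnMDl modn_small // divnMDl ?s_pos // divn_small // addn0 mulN1r subrr.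
Qed.

Lemma valid_VZ n v : List.In v (nseq n (@VZ k)) -> valid_var xi v.
Proof. by elim: n => //= n IH [<-|/IH]. Qed.

(** Normal monomials containing some [x_[al]] carry only the representative [crep chi la]; repeated
    use of [chi x = x] moves [la] to it. *)
Lemma NF_wx la al j : is_character la -> al != 0 -> NF [:: (1, (la, wx al j))].
Proof.
move=> cl al0; have [n cE] := crep_spec chi la.
have shift m mu : is_character mu ->
    inJ ([:: (1, (chr_mul (chr_pow chi m) mu, wx al j))] ++ skscale (-1) [:: (1, (mu, wx al j))]).
  move=> cm; elim: m => [|m IH].
    apply: inJ_lin inJ_nil => psi; rewrite lin_cat lin_scale !lin_one lin_nil chr_pow0 chr_mul1.
    by rewrite mulN1r subrr.
  have gg : isGenJ a chi sb s s' xi (genJ2 chi xi al).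
    by right; left; exists al; split=> //; apply: Or31.
  have cmm : is_character (chr_mul (chr_pow chi m) mu) by apply: char_mul => //; apply: chi_pow_char.
  have vl : valid_fskew xi [:: (1 : int, (chr_mul (chr_pow chi m) mu, [::] : seq (var k)))].
    exact: valid_mon1.
  have ve : valid_fskew xi [:: (1 : int, (eps, nseq j (@VZ k)))].
    by apply: valid_mon1; split=> [|v]; [apply: wmod_eps|apply: valid_VZ].
  have J1 := inJ_mulr ve (inJ_mull vl (inJ_gen gg)).
  apply: inJ_lin (inJ_cat J1 IH) => psi.
  rewrite [RHS]lin_cat lin_ctx ![lin psi (_ ++ _)]lin_cat !lin_scale !lin_one.
  rewrite /genJ2 !lin_cons lin_nil.
  rewrite /= !monmul_nil !monmul_eps chr_mulr1 /= -/(wx al j).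
  have -> : chr_mul (chr_pow chi m.+1) mu = chr_mul (chr_mul (chr_pow chi m) mu) chi.
    by apply/funext => g; rewrite chr_powS /chr_mul; ring.
  ring.
have crep_char : is_character (crep chi la) by rewrite cE; apply: char_mul => //; apply: chi_pow_char.
pose b : bidx k G := (crep chi la, al ^+ s', j.+1).
exists [:: (1, b)].
  move=> t [<-|[]]; split=> // _ /=.
  by rewrite [in X in crep _ X]cE (crep_shift sb_pos chi_ord).
have bn : nm b = (crep chi la, wx al j).
  by rewrite /nm /= expf_eq0 s'_pos (negPf al0) /wx xclass_rt.
rewrite /nmf /= bn.
have := inJ_scale (-1) (shift n la cl); rewrite -cE; apply: inJ_lin => psi.
rewrite !lin_scale !lin_cat !lin_scale !lin_one !lin_cons lin_nil /=; ring.
Qed.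

Lemma wy_valid i j v : List.In v (wy i j) -> valid_var xi v.
Proof. by move=> /List_In_cat [/valid_VY|/valid_VZ]. Qed.

Lemma NF_x la al i j : is_character la -> al != 0 ->
  NF [:: (1, (la, VX (xclass xi al) :: wy i j))].
Proof.
move=> cl al0; elim: i la cl => [|i IH] la cl; first exact: NF_wx.
have gg : isGenJ a chi sb s s' xi (genJ3 G xi al).
  by right; left; exists al; split=> //; apply: Or32.
have := NF_gen (w := wy i j) gg cl (@wy_valid i j); rewrite /= chr_mulr1 => H.
apply: NF_same (H _) => [v|t [<-|[]]]; last by rewrite /= chr_mulr1; apply: IH.
by rewrite !cnt_cons addnCA.
Qed.

(** Adjoining one variable to a normal monomial breaks normality in few ways: the degree in [y]
    reaches [s], a [y] meets an [x], or two [x] meet, with opposite classes or not. One relation of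
    [J] covers each case, and no new violation arises. *)
Lemma NF_cons la v b : is_character la -> valid_var xi v -> validb chi b ->
  NF [:: (1, (la, v :: (nm b).2))].
Proof.
move=> cl; rewrite /nm /=; case: eqVneq => [_|/rt_neq0 g0].
  have is_ : (b.2.-1 %% s < s)%N by rewrite ltn_mod s_pos.
  move: (_ %% s)%N is_ => i is_; move: (_ %/ s)%N => j.
  case: v => [||C] /=; last 1 first.
  - by move=> [al [al0 ->]] _; apply: NF_x.
  - move=> _ _; have [i1|i1] := ltnP i.+1 s; first exact: (NF_wy j cl i1).
    have -> : VY :: wy i j = nseq s VY ++ nseq j VZ.
      by have -> : s = i.+1 by apply/eqP; rewrite eqn_leq i1 is_.
    have gg : isGenJ a chi sb s s' xi (genJ1 a chi s) by left.
    have H := NF_gen (w := nseq j VZ) gg cl (@valid_VZ j); rewrite chr_mulr1 in H.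
    have cc i' : is_character (chr_mul la (chr_pow chi i')) by apply: char_mul => //; apply: chi_pow_char.
    (* All other monomials of the first relation are powers of [y] of degree below [s] with a power
       of [chi], hence normal after multiplication by [la] and powers of [z]. *)
    apply: H => t /List_In_cat [Ht|Ht]; have [t' Ht' ->] := List_In_map Ht.
      have [x [y [Hx Hy ->]]] := List_In_allpairs Ht'; have [l _ ->] := List_In_map Hy.
      have ls : (s - 1 - 2 * l < s)%N by have := s_pos; clear; lia.
      case: Hx => [<-|[<-|[]]].
        by rewrite /= chr_mul1; apply: (NF_wy j (cc l) ls).
      by rewrite /= -chr_powS; apply: (NF_wy j (cc l.+1) ls).
    have [i' Hi Hl] := List_In_flatten Ht'; have [l _ ->] := List_In_map Hl.
    have ls : (s - 2 * i' - 2 * l < s)%N.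
      by have := List_In_iota Hi; have := s_pos; clear; lia.
    exact: (NF_wy j (cc (i' + l)%N) ls).
  move=> _ _; apply: NF_same (NF_wy j.+1 cl is_) => v.
  by rewrite cnt_cons !cnt_cat cnt_cons addnCA.
move: (rt _) g0 (b.2.-1) => al al0 j; case: v => [||C] /=.
- by move=> _ _; apply: (@NF_same _ _ (VX (xclass xi al) :: wy 1 j)); [move=> v; rewrite !cnt_cons addnCA|apply: NF_x].
- by move=> _ _; apply: NF_same (NF_wx j.+1 cl al0) => v; rewrite !cnt_cons addnCA.
move=> [be [be0 ->]] _; have nbe0 : - be != 0 by rewrite oppr_eq0.
have [E|ne] := pselect (xclass xi al = xclass xi (- be)).
  rewrite /wx E.
  have gg : isGenJ a chi sb s s' xi (genJ5 chi sb s s' xi be).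
    by right; left; exists be; split=> //; apply: Or33.
  have H := NF_gen (w := nseq j VZ) gg cl (@valid_VZ j); rewrite chr_mulr1 in H.
  apply: H => t /List_In_cat [Ht|Ht]; have [t' Ht' ->] := List_In_map Ht.
    rewrite /= chr_mulr1; apply: NF_wx => //; rewrite mulf_neq0 // one_xi_neq0 //.
    by have := List_In_iota Ht'; have := s'_pos; clear; lia.
  have [i' _ Hl] := List_In_flatten Ht'; have [l _ ->] := List_In_map Hl.
  have ls : (s - 1 - 2 * l < s)%N by have := s_pos; clear; lia.
  have cc : is_character (chr_mul la (chr_pow chi i')) by apply: char_mul => //; apply: chi_pow_char.
  exact: (NF_wy j cc ls).
have gg : isGenJ a chi sb s s' xi (genJ4 G s s' xi be al).
  by right; right; exists be, al.
have H := NF_gen (w := nseq j VZ) gg cl (@valid_VZ j); rewrite chr_mulr1 in H.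
apply: H => t Ht; have [i _ ->] := List_In_map Ht.
by rewrite /= chr_mulr1; apply: NF_wx => //; apply: add_xi_neq0.
Qed.

Lemma nm_valid b : validb chi b -> valid_mon (nm b).
Proof.
move=> [cb _ _]; split=> // v; rewrite /nm /=; case: eqVneq => [_|/rt_neq0 g0]; first exact: wy_valid.
by move=> [<-|/valid_VZ //]; exists (rt b.1.2).
Qed.

Lemma NF_mon x : valid_mon x -> NF [:: (1, x)].
Proof.
case: x => la w [/= cl]; elim: w la cl => [|v w IH] la cl vw; first exact: (NF_wy 0 cl s_pos).
have vv : valid_var xi v by apply: vw; left.
have IHw := IH eps wmod_eps (fun u Hu => vw u (or_intror Hu)).
have vx : valid_mon (la, [:: v]) by split=> // u [<-|[]].
apply: NF_lin0 (NF_mull vx _ IHw) => [psi|].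
  by rewrite lin_skmul !lin_one monmul_eps.
move=> b vb; have [cb vwb] := nm_valid vb.
(* Collecting the characters on the left lets the character of the normal monomial act on [v]. *)
apply: (@NF_cons (chr_mul la (nm b).1) (var_act ((nm b).1 a ^+ s) v) b) => //; first exact: char_mul.
by apply: act_valid => //; rewrite expf_neq0 //; case: cb.
Qed.

Lemma NF_valid f : valid_fskew xi f -> NF f.
Proof. by move=> vf; apply: NF_terms => t /vf; apply: NF_mon. Qed.

Lemma top_VZs j : TopM sb (Wv (nseq j VZ)) 0 (s * j).+1 (fun _ : 'I_1 => eps).
Proof.
elim: j => [|j IH]; first exact: one_top.
by apply: top_Vz; [exact: Wv_wmod|exact: as1_Wv|].
Qed.

(** The powers of [z] reach level [j * s + 1]. Each [y] then raises the level by one, as long as the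
    current level is not a multiple of [s]; the condition [i < s] guarantees this. *)
Lemma top_wy i j : (i < s)%N -> TopM sb (Wv (wy i j)) 0 (j * s + i).+1 (fun _ : 'I_1 => eps).
Proof.
elim: i => [|i IH] is_; first by rewrite addn0 mulnC; apply: top_VZs.
rewrite addnS; apply: top_Vt2; [exact: Wv_wmod|exact/IH/ltnW|].
by rewrite -addnS dvdn_addr ?dvdn_mull //; apply/negP => /(dvdn_leq (ltn0Sn i)); rewrite leqNgt is_.
Qed.

Lemma nm_top b : validb chi b -> TopB (mon (nm b)) b.1.1 b.1.2 b.2.
Proof.
move: b => [[la ga] n] [/= cl n0 rb]; apply: TopB_iso (hiso_sym (tens_twist _ _)) _.
rewrite -[X in TopB _ X _ _](chr_mulr1 la); apply: twist_top => //.
rewrite /nm /=; case: eqVneq => [->|g0].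
  exists 1%N, (fun _ => eps); split; last by move=> mu; rewrite eqxx; split=> [[]|->] //; exists 0.
    have := top_wy (n.-1 %/ s) (ltn_pmod n.-1 s_pos).
    by rewrite -divn_eq prednK.
  by move=> i j _; rewrite !ord1.
rewrite /wx /= bt_xclass ?rt_neq0 // rtE -[X in TopB _ _ _ X](prednK n0).
by apply: Cyc_tens_top => //; [exact: Wv_wmod|exact: as1_Wv|exact: top_VZs].
Qed.

(** ** The isomorphism *)

Lemma mon_nm_wmod b : validb chi b -> wmod (mon (nm b)).
Proof. by move=> /nm_valid [cb _]; apply: mon_wmod. Qed.

Lemma nmf_valid L : validL L -> valid_fskew xi (nmf L).
Proof. by move=> vL t Ht; have [u /vL /nm_valid vu ->] := List_In_map Ht. Qed.

Lemma Phi_nmf phi L : lin phi (Phi (nmf L)) = lin (fun b => phi (mon (nm b))) L.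
Proof. by rewrite lin_Phi (lin_map nm). Qed.

Lemma Phi_surj F : valid_fsum chi F -> exists f, valid_fskew xi f /\ greenEq chi (Phi f) F.
Proof.
move=> vF; have [L [vL gL]] := triangular_span sb_pos chi_ord chi_char mon_nm_wmod nm_top vF.
exists (nmf L); split; first exact: nmf_valid.
apply: green_sym; apply: green_trans gL _; apply: green_lin => phi.
by rewrite Phi_nmf (lin_map (fun b => mon (nm b))).
Qed.

(** Every functional kills the image of [f] and of [J], hence that of the normal form of [f];
    independence makes the coefficients of the normal form cancel, and [f] itself lies in [J]. *)
Lemma Phi_inj f : valid_fskew xi f -> greenEq chi (Phi f) [::] -> inJ f.
Proof.
move=> vf f0; have [L vL fL] := NF_valid vf.
have v : valid_fskew xi (f ++ skscale (-1) (nmf L)).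
  by apply: valid_cat => //; apply/valid_skscale/nmf_valid.
have L0 phi : functional chi phi -> lin (fun b => phi (mon (nm b))) L = 0.
  move=> fphi; have := green_functional (inJ_Phi v fL) fphi.
  rewrite lin_Phi lin_cat lin_scale -lin_Phi (green_functional f0 fphi) !lin_nil add0r.
  by rewrite (lin_map nm) mulN1r => /eqP; rewrite oppr_eq0 => /eqP.
have Lz psi : lin psi L = 0.
  apply: sum_coef => b; have [vb|nvb] := pselect (validb chi b); last first.
    by apply: sum_coef_In => t /vL vt E; apply: nvb; rewrite -E.
  apply: (triangular_indep sb_pos chi_ord mon_nm_wmod nm_top (l := 0)) => // b' vb' _.
  by apply: L0; apply: functional_topinv.
apply: inJ_lin fL => psi; rewrite lin_cat lin_scale [lin psi (nmf L)](lin_map nm) Lz.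
by rewrite mulr0 addr0.
Qed.

Lemma Phi_char la : is_character la ->
  greenEq chi (Phi [:: (1, (la, [::]))]) [:: (1, Vt chi 1 la)].
Proof.
move=> cl; apply: green_iso; [exact: mon_wmod|exact: V1_wmod|].
by have := V1_mul la eps; rewrite chr_mulr1.
Qed.

Lemma Phi_var v : greenEq chi (Phi [:: (1, (eps, [:: v]))]) [:: (1, Vv v)].
Proof.
by apply: green_iso; [apply: mon_wmod; exact: wmod_eps|exact: Vv_wmod|exact: mon1].
Qed.

Lemma Phi_x al : al != 0 ->
  greenEq chi (Phi [:: (1, (eps, [:: VX (xclass xi al)]))]) [:: (1, Vtb chi sb 1 eps (al ^+ s'))].
Proof.
move=> al0; apply: green_trans (Phi_var _) _; rewrite /= bt_xclass //.
have H := Cyc_Vtb eps (al ^+ s'); have wC := Cyc_wmod (al ^+ s') wmod_eps.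
by apply: green_iso => //; apply: wmod_iso wC H.
Qed.

Lemma Phi_cat f g : Phi (f ++ g) = Phi f ++ Phi g.
Proof. exact: map_cat. Qed.

Lemma Phi_properties :
  (forall f, valid_fskew xi f -> valid_fsum chi (Phi f)) /\
  (forall f g, valid_fskew xi f -> valid_fskew xi g -> eqA f g -> greenEq chi (Phi f) (Phi g)) /\
  (forall f g, valid_fskew xi f -> valid_fskew xi g -> greenEq chi (Phi (f ++ g)) (Phi f ++ Phi g)) /\
  (forall f g, valid_fskew xi f -> valid_fskew xi g ->
     greenEq chi (Phi (skmul a s f g)) (grmul a (Phi f) (Phi g))) /\
  (forall l, is_character l -> greenEq chi (Phi [:: (1, (l, [::]))]) [:: (1, Vt chi 1 l)]) /\
  greenEq chi (Phi [:: (1, (eps, [:: VY]))]) [:: (1, Vt chi 2 eps)] /\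
  greenEq chi (Phi [:: (1, (eps, [:: VZ]))]) [:: (1, Vt chi s.+1 eps)] /\
  (forall al, al != 0 ->
     greenEq chi (Phi [:: (1, (eps, [:: VX (xclass xi al)]))]) [:: (1, Vtb chi sb 1 eps (al ^+ s'))]) /\
  (forall f, valid_fskew xi f -> (greenEq chi (Phi f) [::] <-> inJ f)) /\
  (forall F, valid_fsum chi F -> exists f, valid_fskew xi f /\ greenEq chi (Phi f) F).
Proof.
split; first exact: Phi_valid.
split; first exact: Phi_eqA.
split; first by move=> f g _ _; rewrite Phi_cat; apply: green_refl.
split; first exact: Phi_mul.
split; first exact: Phi_char.
split; first exact: (Phi_var VY).
split; first exact: (Phi_var VZ).
split; first exact: Phi_x.
split; last exact: Phi_surj.
by move=> f vf; split; [exact: Phi_inj|exact: inJ_Phi].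
Qed.

End Standard.

Unset Implicit Arguments.

Theorem theorem4p16 (k : closedFieldType) (G : groupType) (a : G) (chi : G -> k)
    (sb s s' : nat) (xi : k) :
  [pchar k] =i pred0 ->
  (forall g, (a * g = g * a)%g) ->
  is_character chi -> chi a != 1 ->
  chr_order chi sb ->
  s.-primitive_root (chi a)^-1 ->
  sb = (s * s')%N ->
  s'.-primitive_root xi ->
  exists Phi : fskew k G -> fsum k G,
    (* Phi takes values in (formal sums of) weight modules *)
    (forall f, valid_fskew xi f -> valid_fsum chi (Phi f)) /\
    (* well defined on Z[X] # \hat G *)
    (forall f g, valid_fskew xi f -> valid_fskew xi g -> eqA f g ->
       greenEq chi (Phi f) (Phi g)) /\
    (* additive *)
    (forall f g, valid_fskew xi f -> valid_fskew xi g ->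
       greenEq chi (Phi (f ++ g)) (Phi f ++ Phi g)) /\
    (* multiplicative *)
    (forall f g, valid_fskew xi f -> valid_fskew xi g ->
       greenEq chi (Phi (skmul a s f g)) (grmul a (Phi f) (Phi g))) /\
    (* values on the generators *)
    (forall l, is_character l ->
       greenEq chi (Phi [:: (1, (l, [::]))]) [:: (1, Vt chi 1 l)]) /\
    greenEq chi (Phi [:: (1, (@chr_one k G, [:: VY]))])
                [:: (1, Vt chi 2 (@chr_one k G))] /\
    greenEq chi (Phi [:: (1, (@chr_one k G, [:: VZ]))])
                [:: (1, Vt chi s.+1 (@chr_one k G))] /\
    (forall al, al != 0 ->
       greenEq chi (Phi [:: (1, (@chr_one k G, [:: VX (xclass xi al)]))])
                   [:: (1, Vtb chi sb 1 (@chr_one k G) (al ^+ s'))]) /\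
    (* kernel is J *)
    (forall f, valid_fskew xi f ->
       (greenEq chi (Phi f) [::] <-> inJ a chi sb s s' xi f)) /\
    (* surjective *)
    (forall F, valid_fsum chi F ->
       exists f, valid_fskew xi f /\ greenEq chi (Phi f) F).
Proof.
move=> ch0 a_central chi_char chi_a chi_ord q_prim sbE xi_prim; exists (@Phi k G a chi sb s s').
exact: Phi_properties.
Qed.
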